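(* Let $D(\lambda)=\begin{pmatrix}2i&\lambda^{-1}+\lambda\bar b\\\lambda^{-1}b+\lambda&-2i\end{pmatrix}$ with $b\in\mathbb C$, $|1+b|<2$, $b\neq-1$ (the degree one potential with $a=1$, $c=2$; then $\det D(1)>0$). Put $\ell=\sqrt{\det D(1)}=\sqrt{3-2\,\mathrm{Re}\,b-|b|^2}\in(0,2)$. Let $v_1,v_2$ be eigenvectors of $D(1)$ for the eigenvalues $i\ell$, $-i\ell$ with $(v_1,v_2)\in\mathrm{SU}_{1,1}$, and let $S\in\Lambda\mathrm{SU}_{1,1\sigma}$ be defined by $S^{-1}=\mathrm{diag}(\lambda^{1/2},\lambda^{-1/2})\,(v_1,v_2)\,\mathrm{diag}(\lambda^{-1/2},\lambda^{1/2})$. Then, for a suitable normalization of $v_1,v_2$, the minimal surface $f$ generated by $(D,S)$ satisfies $f(z+t)=\rho_t.f(z)$ with $\rho_t=\Big(\big(\mathrm{Re}(\alpha(1-e^{2i\ell t})),\ \mathrm{Im}(\alpha(1-e^{2i\ell t})),\ 2\ell t\,\mathfrak c-\tfrac{|\alpha|^2}{2}\sin(2\ell t)\big),\ e^{2i\ell t}\Big)$, i.e. $f$ is a helicoidal minimal surface with respect to the vertical axis through $(\mathrm{Re}\,\alpha,\mathrm{Im}\,\alpha,0)$ with pitch $\mathfrak c$, where $\alpha=\dfrac{i(2+\ell)(-6+\bar b+b(3+2\,\mathrm{Re}\,b)+4\ell)}{\ell^2(1+b)\sqrt{4-\ell^2}}$ and $\mathfrak c=\dfrac{-2\big(3\,\mathrm{Re}\,b-(\mathrm{Re}\,b)^2-|b|^2\mathrm{Re}\,b-|b|^2\big)}{\ell^4}$.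 Moreover $f$ is a rotational surface (pitch $0$) if and only if $3\,\mathrm{Re}\,b-(\mathrm{Re}\,b)^2-|b|^2\mathrm{Re}\,b-|b|^2=0$. Conversely, the degree one potential of any helicoidal minimal surface (not translation invariant) satisfies $\det D(1)>0$.
   Context: $\mathrm{Nil}_3$: $\mathbb R^3$ with group law $(a_1,a_2,a_3)\cdot(x_1,x_2,x_3)=(a_1+x_1,a_2+x_2,a_3+x_3+\tfrac12(a_1x_2-a_2x_1))$; $\mathrm{Iso}_\circ(\mathrm{Nil}_3)\cong\mathrm{Nil}_3\rtimes\mathrm U_1$ with $(p,e^{i\theta}).x=p\cdot(\cos\theta x_1-\sin\theta x_2,\sin\theta x_1+\cos\theta x_2,x_3)$. A helicoidal motion with pitch $\mathfrak c$ along the axis through $\alpha=(a_1,a_2,0)\equiv a_1+ia_2$ is $t\mapsto\big((\mathrm{Re}(\alpha(1-e^{it})),\mathrm{Im}(\alpha(1-e^{it})),\mathfrak ct-\tfrac{|\alpha|^2}2\sin t),e^{it}\big)$. $\mathrm{SU}_{1,1}$ preserves the Hermitian form $|x|^2-|y|^2$. Loop groups: $\sigma_3=\mathrm{diag}(1,-1)$; $\Lambda\mathrm{SL}_2\mathbb C_\sigma$: loops $g:\mathbb S^1\to\mathrm{SL}_2\mathbb C$ with $g(-\lambda)=\sigma_3g(\lambda)\sigma_3$; $\Lambda^+\mathrm{SL}_2\mathbb C_\sigma$: those holomorphic on $|\lambda|<1$; $\Lambda\mathrm{SU}_{1,1\sigma}$: those with $\sigma_3({}^t\overline{g(1/\bar\lambda)})^{-1}\sigma_3=g(\lambda)$.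 A degree one potential is $D(\lambda)=\begin{pmatrix}ic&\lambda^{-1}a+\lambda\bar b\\\lambda^{-1}b+\lambda\bar a&-ic\end{pmatrix}$, $c\in\mathbb R$, $a,b\in\mathbb C$; $\det D(1)=c^2-|a+\bar b|^2$. The surface generated by $(D,S)$: $C=\exp(zD(\lambda))$, Iwasawa decomposition $C=\hat FV_+$ near the real axis ($\hat F\in\Lambda\mathrm{SU}_{1,1\sigma}$, $V_+\in\Lambda^+\mathrm{SL}_2\mathbb C_\sigma$ with positive diagonal at $\lambda=0$), $F=S\hat F$, then the Sym formula $f_{\mathbb L_3}=-i\lambda(\partial_\lambda F)F^{-1}-\tfrac i2F\sigma_3F^{-1}$, $\hat f=(f_{\mathbb L_3})^o-\tfrac i2\lambda(\partial_\lambda f_{\mathbb L_3})^d$; at $\lambda=1$, $\hat f=x_1\mathcal E_1+x_2\mathcal E_2+x_3\mathcal E_3$ with $\mathcal E_1=\tfrac12\begin{pmatrix}0&i\\-i&0\end{pmatrix}$, $\mathcal E_2=\tfrac12\begin{pmatrix}0&-1\\-1&0\end{pmatrix}$, $\mathcal E_3=\tfrac12\begin{pmatrix}-i&0\\0&i\end{pmatrix}$, and the surface is $z\mapsto(x_1,x_2,x_3)$. *)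

(* Defs.v *)
From Stdlib Require Import Reals Lra Arith Factorial.
Open Scope R_scope.

Record Cx := mkC { cre : R ; cim : R }.
Definition Cr (x : R) : Cx := mkC x 0.
Definition Czero : Cx := Cr 0.
Definition Cone : Cx := Cr 1.
Definition Ci : Cx := mkC 0 1.
Definition Cadd (z w : Cx) : Cx := mkC (cre z + cre w) (cim z + cim w).
Definition Copp (z : Cx) : Cx := mkC (- cre z) (- cim z).
Definition Csub (z w : Cx) : Cx := Cadd z (Copp w).
Definition Cmul (z w : Cx) : Cx :=
  mkC (cre z * cre w - cim z * cim w) (cre z * cim w + cim z * cre w).
Definition Cconj (z : Cx) : Cx := mkC (cre z) (- cim z).
Definition Cnormsq (z : Cx) : R := cre z * cre z + cim z * cim z.
Definition Cabs (z : Cx) : R := sqrt (Cnormsq z).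
Definition Cinv (z : Cx) : Cx := mkC (cre z / Cnormsq z) (- cim z / Cnormsq z).
Definition Cdiv (z w : Cx) : Cx := Cmul z (Cinv w).
Definition Ccis (t : R) : Cx := mkC (cos t) (sin t).

Record M2 := mkM { a11 : Cx ; a12 : Cx ; a21 : Cx ; a22 : Cx }.
Definition Mmul (A B : M2) : M2 :=
  mkM (Cadd (Cmul (a11 A) (a11 B)) (Cmul (a12 A) (a21 B)))
      (Cadd (Cmul (a11 A) (a12 B)) (Cmul (a12 A) (a22 B)))
      (Cadd (Cmul (a21 A) (a11 B)) (Cmul (a22 A) (a21 B)))
      (Cadd (Cmul (a21 A) (a12 B)) (Cmul (a22 A) (a22 B))).
Definition Madd (A B : M2) : M2 :=
  mkM (Cadd (a11 A) (a11 B)) (Cadd (a12 A) (a12 B))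
      (Cadd (a21 A) (a21 B)) (Cadd (a22 A) (a22 B)).
Definition Mscal (k : Cx) (A : M2) : M2 :=
  mkM (Cmul k (a11 A)) (Cmul k (a12 A)) (Cmul k (a21 A)) (Cmul k (a22 A)).
Definition Msub (A B : M2) : M2 := Madd A (Mscal (Copp Cone) B).
Definition Mid : M2 := mkM Cone Czero Czero Cone.
Definition Mzero : M2 := mkM Czero Czero Czero Czero.
Definition Mdet (A : M2) : Cx := Csub (Cmul (a11 A) (a22 A)) (Cmul (a12 A) (a21 A)).
Definition Minv (A : M2) : M2 :=
  Mscal (Cinv (Mdet A)) (mkM (a22 A) (Copp (a12 A)) (Copp (a21 A)) (a11 A)).
Definition Mstar (A : M2) : M2 :=
  mkM (Cconj (a11 A)) (Cconj (a21 A)) (Cconj (a12 A)) (Cconj (a22 A)).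
Definition sigma3 : M2 := mkM Cone Czero Czero (Copp Cone).
Definition Moff (A : M2) : M2 := mkM Czero (a12 A) (a21 A) Czero.
Definition Mdiag (A : M2) : M2 := mkM (a11 A) Czero Czero (a22 A).

Definition Cconv (u : nat -> Cx) (l : Cx) : Prop :=
  Un_cv (fun n => cre (u n)) (cre l) /\ Un_cv (fun n => cim (u n)) (cim l).
Definition Mconv (u : nat -> M2) (L : M2) : Prop :=
  Cconv (fun n => a11 (u n)) (a11 L) /\ Cconv (fun n => a12 (u n)) (a12 L) /\
  Cconv (fun n => a21 (u n)) (a21 L) /\ Cconv (fun n => a22 (u n)) (a22 L).

Fixpoint Mpow (X : M2) (n : nat) : M2 :=
  match n with O => Mid | S k => Mmul X (Mpow X k) end.
Fixpoint Mexp_partial (X : M2) (N : nat) : M2 :=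
  match N with
  | O => Mid
  | S k => Madd (Mexp_partial X k) (Mscal (Cr (/ INR (fact (S k)))) (Mpow X (S k)))
  end.
Definition IsMexp (X E : M2) : Prop := Mconv (Mexp_partial X) E.

Definition Cdiff_at (g : Cx -> Cx) (z0 : Cx) : Prop :=
  exists L : Cx, forall eps, 0 < eps -> exists delta, 0 < delta /\
    forall h, 0 < Cabs h < delta ->
      Cabs (Csub (Csub (g (Cadd z0 h)) (g z0)) (Cmul L h)) <= eps * Cabs h.
Definition Ccont_disk_at (g : Cx -> Cx) (z0 : Cx) : Prop :=
  forall eps, 0 < eps -> exists delta, 0 < delta /\
    forall w, Cabs w <= 1 -> Cabs (Csub w z0) < delta -> Cabs (Csub (g w) (g z0)) < eps.
Definition Mentry_prop (P : (Cx -> Cx) -> Prop) (G : Cx -> M2) : Prop :=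
  P (fun w => a11 (G w)) /\ P (fun w => a12 (G w)) /\
  P (fun w => a21 (G w)) /\ P (fun w => a22 (G w)).

(* ---------- loop groups (loops = maps on the unit circle |lambda| = 1) ---------- *)
Definition Loop := Cx -> M2.

Definition InLoopSL (g : Loop) : Prop :=
  forall lam, Cabs lam = 1 ->
    Mdet (g lam) = Cone /\ g (Copp lam) = Mmul sigma3 (Mmul (g lam) sigma3).

Definition InLoopSU (g : Loop) : Prop :=
  InLoopSL g /\
  forall lam, Cabs lam = 1 ->
    Mmul sigma3 (Mmul (Minv (Mstar (g (Cinv (Cconj lam))))) sigma3) = g lam.

Definition InLoopPlusPos (g : Loop) : Prop :=
  InLoopSL g /\
  exists G : Cx -> M2,
    (forall lam, Cabs lam = 1 -> G lam = g lam) /\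
    (forall w, Cabs w < 1 -> Mentry_prop (fun h => Cdiff_at h w) G) /\
    (forall w, Cabs w <= 1 -> Mentry_prop (fun h => Ccont_disk_at h w) G) /\
    0 < cre (a11 (G Czero)) /\ cim (a11 (G Czero)) = 0 /\
    0 < cre (a22 (G Czero)) /\ cim (a22 (G Czero)) = 0.

Definition Dpot (a b : Cx) (c : R) (lam : Cx) : M2 :=
  mkM (Cmul Ci (Cr c))
      (Cadd (Cmul (Cinv lam) a) (Cmul lam (Cconj b)))
      (Cadd (Cmul (Cinv lam) b) (Cmul lam (Cconj a)))
      (Copp (Cmul Ci (Cr c))).

Definition Cderiv_th (h : R -> Cx) (t0 : R) (l : Cx) : Prop :=
  derivable_pt_lim (fun t => cre (h t)) t0 (cre l) /\
  derivable_pt_lim (fun t => cim (h t)) t0 (cim l).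
Definition Mderiv_th (h : R -> M2) (t0 : R) (L : M2) : Prop :=
  Cderiv_th (fun t => a11 (h t)) t0 (a11 L) /\ Cderiv_th (fun t => a12 (h t)) t0 (a12 L) /\
  Cderiv_th (fun t => a21 (h t)) t0 (a21 L) /\ Cderiv_th (fun t => a22 (h t)) t0 (a22 L).
(* For h(t) = g(e^{it}):  (lambda d/dlambda g)(e^{it0}) = -i d/dt h(t0). *)
Definition LamDlam (h : R -> M2) (t0 : R) (M : M2) : Prop :=
  exists d, Mderiv_th h t0 d /\ M = Mscal (Copp Ci) d.

Definition half_i : Cx := Cmul Ci (Cr (/2)).

(* f_L3 on the circle, written as a function of t (lambda = e^{it}),
   given lamdF t = (lambda d_lambda F)(e^{it}) *)
Definition fL3 (F : Loop) (lamdF : R -> M2) (t : R) : M2 :=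
  Msub (Mscal (Copp Ci) (Mmul (lamdF t) (Minv (F (Ccis t)))))
       (Mscal half_i (Mmul (F (Ccis t)) (Mmul sigma3 (Minv (F (Ccis t)))))).

Definition SymHat (F : Loop) (X : M2) : Prop :=
  exists lamdF : R -> M2,
    (forall t, LamDlam (fun s => F (Ccis s)) t (lamdF t)) /\
    exists lamdf : M2,
      LamDlam (fL3 F lamdF) 0 lamdf /\
      X = Msub (Moff (fL3 F lamdF 0)) (Mscal half_i (Mdiag lamdf)).

Definition R3 := (R * R * R)%type.
Definition p1 (p : R3) : R := fst (fst p).
Definition p2 (p : R3) : R := snd (fst p).
Definition p3 (p : R3) : R := snd p.

Definition E1 : M2 := Mscal (Cr (/2)) (mkM Czero Ci (Copp Ci) Czero).
Definition E2 : M2 := Mscal (Cr (/2)) (mkM Czero (Copp Cone) (Copp Cone) Czero).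
Definition E3 : M2 := Mscal (Cr (/2)) (mkM (Copp Ci) Czero Czero Ci).
Definition XE (p : R3) : M2 :=
  Madd (Mscal (Cr (p1 p)) E1) (Madd (Mscal (Cr (p2 p)) E2) (Mscal (Cr (p3 p)) E3)).

Definition SurfPt (D : Cx -> M2) (S : Loop) (z : Cx) (p : R3) : Prop :=
  exists Fh Vp : Loop,
    InLoopSU Fh /\ InLoopPlusPos Vp /\
    (forall lam, Cabs lam = 1 -> IsMexp (Mscal z (D lam)) (Mmul (Fh lam) (Vp lam))) /\
    SymHat (fun lam => Mmul (S lam) (Fh lam)) (XE p).

Definition Copen (U : Cx -> Prop) : Prop :=
  forall z, U z -> exists r, 0 < r /\ forall w, Cabs (Csub w z) < r -> U w.

Definition Generated (D : Cx -> M2) (S : Loop) (f : Cx -> R3) (U : Cx -> Prop) : Prop :=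
  (forall x : R, U (Cr x)) /\ Copen U /\ forall z, U z -> SurfPt D S z (f z).

Definition nil_mul (a x : R3) : R3 :=
  (p1 a + p1 x, p2 a + p2 x, p3 a + p3 x + / 2 * (p1 a * p2 x - p2 a * p1 x)).
Definition Iso := (R3 * R)%type.   (* (p, theta) stands for (p, e^{i theta}) *)
Definition act (g : Iso) (x : R3) : R3 :=
  let th := snd g in
  nil_mul (fst g) (cos th * p1 x - sin th * p2 x, sin th * p1 x + cos th * p2 x, p3 x).

Definition helic (alpha : Cx) (c : R) (s : R) : Iso :=
  let w := Cmul alpha (Csub Cone (Ccis s)) in
  ((cre w, cim w, c * s - Cnormsq alpha / 2 * sin s), s).

Definition Cplus_real (z : Cx) (t : R) : Cx := Cadd z (Cr t).

Definition Equivariant (f : Cx -> R3) (U : Cx -> Prop) (g : R -> Iso) : Prop :=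
  forall z t, U z -> U (Cplus_real z t) -> f (Cplus_real z t) = act (g t) (f z).

Definition Helicoidal (f : Cx -> R3) (U : Cx -> Prop) : Prop :=
  exists alpha c kappa, kappa <> 0 /\ Equivariant f U (fun t => helic alpha c (kappa * t)).
Definition Rotational (f : Cx -> R3) (U : Cx -> Prop) : Prop :=
  exists alpha kappa, kappa <> 0 /\ Equivariant f U (fun t => helic alpha 0 (kappa * t)).
Definition TranslationInvariant (f : Cx -> R3) (U : Cx -> Prop) : Prop :=
  exists v : R3, v <> (0, 0, 0) /\
    Equivariant f U (fun t => ((t * p1 v, t * p2 v, t * p3 v), 0)).

Definition cross (u v : R3) : R3 :=
  (p2 u * p3 v - p3 u * p2 v, p3 u * p1 v - p1 u * p3 v, p1 u * p2 v - p2 u * p1 v).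
Definition R3deriv (h : R -> R3) (t0 : R) (d : R3) : Prop :=
  derivable_pt_lim (fun t => p1 (h t)) t0 (p1 d) /\
  derivable_pt_lim (fun t => p2 (h t)) t0 (p2 d) /\
  derivable_pt_lim (fun t => p3 (h t)) t0 (p3 d).
Definition ImmersedAt (f : Cx -> R3) (z0 : Cx) : Prop :=
  exists fx fy : R3,
    R3deriv (fun x => f (mkC x (cim z0))) (cre z0) fx /\
    R3deriv (fun y => f (mkC (cre z0) y)) (cim z0) fy /\
    cross fx fy <> (0, 0, 0).

Definition ell (b : Cx) : R := sqrt (3 - 2 * cre b - Cnormsq b).
Definition pitch_num (b : Cx) : R :=
  3 * cre b - cre b ^ 2 - Cnormsq b * cre b - Cnormsq b.
Definition pitch (b : Cx) : R := -2 * pitch_num b / ell b ^ 4.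
Definition alpha_of (b : Cx) : Cx :=
  let l := ell b in
  Cdiv (Cmul (Cmul Ci (Cr (2 + l)))
             (Cadd (Cadd (Cadd (Cr (-6)) (Cconj b)) (Cmul b (Cr (3 + 2 * cre b)))) (Cr (4 * l))))
       (Cmul (Cmul (Cr (l ^ 2)) (Cadd Cone b)) (Cr (sqrt (4 - l ^ 2)))).

(* S from P = (v1,v2):  S^{-1}(lambda) = diag(lambda^{1/2},lambda^{-1/2}) P diag(lambda^{-1/2},lambda^{1/2}) *)
Definition Sinv_of (P : M2) (lam : Cx) : M2 :=
  mkM (a11 P) (Cmul lam (a12 P)) (Cmul (Cinv lam) (a21 P)) (a22 P).
Definition S_of (P : M2) : Loop := fun lam => Minv (Sinv_of P lam).

Definition good_eigenframe (D1 : M2) (l : R) (P : M2) : Prop :=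
  Mdet P = Cone /\ Mmul (Mstar P) (Mmul sigma3 P) = sigma3 /\
  Mmul D1 P = Mmul P (mkM (Cmul Ci (Cr l)) Czero Czero (Copp (Cmul Ci (Cr l)))).

(* Main.v *)
From Stdlib Require Import Reals Lra Lia Factorial ClassicalEpsilon Ranalysis5.
From Coquelicot Require Import Rbar Rcomplements Hierarchy Continuity Derive RInt RInt_analysis AutoDerive Series PSeries Lim_seq Compactness ElemFct.
Require Import Defs.
Open Scope R_scope.
Set Bullet Behavior "Strict Subproofs".

(** For real [t] the loop [exp (t D)] lies in SU(1,1), so uniqueness of the Iwasawa
    decomposition gives [F(z+t) = M(t) F(z)] with [M(t) = S exp(t D) S^-1]. Uniqueness
    reduces to the fact that a function holomorphic in the disk and real on the circle is
    constant there, which follows from the mean value property applied to the function and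
    to its square; the mean value property is Goursat's theorem in the coordinates
    [w = e^(s + i t)]. Writing [lambda = e^(i theta)], the Sym formula turns [F] into
    [Y = - F_theta F^-1 - (i/2) F sigma_3 F^-1], which transforms by
    [Y(z+t) = - M_theta M^-1 + M Y(z) M^-1]. For the eigenvector frame, [M] is diagonal at
    [lambda = 1], and its derivatives up to order two, computed from
    [exp (t B) = cos (t r) + sin (t r) / r B] with [r^2 = det D], give [alpha] and the pitch.

    Conversely, in differences [Y(z+s) - Y(z)] the inhomogeneous term cancels. Helicoidality
    says that the off-diagonal part of such a difference is rotated by [Ad M(t)]; two
    derivatives in [t] force the generator of [M] at [lambda = 1] to be diagonal and nonzero,
    unless the surface lies in a vertical line.

    For the existence of the surface, the Iwasawa decomposition of [exp (i y D)] is found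
    by integrating the Lax equation: the metric factor is obtained by a quadrature, [V_+]
    solves a linear equation whose coefficient is a polynomial in [lambda], so it is an entire
    power series in [lambda] whose coefficients are iterated integrals, and
    [exp (i y D) V_+^-1] turns out to be SU(1,1)-valued. *)

(** A surface point is described by the mere existence of Iwasawa factors at z, with no relation
    between the factors at different points; every comparison of f(z+t) with f(z) therefore rests on
    uniqueness of the factorization. In the converse S is an arbitrary loop, so the
    differentiability of M in the angle has to be recovered from the frames, as F(z+t) F(z)^-1.

    With 1 + b = n exp(-i psi) and l = [ell b] one has n^2 + l^2 = 4. The eigenvectors of D(1) then
    form a hyperbolic rotation whose squared entries are rational in l, twisted by the phase psi/2,
    and axis and pitch become short expressions in n, l and psi.

    For existence, isospectrality of the Lax equation fixes q^2 = 3 - N + exp(-2x) + N exp(2x) with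
    N = |b|^2. Taking x instead of y = Im z as independent variable turns the nonlinear equation
    dx/dy = 2q into an integral. The condition |1 + b| < 2 forces N < 9, which keeps q^2 positive
    for every real x.

    The degenerate case of the converse, a surface inside a vertical line, is excluded by a point
    where f is an immersion. *)

(** * Complex numbers, the modulus and the unit circle *)

Lemma Cx_eq (z w : Cx) : cre z = cre w -> cim z = cim w -> z = w.
Proof. destruct z, w; simpl; intros; subst; reflexivity. Qed.

Ltac cx_solve := apply Cx_eq; simpl; try ring.

Lemma Cnormsq_pos (z : Cx) : z <> Czero -> 0 < Cnormsq z.
Proof.
  intros H. unfold Cnormsq. destruct z as [x y]; simpl.
  destruct (Req_dec x 0) as [->|Hx]; [destruct (Req_dec y 0) as [->|Hy]|].
  - exfalso; apply H; reflexivity.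
  - nra.
  - nra.
Qed.

Lemma Cone_neq_Czero : Cone <> Czero.
Proof. intros H. apply (f_equal cre) in H. simpl in H. lra. Qed.

Lemma Cx_field_theory : field_theory Czero Cone Cadd Cmul Csub Copp Cdiv Cinv (@eq Cx).
Proof.
  constructor; [constructor|..]; intros; try (cx_solve; fail).
  - apply Cone_neq_Czero.
  - apply Cnormsq_pos in H.
    apply Cx_eq; unfold Cinv, Cmul; simpl; unfold Cnormsq in *; field; lra.
Qed.
Add Field Cx_field : Cx_field_theory.

Lemma M2_eq (A B : M2) :
  a11 A = a11 B -> a12 A = a12 B -> a21 A = a21 B -> a22 A = a22 B -> A = B.
Proof. destruct A, B; simpl; intros; subst; reflexivity. Qed.

Ltac msolve := apply M2_eq; simpl; try ring.

Lemma Cconj_add z w : Cconj (Cadd z w) = Cadd (Cconj z) (Cconj w).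
Proof. cx_solve. Qed.
Lemma Cconj_mul z w : Cconj (Cmul z w) = Cmul (Cconj z) (Cconj w).
Proof. cx_solve. Qed.
Lemma Cconj_opp z : Cconj (Copp z) = Copp (Cconj z).
Proof. cx_solve. Qed.
Lemma Cconj_sub z w : Cconj (Csub z w) = Csub (Cconj z) (Cconj w).
Proof. cx_solve. Qed.
Lemma Cconj_conj z : Cconj (Cconj z) = z.
Proof. cx_solve. Qed.
Lemma Cconj_Cr x : Cconj (Cr x) = Cr x.
Proof. cx_solve. Qed.
Lemma Cconj_Ci : Cconj Ci = Copp Ci.
Proof. cx_solve. Qed.
Lemma Cconj_Czero : Cconj Czero = Czero.
Proof. cx_solve. Qed.
Lemma Cconj_Cone : Cconj Cone = Cone.
Proof. cx_solve. Qed.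
Ltac cconj_simpl :=
  repeat rewrite ?Cconj_add, ?Cconj_mul, ?Cconj_opp, ?Cconj_sub, ?Cconj_conj,
    ?Cconj_Cr, ?Cconj_Ci, ?Cconj_Czero, ?Cconj_Cone.
Lemma Cnormsq_mul z w : Cnormsq (Cmul z w) = Cnormsq z * Cnormsq w.
Proof. unfold Cnormsq; simpl; ring. Qed.
Lemma Cmul_conj z : Cmul z (Cconj z) = Cr (Cnormsq z).
Proof. unfold Cnormsq; cx_solve. Qed.
Lemma Cr_add x y : Cr (x + y) = Cadd (Cr x) (Cr y).
Proof. cx_solve. Qed.
Lemma Cr_mul x y : Cr (x * y) = Cmul (Cr x) (Cr y).
Proof. cx_solve. Qed.
Lemma Cr_opp x : Cr (- x) = Copp (Cr x).
Proof. cx_solve. Qed.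
Lemma Cr_inj x y : Cr x = Cr y -> x = y.
Proof. intros H. exact (f_equal cre H). Qed.
Lemma Ci_sqr : Cmul Ci Ci = Copp Cone.
Proof. cx_solve. Qed.
Lemma Cmul_eq0 z w : Cmul z w = Czero -> z = Czero \/ w = Czero.
Proof.
  intros H. destruct (excluded_middle_informative (z = Czero)) as [|n]; [now left|right].
  replace w with (Cmul (Cinv z) (Cmul z w)) by (field; exact n).
  rewrite H. ring.
Qed.

Lemma Cabs_nonneg z : 0 <= Cabs z.
Proof. apply sqrt_pos. Qed.
Lemma Cnormsq_nonneg z : 0 <= Cnormsq z.
Proof. unfold Cnormsq. nra. Qed.
Lemma Cabs_sqr z : Cabs z * Cabs z = Cnormsq z.
Proof. apply sqrt_sqrt, Cnormsq_nonneg. Qed.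
Lemma Cabs_mul z w : Cabs (Cmul z w) = Cabs z * Cabs w.
Proof. unfold Cabs. rewrite Cnormsq_mul. apply sqrt_mult; apply Cnormsq_nonneg. Qed.
Lemma Cabs_Cr x : Cabs (Cr x) = Rabs x.
Proof.
  unfold Cabs, Cnormsq; simpl. replace (x * x + 0 * 0) with (Rsqr x) by (unfold Rsqr; ring).
  apply sqrt_Rsqr_abs.
Qed.
Lemma Cabs_conj z : Cabs (Cconj z) = Cabs z.
Proof. unfold Cabs, Cnormsq; simpl. f_equal; ring. Qed.
Lemma Cabs_opp z : Cabs (Copp z) = Cabs z.
Proof. unfold Cabs, Cnormsq; simpl. f_equal; ring. Qed.
Lemma Cabs_cre z : Rabs (cre z) <= Cabs z.
Proof.
  unfold Cabs. rewrite <- sqrt_Rsqr_abs. apply sqrt_le_1_alt.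
  unfold Rsqr, Cnormsq; nra.
Qed.
Lemma Cabs_cim z : Rabs (cim z) <= Cabs z.
Proof.
  unfold Cabs. rewrite <- sqrt_Rsqr_abs. apply sqrt_le_1_alt.
  unfold Rsqr, Cnormsq; nra.
Qed.
Lemma Cabs_add z w : Cabs (Cadd z w) <= Cabs z + Cabs w.
Proof.
  pose proof (Cabs_nonneg z). pose proof (Cabs_nonneg w).
  pose proof (Cabs_nonneg (Cadd z w)).
  apply Rsqr_incr_0_var; [|lra]. unfold Rsqr.
  replace ((Cabs z + Cabs w) * (Cabs z + Cabs w))
    with (Cabs z * Cabs z + Cabs w * Cabs w + 2 * (Cabs z * Cabs w)) by ring.
  rewrite !Cabs_sqr.
  assert (Hk : cre z * cre w + cim z * cim w <= Cabs z * Cabs w).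
  { replace (Cabs z * Cabs w) with (Cabs (Cmul (Cconj z) w))
      by (rewrite Cabs_mul, Cabs_conj; reflexivity).
    eapply Rle_trans; [|apply Cabs_cre]. eapply Rle_trans; [|apply Rle_abs].
    simpl; lra. }
  unfold Cnormsq; simpl; nra.
Qed.
Lemma Cabs_le_sum z : Cabs z <= Rabs (cre z) + Rabs (cim z).
Proof.
  replace z with (Cadd (Cr (cre z)) (Cmul Ci (Cr (cim z)))) at 1 by cx_solve.
  eapply Rle_trans; [apply Cabs_add|].
  rewrite Cabs_mul, !Cabs_Cr.
  replace (Cabs Ci) with 1; [lra|].
  unfold Cabs, Cnormsq; simpl. replace (0 * 0 + 1 * 1) with 1 by ring. now rewrite sqrt_1.
Qed.
Lemma Cabs_0_eq z : Cabs z = 0 -> z = Czero.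
Proof.
  intros H. destruct (excluded_middle_informative (z = Czero)) as [|n]; [easy|].
  apply Cnormsq_pos in n. rewrite <- Cabs_sqr, H in n. lra.
Qed.
Lemma Cabs_pos z : z <> Czero -> 0 < Cabs z.
Proof. intros H. apply sqrt_lt_R0, Cnormsq_pos, H. Qed.
Lemma Cabs_1_normsq z : Cabs z = 1 <-> Cnormsq z = 1.
Proof.
  split; intros H.
  - rewrite <- Cabs_sqr, H; ring.
  - unfold Cabs; rewrite H; apply sqrt_1.
Qed.
Lemma Cabs_cis t : Cabs (Ccis t) = 1.
Proof.
  apply Cabs_1_normsq. unfold Cnormsq; simpl. pose proof (sin2_cos2 t). unfold Rsqr in H. lra.
Qed.
Lemma Cis_surj z : Cabs z = 1 -> exists t, Ccis t = z.
Proof.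
  intros H. apply Cabs_1_normsq in H. unfold Cnormsq in H. destruct z as [x y]; simpl in H.
  assert (Hx : -1 <= x <= 1) by nra.
  destruct (Rle_dec 0 y) as [Hy|Hy].
  - exists (acos x). apply Cx_eq; simpl; [apply cos_acos; lra|].
    rewrite sin_acos by lra. apply Rsqr_inj; [apply sqrt_pos|lra|].
    rewrite Rsqr_sqrt; unfold Rsqr; nra.
  - exists (- acos x). apply Cx_eq; simpl; [rewrite cos_neg; apply cos_acos; lra|].
    rewrite sin_neg, sin_acos by lra.
    assert (sqrt (1 - Rsqr x) = - y); [|lra]. apply Rsqr_inj; [apply sqrt_pos|lra|].
    rewrite Rsqr_sqrt; unfold Rsqr; nra.
Qed.
Lemma Cinv_unit z : Cabs z = 1 -> Cinv z = Cconj z.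
Proof.
  intros H. apply Cabs_1_normsq in H. unfold Cinv. rewrite H. apply Cx_eq; simpl; field.
Qed.
Lemma unit_neq0 z : Cabs z = 1 -> z <> Czero.
Proof.
  intros H E. rewrite E in H. change Czero with (Cr 0) in H. rewrite Cabs_Cr, Rabs_R0 in H. lra.
Qed.
Lemma Ccis_add s t : Ccis (s + t) = Cmul (Ccis s) (Ccis t).
Proof. apply Cx_eq; simpl; [rewrite cos_plus|rewrite sin_plus]; ring. Qed.
Lemma Ccis_0 : Ccis 0 = Cone.
Proof. apply Cx_eq; simpl; [apply cos_0|apply sin_0]. Qed.

(** * Two by two matrices and SU(1,1)-valued loops *)

Definition Madj (A : M2) : M2 := mkM (a22 A) (Copp (a12 A)) (Copp (a21 A)) (a11 A).

Lemma Cinv_Cone : Cinv Cone = Cone.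
Proof. apply Cx_eq; unfold Cinv, Cnormsq; simpl; field. Qed.
Lemma Minv_det1 A : Mdet A = Cone -> Minv A = Madj A.
Proof. intros H. unfold Minv, Madj. rewrite H, Cinv_Cone. msolve. Qed.

Lemma Mmul_assoc A B C : Mmul A (Mmul B C) = Mmul (Mmul A B) C.
Proof. msolve. Qed.
Lemma Mmul_1l A : Mmul Mid A = A.
Proof. destruct A; msolve. Qed.
Lemma Mmul_1r A : Mmul A Mid = A.
Proof. destruct A; msolve. Qed.
Lemma Mdet_mul A B : Mdet (Mmul A B) = Cmul (Mdet A) (Mdet B).
Proof. unfold Mdet; simpl; ring. Qed.
Lemma Mdet_adj A : Mdet (Madj A) = Mdet A.
Proof. unfold Mdet; simpl; ring. Qed.
Lemma Madj_mul A B : Madj (Mmul A B) = Mmul (Madj B) (Madj A).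
Proof. msolve. Qed.
Lemma Madj_adj A : Madj (Madj A) = A.
Proof. destruct A; msolve. Qed.
Lemma Mmul_adj_r A : Mdet A = Cone -> Mmul A (Madj A) = Mid.
Proof. unfold Mdet; intros H. msolve; rewrite <- H; ring. Qed.
Lemma Mmul_adj_l A : Mdet A = Cone -> Mmul (Madj A) A = Mid.
Proof. unfold Mdet; intros H. msolve; rewrite <- H; ring. Qed.
(* The real algebra of matrices [[p, q], [conj q, conj p]] contains both SU(1,1)
   and su(1,1); it is closed under products, adjugates and derivatives. *)
Definition RF (A : M2) : Prop := a21 A = Cconj (a12 A) /\ a22 A = Cconj (a11 A).

Lemma RF_mul A B : RF A -> RF B -> RF (Mmul A B).
Proof.
  intros [H1 H2] [H3 H4]. split; simpl; rewrite H1, H2, H3, H4; cconj_simpl; ring.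
Qed.
Lemma RF_add A B : RF A -> RF B -> RF (Madd A B).
Proof.
  intros [H1 H2] [H3 H4]. split; simpl; rewrite ?H1, ?H2, ?H3, ?H4; cconj_simpl; ring.
Qed.
Lemma RF_scal x A : RF A -> RF (Mscal (Cr x) A).
Proof. intros [H1 H2]. split; simpl; rewrite ?H1, ?H2; cconj_simpl; ring. Qed.
Lemma RF_adj A : RF A -> RF (Madj A).
Proof. intros [H1 H2]. split; simpl; rewrite ?H1, ?H2; cconj_simpl; ring. Qed.
Lemma Copp_unit lam : Cabs lam = 1 -> Cabs (Copp lam) = 1.
Proof. now rewrite Cabs_opp. Qed.

Lemma Cinv_conj_unit lam : Cabs lam = 1 -> Cinv (Cconj lam) = lam.
Proof. intros H. rewrite Cinv_unit; [apply Cconj_conj|now rewrite Cabs_conj]. Qed.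

(** On the circle 1 / conj lambda = lambda, and for determinant one the inverse is the adjugate. The
    reality condition then just swaps and conjugates entries, which is [RF]. *)
Lemma InLoopSU_iff g :
  InLoopSU g <-> InLoopSL g /\ forall lam, Cabs lam = 1 -> RF (g lam).
Proof.
  split; intros [H1 H2]; (split; [exact H1|]); intros lam Hl;
    specialize (H1 lam Hl); destruct H1 as [Hd _].
  - specialize (H2 lam Hl). rewrite Cinv_conj_unit in H2 by exact Hl.
    assert (Hd' : Mdet (Mstar (g lam)) = Cone).
    { unfold Mdet in *; simpl. rewrite <- Cconj_Cone, <- Hd. cconj_simpl. ring. }
    rewrite (Minv_det1 _ Hd') in H2.
    split.
    + rewrite <- H2 at 1. simpl. cconj_simpl. ring.
    + rewrite <- H2 at 1. simpl. cconj_simpl. ring.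
  - specialize (H2 lam Hl). rewrite Cinv_conj_unit by exact Hl.
    assert (Hd' : Mdet (Mstar (g lam)) = Cone).
    { unfold Mdet in *; simpl. rewrite <- Cconj_Cone, <- Hd. cconj_simpl. ring. }
    rewrite (Minv_det1 _ Hd'). destruct H2 as [H2 H3].
    apply M2_eq; simpl; rewrite ?H2, ?H3; cconj_simpl; ring.
Qed.

Lemma InLoopSL_mul g h : InLoopSL g -> InLoopSL h -> InLoopSL (fun l => Mmul (g l) (h l)).
Proof.
  intros Hg Hh lam Hl. destruct (Hg lam Hl) as [G1 G2], (Hh lam Hl) as [K1 K2].
  split.
  - rewrite Mdet_mul, G1, K1. ring.
  - rewrite G2, K2. msolve.
Qed.
Lemma InLoopSL_adj g : InLoopSL g -> InLoopSL (fun l => Madj (g l)).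
Proof.
  intros Hg lam Hl. destruct (Hg lam Hl) as [G1 G2]. split.
  - now rewrite Mdet_adj.
  - rewrite G2. msolve.
Qed.
Lemma InLoopSU_mul g h : InLoopSU g -> InLoopSU h -> InLoopSU (fun l => Mmul (g l) (h l)).
Proof.
  rewrite !InLoopSU_iff. intros [G1 G2] [K1 K2]. split.
  - now apply InLoopSL_mul.
  - intros; apply RF_mul; auto.
Qed.

(** * Derivatives of matrix-valued curves *)

Lemma Cderiv_ext (f g : R -> Cx) t l :
  (forall s, f s = g s) -> Cderiv_th f t l -> Cderiv_th g t l.
Proof.
  intros H [H1 H2]. split.
  - apply is_derive_Reals. apply is_derive_Reals in H1. eapply is_derive_ext; [|exact H1].
    intros; simpl; now rewrite H.
  - apply is_derive_Reals. apply is_derive_Reals in H2. eapply is_derive_ext; [|exact H2].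
    intros; simpl; now rewrite H.
Qed.
Lemma Cderiv_const c t : Cderiv_th (fun _ => c) t Czero.
Proof. split; simpl; apply derivable_pt_lim_const. Qed.
Lemma Cderiv_add f g t a b :
  Cderiv_th f t a -> Cderiv_th g t b -> Cderiv_th (fun s => Cadd (f s) (g s)) t (Cadd a b).
Proof.
  intros [F1 F2] [G1 G2]. split; simpl.
  - exact (derivable_pt_lim_plus _ _ _ _ _ F1 G1).
  - exact (derivable_pt_lim_plus _ _ _ _ _ F2 G2).
Qed.
Lemma Cderiv_opp f t a : Cderiv_th f t a -> Cderiv_th (fun s => Copp (f s)) t (Copp a).
Proof.
  intros [F1 F2]. split; simpl.
  - exact (derivable_pt_lim_opp _ _ _ F1).
  - exact (derivable_pt_lim_opp _ _ _ F2).
Qed.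
Lemma Cderiv_conj f t a : Cderiv_th f t a -> Cderiv_th (fun s => Cconj (f s)) t (Cconj a).
Proof.
  intros [F1 F2]. split; simpl; [exact F1|].
  exact (derivable_pt_lim_opp _ _ _ F2).
Qed.
Lemma Cderiv_mul f g t a b :
  Cderiv_th f t a -> Cderiv_th g t b ->
  Cderiv_th (fun s => Cmul (f s) (g s)) t (Cadd (Cmul a (g t)) (Cmul (f t) b)).
Proof.
  intros [F1 F2] [G1 G2]. split; simpl.
  - pose proof (derivable_pt_lim_minus _ _ _ _ _ (derivable_pt_lim_mult _ _ _ _ _ F1 G1)
      (derivable_pt_lim_mult _ _ _ _ _ F2 G2)) as H.
    match goal with |- derivable_pt_lim _ _ ?l => match type of H with derivable_pt_lim _ _ ?l' =>
      replace l with l' by ring end end. exact H.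
  - pose proof (derivable_pt_lim_plus _ _ _ _ _ (derivable_pt_lim_mult _ _ _ _ _ F1 G2)
      (derivable_pt_lim_mult _ _ _ _ _ F2 G1)) as H.
    match goal with |- derivable_pt_lim _ _ ?l => match type of H with derivable_pt_lim _ _ ?l' =>
      replace l with l' by ring end end. exact H.
Qed.
Lemma Cderiv_Cr f t a : derivable_pt_lim f t a -> Cderiv_th (fun s => Cr (f s)) t (Cr a).
Proof. intros H. split; simpl; [exact H|apply derivable_pt_lim_const]. Qed.
Lemma Cderiv_cis t : Cderiv_th Ccis t (Cmul Ci (Ccis t)).
Proof.
  split; simpl.
  - replace (0 * cos t - 1 * sin t) with (- sin t) by ring. apply derivable_pt_lim_cos.
  - replace (0 * sin t + 1 * cos t) with (cos t) by ring. apply derivable_pt_lim_sin.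
Qed.
Lemma Cderiv_unique f t a b : Cderiv_th f t a -> Cderiv_th f t b -> a = b.
Proof. intros [F1 F2] [G1 G2]. apply Cx_eq; eapply uniqueness_limite; eauto. Qed.
Lemma Cderiv_loc f g t l eps : 0 < eps ->
  (forall s, Rabs (s - t) < eps -> f s = g s) -> Cderiv_th f t l -> Cderiv_th g t l.
Proof.
  intros He H [H1 H2].
  split; apply is_derive_Reals; [apply is_derive_Reals in H1|apply is_derive_Reals in H2];
    (eapply is_derive_ext_loc; [|eassumption]); exists (mkposreal _ He); intros s Hs;
    rewrite (H s); auto.
Qed.
Lemma Cderiv_0_const (f : R -> Cx) :
  (forall t, Cderiv_th f t Czero) -> forall t, f t = f 0.
Proof.
  intros H t. apply Cx_eq.
  - destruct (Req_dec t 0) as [->|]; [easy|].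
    destruct (MVT_gen (fun s => cre (f s)) 0 t (fun _ => 0)) as [c [_ Hc]].
    + intros. apply is_derive_Reals. apply (H x).
    + intros. apply continuity_pt_filterlim. apply (@ex_derive_continuous _ R_NormedModule).
      exists 0. apply is_derive_Reals, (H x).
    + lra.
  - destruct (Req_dec t 0) as [->|]; [easy|].
    destruct (MVT_gen (fun s => cim (f s)) 0 t (fun _ => 0)) as [c [_ Hc]].
    + intros. apply is_derive_Reals. apply (H x).
    + intros. apply continuity_pt_filterlim. apply (@ex_derive_continuous _ R_NormedModule).
      exists 0. apply is_derive_Reals, (H x).
    + lra.
Qed.

Lemma Mderiv_ext (f g : R -> M2) t l :
  (forall s, f s = g s) -> Mderiv_th f t l -> Mderiv_th g t l.
Proof.
  intros H (H1 & H2 & H3 & H4).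
  repeat split; eapply Cderiv_ext; try eassumption; intros; simpl; now rewrite H.
Qed.
Lemma Mderiv_loc (f g : R -> M2) t l eps : 0 < eps ->
  (forall s, Rabs (s - t) < eps -> f s = g s) -> Mderiv_th f t l -> Mderiv_th g t l.
Proof.
  intros He H (H1 & H2 & H3 & H4).
  repeat split; eapply (Cderiv_loc _ _ _ _ eps He); try eassumption;
    intros; simpl; now rewrite H.
Qed.
Lemma Mderiv_const A t : Mderiv_th (fun _ => A) t Mzero.
Proof. repeat split; simpl; apply derivable_pt_lim_const. Qed.
Lemma Mderiv_add f g t A B :
  Mderiv_th f t A -> Mderiv_th g t B -> Mderiv_th (fun s => Madd (f s) (g s)) t (Madd A B).
Proof.
  intros (F1 & F2 & F3 & F4) (G1 & G2 & G3 & G4).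
  split; [|split; [|split]]; simpl; apply Cderiv_add; assumption.
Qed.
Lemma Mderiv_adj f t A : Mderiv_th f t A -> Mderiv_th (fun s => Madj (f s)) t (Madj A).
Proof.
  intros (F1 & F2 & F3 & F4).
  split; [|split; [|split]]; simpl; try apply Cderiv_opp; assumption.
Qed.
Lemma Mderiv_mul f g t A B :
  Mderiv_th f t A -> Mderiv_th g t B ->
  Mderiv_th (fun s => Mmul (f s) (g s)) t (Madd (Mmul A (g t)) (Mmul (f t) B)).
Proof.
  intros (F1 & F2 & F3 & F4) (G1 & G2 & G3 & G4).
  assert (E : forall x y z w, Cadd (Cadd x y) (Cadd z w) = Cadd (Cadd x z) (Cadd y w))
    by (intros; ring).
  split; [|split; [|split]]; simpl; rewrite E; apply Cderiv_add; apply Cderiv_mul; assumption.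
Qed.
Lemma Mderiv_scal (k : R -> Cx) f t k' A :
  Cderiv_th k t k' -> Mderiv_th f t A ->
  Mderiv_th (fun s => Mscal (k s) (f s)) t (Madd (Mscal k' (f t)) (Mscal (k t) A)).
Proof.
  intros K (F1 & F2 & F3 & F4).
  split; [|split; [|split]]; simpl; apply Cderiv_mul; assumption.
Qed.
Lemma Mderiv_unique f t A B : Mderiv_th f t A -> Mderiv_th f t B -> A = B.
Proof.
  intros (F1 & F2 & F3 & F4) (G1 & G2 & G3 & G4).
  apply M2_eq; eapply Cderiv_unique; eassumption.
Qed.
Lemma Mderiv_eq f t A B : Mderiv_th f t A -> A = B -> Mderiv_th f t B.
Proof. now intros H <-. Qed.
Lemma Mderiv_mul_const_l C f t A :
  Mderiv_th f t A -> Mderiv_th (fun s => Mmul C (f s)) t (Mmul C A).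
Proof.
  intros H. eapply Mderiv_eq; [apply Mderiv_mul; [apply Mderiv_const|exact H]|]. msolve.
Qed.
Lemma Mderiv_mul_const_r C f t A :
  Mderiv_th f t A -> Mderiv_th (fun s => Mmul (f s) C) t (Mmul A C).
Proof.
  intros H. eapply Mderiv_eq; [apply Mderiv_mul; [exact H|apply Mderiv_const]|]. msolve.
Qed.
Lemma Mderiv_scal_const k f t A :
  Mderiv_th f t A -> Mderiv_th (fun s => Mscal k (f s)) t (Mscal k A).
Proof.
  intros H. eapply Mderiv_eq; [apply Mderiv_scal; [apply Cderiv_const|exact H]|]. msolve.
Qed.
Lemma Mderiv_0_const f : (forall t, Mderiv_th f t Mzero) -> forall t, f t = f 0.
Proof.
  intros H t.
  apply M2_eq; [apply (Cderiv_0_const (fun s => a11 (f s)))|apply (Cderiv_0_const (fun s => a12 (f s)))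
    |apply (Cderiv_0_const (fun s => a21 (f s)))|apply (Cderiv_0_const (fun s => a22 (f s)))];
    intros s; apply (H s).
Qed.
Lemma RF_deriv f t A : (forall s, RF (f s)) -> Mderiv_th f t A -> RF A.
Proof.
  intros H (F1 & F2 & F3 & F4). split.
  - eapply Cderiv_unique; [exact F3|]. eapply Cderiv_ext; [|apply Cderiv_conj, F2].
    intros s; simpl. symmetry. apply (H s).
  - eapply Cderiv_unique; [exact F4|]. eapply Cderiv_ext; [|apply Cderiv_conj, F1].
    intros s; simpl. symmetry. apply (H s).
Qed.

Definition Mtr (A : M2) : Cx := Cadd (a11 A) (a22 A).
(** Jacobi's formula for a determinant that is constantly one. *)
Lemma det1_deriv_trace f t A :
  (forall s, Mdet (f s) = Cone) -> Mderiv_th f t A -> Mtr (Mmul A (Madj (f t))) = Czero.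
Proof.
  intros H F. destruct F as (F1 & F2 & F3 & F4).
  assert (D : Cderiv_th (fun s => Mdet (f s)) t (Mtr (Mmul A (Madj (f t))))).
  { unfold Mtr; simpl.
    match goal with |- Cderiv_th _ _ ?l =>
      replace l with (Cadd (Cadd (Cmul (a11 A) (a22 (f t))) (Cmul (a11 (f t)) (a22 A)))
        (Copp (Cadd (Cmul (a12 A) (a21 (f t))) (Cmul (a12 (f t)) (a21 A))))) by ring end.
    unfold Mdet, Csub. apply Cderiv_add; [|apply Cderiv_opp]; apply Cderiv_mul; assumption. }
  eapply Cderiv_unique; [exact D|]. eapply Cderiv_ext; [|apply (Cderiv_const Cone)].
  intros s; now rewrite H.
Qed.

(** * The matrix exponential *)

(** For every r the terms (K r)^n / n! tend to zero and are therefore bounded, so every r lies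
    within the radius of convergence. *)
Lemma CV_radius_fact (a : nat -> R) (A K : R) :
  (forall n, Rabs (a n) <= A * (K ^ n / INR (fact n))) -> CV_radius a = p_infty.
Proof.
  intros H.
  assert (HA : forall r : R, Rbar_le r (CV_radius a)).
  { intros r. apply (proj1 (CV_radius_bounded a)).
    destruct (maj_by_pos (fun n => (K * r) ^ n / INR (fact n))) as [l [_ Hl]].
    { exists 0. apply cv_speed_pow_fact. }
    exists (Rabs A * l). intros n. rewrite Rabs_mult.
    eapply Rle_trans; [apply Rmult_le_compat_r; [apply Rabs_pos|apply H]|].
    eapply Rle_trans; [apply Rle_abs|].
    rewrite Rabs_mult, Rabs_Rabsolu, Rabs_mult, Rmult_assoc.
    apply Rmult_le_compat_l; [apply Rabs_pos|].
    eapply Rle_trans; [|apply (Hl n)]. apply Req_le.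
    rewrite <- Rabs_mult. f_equal. rewrite Rpow_mult_distr. unfold Rdiv. ring. }
  destruct (CV_radius a) as [r| |] eqn:E; [exfalso|reflexivity|exfalso].
  - specialize (HA (r + 1)). simpl in HA. lra.
  - apply (HA 0).
Qed.

Lemma CV_radius_fact_lt (a : nat -> R) (A K : R) (x : R) :
  (forall n, Rabs (a n) <= A * (K ^ n / INR (fact n))) -> Rbar_lt (Rabs x) (CV_radius a).
Proof. intros H. rewrite (CV_radius_fact _ _ _ H). exact I. Qed.

Definition Mnorm (A : M2) : R := Cabs (a11 A) + Cabs (a12 A) + (Cabs (a21 A) + Cabs (a22 A)).

Lemma Mnorm_nonneg A : 0 <= Mnorm A.
Proof.
  unfold Mnorm. pose proof (Cabs_nonneg (a11 A)). pose proof (Cabs_nonneg (a12 A)).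
  pose proof (Cabs_nonneg (a21 A)). pose proof (Cabs_nonneg (a22 A)). lra.
Qed.
Lemma Mnorm_mul A B : Mnorm (Mmul A B) <= Mnorm A * Mnorm B.
Proof.
  unfold Mnorm; simpl.
  assert (T : forall x y z w, Cabs (Cadd (Cmul x y) (Cmul z w)) <= Cabs x * Cabs y + Cabs z * Cabs w).
  { intros. rewrite <- !Cabs_mul. apply Cabs_add. }
  pose proof (T (a11 A) (a11 B) (a12 A) (a21 B)).
  pose proof (T (a11 A) (a12 B) (a12 A) (a22 B)).
  pose proof (T (a21 A) (a11 B) (a22 A) (a21 B)).
  pose proof (T (a21 A) (a12 B) (a22 A) (a22 B)).
  pose proof (Cabs_nonneg (a11 A)). pose proof (Cabs_nonneg (a12 A)).
  pose proof (Cabs_nonneg (a21 A)). pose proof (Cabs_nonneg (a22 A)).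
  pose proof (Cabs_nonneg (a11 B)). pose proof (Cabs_nonneg (a12 B)).
  pose proof (Cabs_nonneg (a21 B)). pose proof (Cabs_nonneg (a22 B)).
  set (p := Cabs (a11 A)) in *. set (q := Cabs (a12 A)) in *.
  set (r := Cabs (a21 A)) in *. set (s := Cabs (a22 A)) in *.
  set (p' := Cabs (a11 B)) in *. set (q' := Cabs (a12 B)) in *.
  set (r' := Cabs (a21 B)) in *. set (s' := Cabs (a22 B)) in *.
  assert (0 <= p * (r' + s')) by (apply Rmult_le_pos; lra).
  assert (0 <= q * (p' + q')) by (apply Rmult_le_pos; lra).
  assert (0 <= r * (r' + s')) by (apply Rmult_le_pos; lra).
  assert (0 <= s * (p' + q')) by (apply Rmult_le_pos; lra).
  lra.
Qed.
Lemma Mnorm_pow X n : Mnorm (Mpow X n) <= 2 * Mnorm X ^ n.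
Proof.
  induction n as [|n IH]; simpl.
  - unfold Mnorm; simpl. change Czero with (Cr 0). change Cone with (Cr 1).
    rewrite !Cabs_Cr, Rabs_R0, Rabs_R1. lra.
  - eapply Rle_trans; [apply Mnorm_mul|].
    pose proof (Mnorm_nonneg X). nra.
Qed.

(** The eight real coordinates of a matrix are treated at once as bounded real-linear functionals.
    The class is closed under A -> L (X A), so the derivative of the exponential series is again a
    series of the same kind. *)
Record Rlin (L : M2 -> R) : Prop := {
  Rlin_add : forall A B, L (Madd A B) = L A + L B;
  Rlin_scal : forall x A, L (Mscal (Cr x) A) = x * L A;
  Rlin_bound : exists c, 0 <= c /\ forall A, Rabs (L A) <= c * Mnorm A }.

Ltac rlin := constructor; [intros; simpl; ring|intros; simpl; ring|
  exists 1; split; [lra|]; intros A; eapply Rle_trans; [(apply Cabs_cre || apply Cabs_cim)|];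
  unfold Mnorm; pose proof (Cabs_nonneg (a11 A)); pose proof (Cabs_nonneg (a12 A));
  pose proof (Cabs_nonneg (a21 A)); pose proof (Cabs_nonneg (a22 A)); lra].
Lemma Rlin_re11 : Rlin (fun A => cre (a11 A)). Proof. rlin. Qed.
Lemma Rlin_im11 : Rlin (fun A => cim (a11 A)). Proof. rlin. Qed.
Lemma Rlin_re12 : Rlin (fun A => cre (a12 A)). Proof. rlin. Qed.
Lemma Rlin_im12 : Rlin (fun A => cim (a12 A)). Proof. rlin. Qed.
Lemma Rlin_re21 : Rlin (fun A => cre (a21 A)). Proof. rlin. Qed.
Lemma Rlin_im21 : Rlin (fun A => cim (a21 A)). Proof. rlin. Qed.
Lemma Rlin_re22 : Rlin (fun A => cre (a22 A)). Proof. rlin. Qed.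
Lemma Rlin_im22 : Rlin (fun A => cim (a22 A)). Proof. rlin. Qed.

Lemma Rlin_mul_l X L : Rlin L -> Rlin (fun A => L (Mmul X A)).
Proof.
  intros [H1 H2 [c [Hc H3]]]. constructor.
  - intros A B. rewrite <- H1. f_equal. msolve.
  - intros x A. rewrite <- H2. f_equal. msolve.
  - exists (c * Mnorm X). split; [apply Rmult_le_pos; [exact Hc|apply Mnorm_nonneg]|].
    intros A. eapply Rle_trans; [apply H3|].
    pose proof (Mnorm_mul X A). nra.
Qed.

Definition expcoef (L : M2 -> R) (X : M2) (n : nat) : R := L (Mpow X n) / INR (fact n).

Lemma Mpow_scal x X n : Mpow (Mscal (Cr x) X) n = Mscal (Cr (x ^ n)) (Mpow X n).
Proof.
  induction n as [|n IH]; simpl.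
  - change (Cr 1) with Cone. msolve.
  - rewrite IH, Cr_mul. msolve.
Qed.

Lemma Rlin_partial L X t n : Rlin L ->
  L (Mexp_partial (Mscal (Cr t) X) n) = sum_n (fun k => expcoef L X k * t ^ k) n.
Proof.
  intros HL. induction n as [|n IH].
  - rewrite sum_O. unfold expcoef; simpl. field.
  - rewrite sum_Sn, <- IH. cbn [Mexp_partial].
    rewrite (Rlin_add _ HL), (Rlin_scal _ HL), Mpow_scal, (Rlin_scal _ HL).
    unfold expcoef, plus; simpl (AbelianMonoid.sort _). cbn [AbelianMonoid.plus]. simpl plus.
    change (L (Mexp_partial (Mscal (Cr t) X) n) + / INR (fact (S n)) * (t ^ S n * L (Mpow X (S n))) =
      L (Mexp_partial (Mscal (Cr t) X) n) + L (Mpow X (S n)) / INR (fact (S n)) * t ^ S n).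
    unfold Rdiv. ring.
Qed.

Lemma expcoef_bound L X : Rlin L ->
  exists A, forall n, Rabs (expcoef L X n) <= A * (Mnorm X ^ n / INR (fact n)).
Proof.
  intros [_ _ [c [Hc H]]]. exists (2 * c). intros n. unfold expcoef, Rdiv.
  rewrite Rabs_mult, (Rabs_pos_eq (/ _)) by (left; apply Rinv_0_lt_compat, INR_fact_lt_0).
  rewrite <- Rmult_assoc. apply Rmult_le_compat_r; [left; apply Rinv_0_lt_compat, INR_fact_lt_0|].
  eapply Rle_trans; [apply H|]. pose proof (Mnorm_pow X n). nra.
Qed.

Lemma expcoef_cv L X t : Rlin L ->
  Un_cv (fun n => L (Mexp_partial (Mscal (Cr t) X) n)) (PSeries (expcoef L X) t).
Proof.
  intros HL. destruct (expcoef_bound L X HL) as [A HA].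
  apply is_lim_seq_Reals.
  eapply is_lim_seq_ext; [intros n; symmetry; apply Rlin_partial, HL|].
  assert (HS : ex_series (fun k => expcoef L X k * t ^ k)).
  { apply ex_series_Rabs. apply CV_disk_inside. eapply CV_radius_fact_lt, HA. }
  apply Series_correct in HS. unfold is_series in HS. unfold PSeries. exact HS.
Qed.

Lemma expcoef_deriv L X t : Rlin L ->
  derivable_pt_lim (PSeries (expcoef L X)) t (PSeries (expcoef (fun A => L (Mmul X A)) X) t).
Proof.
  intros HL. destruct (expcoef_bound L X HL) as [A HA].
  apply is_derive_Reals.
  replace (PSeries (expcoef (fun A => L (Mmul X A)) X) t)
    with (PSeries (PS_derive (expcoef L X)) t).
  - apply is_derive_PSeries. eapply CV_radius_fact_lt, HA.
  - apply PSeries_ext. intros n. unfold PS_derive, expcoef. cbn [Mpow].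
    rewrite fact_simpl, mult_INR. field. split; [apply INR_fact_neq_0|apply not_0_INR; lia].
Qed.

(** This is exp(tX). Keeping the real parameter apart makes every entry a real power series in t. *)
Definition Mexp (X : M2) (t : R) : M2 :=
  let e L := PSeries (expcoef L X) t in
  mkM (mkC (e (fun A => cre (a11 A))) (e (fun A => cim (a11 A))))
      (mkC (e (fun A => cre (a12 A))) (e (fun A => cim (a12 A))))
      (mkC (e (fun A => cre (a21 A))) (e (fun A => cim (a21 A))))
      (mkC (e (fun A => cre (a22 A))) (e (fun A => cim (a22 A)))).

Lemma IsMexp_Mexp_scal X t : IsMexp (Mscal (Cr t) X) (Mexp X t).
Proof.
  repeat split; simpl.
  - exact (expcoef_cv _ X t Rlin_re11).
  - exact (expcoef_cv _ X t Rlin_im11).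
  - exact (expcoef_cv _ X t Rlin_re12).
  - exact (expcoef_cv _ X t Rlin_im12).
  - exact (expcoef_cv _ X t Rlin_re21).
  - exact (expcoef_cv _ X t Rlin_im21).
  - exact (expcoef_cv _ X t Rlin_re22).
  - exact (expcoef_cv _ X t Rlin_im22).
Qed.
Lemma Mscal_1 X : Mscal (Cr 1) X = X.
Proof. change (Cr 1) with Cone. destruct X; msolve. Qed.
Lemma IsMexp_Mexp X : IsMexp X (Mexp X 1).
Proof. rewrite <- (Mscal_1 X) at 1. apply IsMexp_Mexp_scal. Qed.

Lemma Cconv_unique u a b : Cconv u a -> Cconv u b -> a = b.
Proof. intros [H1 H2] [H3 H4]. apply Cx_eq; eapply UL_sequence; eassumption. Qed.
Lemma Mconv_unique u A B : Mconv u A -> Mconv u B -> A = B.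
Proof.
  intros (H1 & H2 & H3 & H4) (K1 & K2 & K3 & K4).
  apply M2_eq; eapply Cconv_unique; eassumption.
Qed.
Lemma Cconv_add u v a b : Cconv u a -> Cconv v b -> Cconv (fun n => Cadd (u n) (v n)) (Cadd a b).
Proof. intros [H1 H2] [H3 H4]. split; simpl; apply CV_plus; assumption. Qed.
Lemma Cconv_mul u v a b : Cconv u a -> Cconv v b -> Cconv (fun n => Cmul (u n) (v n)) (Cmul a b).
Proof.
  intros [H1 H2] [H3 H4]. split; simpl.
  - apply CV_minus; apply CV_mult; assumption.
  - apply CV_plus; apply CV_mult; assumption.
Qed.
Lemma Cconv_const a : Cconv (fun _ => a) a.
Proof.
  split; intros e He; exists 0%nat; intros; unfold Rdist; rewrite Rminus_diag, Rabs_R0; exact He.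
Qed.
Lemma Mconv_mul u v A B : Mconv u A -> Mconv v B -> Mconv (fun n => Mmul (u n) (v n)) (Mmul A B).
Proof.
  intros (H1 & H2 & H3 & H4) (K1 & K2 & K3 & K4).
  split; [|split; [|split]]; simpl; apply Cconv_add; apply Cconv_mul; assumption.
Qed.
Lemma Mconv_const A : Mconv (fun _ => A) A.
Proof. split; [|split; [|split]]; apply Cconv_const. Qed.
Lemma Cconv_ext u v a : (forall n, u n = v n) -> Cconv u a -> Cconv v a.
Proof.
  intros H [H1 H2]. split; eapply Un_cv_ext; try eassumption; intros; simpl; now rewrite H.
Qed.
Lemma Mconv_ext u v A : (forall n, u n = v n) -> Mconv u A -> Mconv v A.
Proof.
  intros H (H1 & H2 & H3 & H4).
  split; [|split; [|split]]; eapply Cconv_ext; try eassumption; intros; simpl; now rewrite H.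
Qed.

Lemma Mexp_deriv X t : Mderiv_th (Mexp X) t (Mmul X (Mexp X t)).
Proof.
  assert (E : forall L, Rlin L ->
    Un_cv (fun n => L (Mmul X (Mexp_partial (Mscal (Cr t) X) n))) (L (Mmul X (Mexp X t))) ->
    derivable_pt_lim (PSeries (expcoef L X)) t (L (Mmul X (Mexp X t)))).
  { intros L HL HC.
    rewrite <- (UL_sequence _ _ _ (expcoef_cv _ X t (Rlin_mul_l X L HL)) HC).
    apply expcoef_deriv, HL. }
  pose proof (Mconv_mul _ _ _ _ (Mconv_const X) (IsMexp_Mexp_scal X t)) as
    ((H1 & H2) & (H3 & H4) & (H5 & H6) & (H7 & H8)).
  split; [|split; [|split]]; split.
  - exact (E _ Rlin_re11 H1).
  - exact (E _ Rlin_im11 H2).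
  - exact (E _ Rlin_re12 H3).
  - exact (E _ Rlin_im12 H4).
  - exact (E _ Rlin_re21 H5).
  - exact (E _ Rlin_im21 H6).
  - exact (E _ Rlin_re22 H7).
  - exact (E _ Rlin_im22 H8).
Qed.

Lemma Mexp_0 X : Mexp X 0 = Mid.
Proof.
  unfold Mexp. rewrite !PSeries_0. unfold expcoef; simpl.
  apply M2_eq; simpl; apply Cx_eq; simpl; field.
Qed.

Lemma Mexp_partial_comm X Y n :
  Mmul X Y = Mmul Y X -> Mmul Y (Mexp_partial X n) = Mmul (Mexp_partial X n) Y.
Proof.
  intros H.
  assert (P : forall k, Mmul Y (Mpow X k) = Mmul (Mpow X k) Y).
  { induction k as [|k IH]; simpl; [now rewrite Mmul_1l, Mmul_1r|].
    now rewrite Mmul_assoc, <- H, <- Mmul_assoc, IH, Mmul_assoc. }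
  induction n as [|n IH].
  - simpl. now rewrite Mmul_1l, Mmul_1r.
  - cbn [Mexp_partial].
    assert (D1 : forall A k B, Mmul Y (Madd A (Mscal k B)) = Madd (Mmul Y A) (Mscal k (Mmul Y B)))
      by (intros; msolve).
    assert (D2 : forall A k B, Mmul (Madd A (Mscal k B)) Y = Madd (Mmul A Y) (Mscal k (Mmul B Y)))
      by (intros; msolve).
    now rewrite D1, D2, IH, P.
Qed.

Lemma Mscal_mul_l k A B : Mmul (Mscal k A) B = Mscal k (Mmul A B).
Proof. msolve. Qed.
Lemma Mscal_mul_r k A B : Mmul A (Mscal k B) = Mscal k (Mmul A B).
Proof. msolve. Qed.

Lemma IsMexp_comm X Y E : Mmul X Y = Mmul Y X -> IsMexp X E -> Mmul Y E = Mmul E Y.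
Proof.
  intros H HE. eapply Mconv_unique; [apply Mconv_mul; [apply Mconv_const|exact HE]|].
  eapply Mconv_ext; [|apply Mconv_mul; [exact HE|apply Mconv_const]].
  intros n. symmetry. apply Mexp_partial_comm, H.
Qed.
Lemma Mexp_comm X Y t : Mmul X Y = Mmul Y X -> Mmul Y (Mexp X t) = Mmul (Mexp X t) Y.
Proof.
  intros H. apply (IsMexp_comm (Mscal (Cr t) X)); [|apply IsMexp_Mexp_scal].
  now rewrite Mscal_mul_l, Mscal_mul_r, H.
Qed.

Lemma Mexp_inv X t : Mmul (Mexp (Mscal (Cr (-1)) X) t) (Mexp X t) = Mid.
Proof.
  rewrite (Mderiv_0_const (fun t => Mmul (Mexp (Mscal (Cr (-1)) X) t) (Mexp X t))).
  - now rewrite !Mexp_0, Mmul_1l.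
  - intros s. eapply Mderiv_eq; [apply Mderiv_mul; apply Mexp_deriv|].
    rewrite (Mmul_assoc _ X). rewrite <- (Mexp_comm (Mscal (Cr (-1)) X) X).
    + msolve; cx_solve.
    + msolve.
Qed.

(** The product exp(-tX) E(t) has derivative zero. This is the tool that identifies conjugates,
    reflections and closed formulas with exponentials. *)
Lemma Mexp_ode_unique X E :
  E 0 = Mid -> (forall t, Mderiv_th E t (Mmul X (E t))) -> forall t, E t = Mexp X t.
Proof.
  intros E0 HE t.
  set (X' := Mscal (Cr (-1)) X).
  assert (HC : forall s, Mmul X (Mexp X' s) = Mmul (Mexp X' s) X).
  { intros s. apply Mexp_comm. unfold X'. msolve. }
  assert (H : Mmul (Mexp X' t) (E t) = Mid).
  { rewrite (Mderiv_0_const (fun t => Mmul (Mexp X' t) (E t))).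
    - now rewrite E0, Mexp_0, Mmul_1l.
    - intros s. eapply Mderiv_eq; [apply Mderiv_mul; [apply Mexp_deriv|apply HE]|].
      rewrite (Mmul_assoc _ X), <- HC. unfold X'. msolve; cx_solve. }
  assert (H2 : Mmul (Mexp X t) (Mexp X' t) = Mid).
  { replace X with (Mscal (Cr (-1)) X') by (unfold X'; msolve; cx_solve). apply Mexp_inv. }
  rewrite <- (Mmul_1l (E t)), <- H2, <- Mmul_assoc, H. apply Mmul_1r.
Qed.

Lemma IsMexp_ode X E :
  E 0 = Mid -> (forall t, Mderiv_th E t (Mmul X (E t))) -> forall t, IsMexp (Mscal (Cr t) X) (E t).
Proof. intros H0 H t. rewrite (Mexp_ode_unique X E H0 H). apply IsMexp_Mexp_scal. Qed.

Lemma IsMexp_add X Y EX EY :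
  Mmul X Y = Mmul Y X -> IsMexp X EX -> IsMexp Y EY -> IsMexp (Madd X Y) (Mmul EX EY).
Proof.
  intros HC HX HY.
  rewrite (Mconv_unique _ _ _ HX (IsMexp_Mexp X)), (Mconv_unique _ _ _ HY (IsMexp_Mexp Y)).
  rewrite <- (Mscal_1 (Madd X Y)).
  apply (IsMexp_ode (Madd X Y) (fun t => Mmul (Mexp X t) (Mexp Y t))).
  - now rewrite !Mexp_0, Mmul_1l.
  - intros t. eapply Mderiv_eq; [apply Mderiv_mul; apply Mexp_deriv|].
    rewrite (Mmul_assoc (Mexp X t) Y), <- (Mexp_comm X Y t HC). msolve.
Qed.

Arguments Mexp X t : simpl never.

(** * Goursat's theorem for rectangles and the mean value property *)

(** Complex differentiability of u + i v at s + i t with derivative p + i q, written in real terms.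
    Nothing is said about continuity of the derivative, hence Goursat's argument instead of Green's
    formula. *)
Definition CRdiff (u v : R -> R -> R) (s t : R) : Prop :=
  exists p q, forall eps, 0 < eps -> exists delta, 0 < delta /\
    forall s' t', Rabs (s' - s) < delta -> Rabs (t' - t) < delta ->
      Rabs (u s' t' - u s t - (p * (s' - s) - q * (t' - t)))
        <= eps * (Rabs (s' - s) + Rabs (t' - t)) /\
      Rabs (v s' t' - v s t - (q * (s' - s) + p * (t' - t)))
        <= eps * (Rabs (s' - s) + Rabs (t' - t)).

Lemma lipschitz_pt_continuous (f : R -> R) x c delta :
  0 < delta -> (forall y, Rabs (y - x) < delta -> Rabs (f y - f x) <= c * Rabs (y - x)) ->
  continuous f x.
Proof.
  intros Hd H. apply continuity_pt_filterlim. intros eps He.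
  exists (Rmin delta (eps / (Rabs c + 1))).
  pose proof (Rabs_pos c).
  assert (0 < eps / (Rabs c + 1)) by (apply Rdiv_lt_0_compat; lra).
  split; [apply Rmin_glb_lt; lra|].
  intros y [_ Hy]. simpl in Hy |- *. unfold Rdist in *.
  eapply Rle_lt_trans; [apply H; eapply Rlt_le_trans; [exact Hy|apply Rmin_l]|].
  assert (Hy2 : Rabs (y - x) < eps / (Rabs c + 1)) by (eapply Rlt_le_trans; [exact Hy|apply Rmin_r]).
  apply Rlt_div_r in Hy2; [|lra].
  pose proof (Rabs_pos (y - x)). pose proof (Rle_abs c). nra.
Qed.

Lemma CRdiff_cont_u u v s t : CRdiff u v s t -> continuous (u s) t.
Proof.
  intros (p & q & H). destruct (H 1 Rlt_0_1) as (d & Hd & H1).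
  apply (lipschitz_pt_continuous _ _ (Rabs q + 1) d Hd). intros t' Ht.
  destruct (H1 s t') as [H2 _]; [rewrite Rminus_diag, Rabs_R0; exact Hd|exact Ht|].
  rewrite Rminus_diag, Rabs_R0 in H2.
  replace (u s t' - u s t) with ((u s t' - u s t - (p * 0 - q * (t' - t))) + - (q * (t' - t))) by ring.
  eapply Rle_trans; [apply Rabs_triang|]. rewrite Rabs_Ropp, Rabs_mult. lra.
Qed.
Lemma CRdiff_cont_v u v s t : CRdiff u v s t -> continuous (fun s => v s t) s.
Proof.
  intros (p & q & H). destruct (H 1 Rlt_0_1) as (d & Hd & H1).
  apply (lipschitz_pt_continuous _ _ (Rabs q + 1) d Hd). intros s' Hs.
  destruct (H1 s' t) as [_ H2]; [exact Hs|rewrite Rminus_diag, Rabs_R0; exact Hd|].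
  rewrite Rminus_diag, Rabs_R0 in H2.
  replace (v s' t - v s t) with ((v s' t - v s t - (q * (s' - s) + p * 0)) + q * (s' - s)) by ring.
  eapply Rle_trans; [apply Rabs_triang|]. rewrite (Rabs_mult q). lra.
Qed.

Lemma RInt_near_const (f : R -> R) c d k e : c <= d -> ex_RInt f c d ->
  (forall x, c <= x <= d -> Rabs (f x - k) <= e) ->
  Rabs (RInt f c d - k * (d - c)) <= e * (d - c).
Proof.
  intros Hcd Hf H.
  assert (H1 : RInt (fun _ => k - e) c d <= RInt f c d).
  { apply RInt_le; [exact Hcd|apply ex_RInt_const|exact Hf|].
    intros x Hx. assert (Hx' : c <= x <= d) by lra.
    specialize (H x Hx'). apply Rabs_le_between in H. lra. }
  assert (H2 : RInt f c d <= RInt (fun _ => k + e) c d).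
  { apply RInt_le; [exact Hcd|exact Hf|apply ex_RInt_const|].
    intros x Hx. assert (Hx' : c <= x <= d) by lra.
    specialize (H x Hx'). apply Rabs_le_between in H. lra. }
  rewrite RInt_const in H1, H2. unfold scal in H1, H2; simpl in H1, H2. unfold mult in H1, H2; simpl in H1, H2.
  apply Rabs_le_between. lra.
Qed.

(* For [u + i v] this is the real part of [-i] times the contour integral over the
   boundary of the rectangle [a,b] x [c,d]. *)
Definition bdry_int (u v : R -> R -> R) (a b c d : R) : R :=
  RInt (u b) c d - RInt (u a) c d - (RInt (fun s => v s d) a b - RInt (fun s => v s c) a b).

Lemma ex_RInt_cont (f : R -> R) a b : a <= b ->
  (forall x, a <= x <= b -> continuous f x) -> ex_RInt f a b.
Proof.
  intros Hab H. apply (@ex_RInt_continuous R_CompleteNormedModule). intros z Hz.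
  rewrite Rmin_left, Rmax_right in Hz by exact Hab. auto.
Qed.

(** The affine part contributes p (b - a) (d - c) from each pair of opposite sides, and the two
    contributions cancel. What remains is at most eps times the size of the rectangle, integrated
    over the sides. *)
Lemma bdry_int_small u v a b c d s t p q eps :
  a <= s <= b -> c <= t <= d -> 0 <= eps ->
  (forall s' t', a <= s' <= b -> c <= t' <= d -> CRdiff u v s' t') ->
  (forall s' t', a <= s' <= b -> c <= t' <= d ->
      Rabs (u s' t' - u s t - (p * (s' - s) - q * (t' - t)))
        <= eps * (Rabs (s' - s) + Rabs (t' - t)) /\
      Rabs (v s' t' - v s t - (q * (s' - s) + p * (t' - t)))
        <= eps * (Rabs (s' - s) + Rabs (t' - t))) ->
  Rabs (bdry_int u v a b c d) <= 2 * eps * ((b - a) + (d - c)) ^ 2.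
Proof.
  intros Hs Ht He HC H. unfold bdry_int.
  assert (Hu : forall s', a <= s' <= b -> ex_RInt (u s') c d).
  { intros s' Hs'. apply ex_RInt_cont; [lra|]. intros x Hx. eapply CRdiff_cont_u, HC; assumption. }
  assert (Hv : forall t', c <= t' <= d -> ex_RInt (fun s => v s t') a b).
  { intros t' Ht'. apply ex_RInt_cont; [lra|]. intros x Hx.
    apply (CRdiff_cont_v u v x t'), HC; assumption. }
  set (L := (b - a) + (d - c)).
  assert (HL : forall s' t', a <= s' <= b -> c <= t' <= d -> Rabs (s' - s) + Rabs (t' - t) <= L).
  { intros s' t' Hs' Ht'. unfold L.
    assert (Rabs (s' - s) <= b - a) by (apply Rabs_le_between; lra).
    assert (Rabs (t' - t) <= d - c) by (apply Rabs_le_between; lra). lra. }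
  assert (I1 : Rabs (RInt (fun x => u b x - u a x) c d - p * (b - a) * (d - c)) <= (2 * eps * L) * (d - c)).
  { apply RInt_near_const; [lra| |].
    - apply (@ex_RInt_minus R_NormedModule); apply Hu; lra.
    - intros x Hx.
      destruct (H b x) as [H1 _]; [lra|lra|]. destruct (H a x) as [H2 _]; [lra|lra|].
      pose proof (HL b x). pose proof (HL a x).
      apply Rabs_le_between in H1. apply Rabs_le_between in H2. apply Rabs_le_between.
      assert (eps * (Rabs (b - s) + Rabs (x - t)) <= eps * L) by (apply Rmult_le_compat_l; [lra|apply HL; lra]).
      assert (eps * (Rabs (a - s) + Rabs (x - t)) <= eps * L) by (apply Rmult_le_compat_l; [lra|apply HL; lra]).
      lra. }
  assert (I2 : Rabs (RInt (fun x => v x d - v x c) a b - p * (d - c) * (b - a)) <= (2 * eps * L) * (b - a)).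
  { apply RInt_near_const; [lra| |].
    - apply (@ex_RInt_minus R_NormedModule); apply Hv; lra.
    - intros x Hx.
      destruct (H x d) as [_ H1]; [lra|lra|]. destruct (H x c) as [_ H2]; [lra|lra|].
      apply Rabs_le_between in H1. apply Rabs_le_between in H2. apply Rabs_le_between.
      assert (eps * (Rabs (x - s) + Rabs (d - t)) <= eps * L) by (apply Rmult_le_compat_l; [lra|apply HL; lra]).
      assert (eps * (Rabs (x - s) + Rabs (c - t)) <= eps * L) by (apply Rmult_le_compat_l; [lra|apply HL; lra]).
      lra. }
  assert (E1 : RInt (fun x => u b x - u a x) c d = RInt (u b) c d - RInt (u a) c d).
  { apply (@RInt_minus R_CompleteNormedModule); apply Hu; lra. }
  assert (E2 : RInt (fun x => v x d - v x c) a b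
               = RInt (fun s => v s d) a b - RInt (fun s => v s c) a b).
  { apply (@RInt_minus R_CompleteNormedModule (fun s => v s d) (fun s => v s c)); apply Hv; lra. }
  rewrite E1 in I1. rewrite E2 in I2.
  apply Rabs_le_between in I1. apply Rabs_le_between in I2. apply Rabs_le_between.
  replace (2 * eps * L ^ 2) with ((2 * eps * L) * (d - c) + (2 * eps * L) * (b - a)) by (unfold L; ring).
  lra.
Qed.

Lemma bdry_int_split u v a m b c n d :
  a <= m <= b -> c <= n <= d ->
  (forall s' t', a <= s' <= b -> c <= t' <= d -> CRdiff u v s' t') ->
  bdry_int u v a b c d = bdry_int u v a m c n + bdry_int u v m b c n
    + bdry_int u v a m n d + bdry_int u v m b n d.
Proof.
  intros Hm Hn HC.
  assert (Hu : forall s', a <= s' <= b -> RInt (u s') c n + RInt (u s') n d = RInt (u s') c d).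
  { intros s' Hs'. apply (@RInt_Chasles R_CompleteNormedModule); apply ex_RInt_cont; try lra;
      intros x Hx; eapply CRdiff_cont_u, HC; lra. }
  assert (Hv : forall t', c <= t' <= d ->
    RInt (fun s => v s t') a m + RInt (fun s => v s t') m b = RInt (fun s => v s t') a b).
  { intros t' Ht'. apply (@RInt_Chasles R_CompleteNormedModule); apply ex_RInt_cont; try lra;
      intros x Hx; apply (CRdiff_cont_v u v x t'), HC; lra. }
  unfold bdry_int.
  rewrite <- (Hu a), <- (Hu b), <- (Hv c), <- (Hv d) by lra. lra.
Qed.

Lemma nested_limit (x : nat -> R) (w : nat -> R) :
  (forall n, x n <= x (S n)) -> (forall n, x (S n) + w (S n) <= x n + w n) ->
  (forall n, 0 <= w n) -> exists l, forall n, x n <= l <= x n + w n.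
Proof.
  intros H1 H2 H3.
  assert (M1 : forall n k, x n <= x (n + k)%nat).
  { intros n k; induction k as [|k IH]; [rewrite Nat.add_0_r; lra|].
    rewrite Nat.add_succ_r. eapply Rle_trans; [exact IH|apply H1]. }
  assert (M2 : forall n k, x (n + k)%nat + w (n + k)%nat <= x n + w n).
  { intros n k; induction k as [|k IH]; [rewrite Nat.add_0_r; lra|].
    rewrite Nat.add_succ_r. eapply Rle_trans; [apply H2|exact IH]. }
  assert (B : forall n m, x m <= x n + w n).
  { intros n m. destruct (Nat.le_ge_cases n m) as [H|H].
    - replace m with (n + (m - n))%nat by lia. pose proof (M2 n (m - n)%nat).
      pose proof (H3 (n + (m - n))%nat). lra.
    - replace n with (m + (n - m))%nat by lia. pose proof (M1 m (n - m)%nat).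
      pose proof (H3 (m + (n - m))%nat). lra. }
  destruct (completeness (fun y => exists n, y = x n)) as [l [L1 L2]].
  - exists (x 0%nat + w 0%nat). intros y [n ->]. apply B.
  - exists (x 0%nat). now exists 0%nat.
  - exists l. intros n. split; [apply L1; now exists n|].
    apply L2. intros y [m ->]. apply B.
Qed.

Lemma pow2_pos n : 0 < 2 ^ n.
Proof. apply pow_lt; lra. Qed.

Lemma small_pow2 (A delta : R) : 0 < delta -> exists N, forall n, (N <= n)%nat -> A / 2 ^ n < delta.
Proof.
  intros Hd.
  destruct (Pow_x_infinity 2) with (b := (Rabs A + 1) / delta) as [N HN].
  - rewrite Rabs_pos_eq; lra.
  - exists N. intros n Hn. specialize (HN n Hn).
    rewrite Rabs_pos_eq in HN by (left; apply pow2_pos).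
    pose proof (pow2_pos n). pose proof (Rle_abs A).
    apply Rlt_div_l; [assumption|].
    apply Rge_le, Rle_div_l in HN; [|lra]. lra.
Qed.

(** Bisection: some quarter of each rectangle carries at least a fourth of the boundary integral.
    Near the common point of the nested rectangles, differentiability bounds the integral over the
    n-th one by a multiple of eps / 4^n. *)
Theorem goursat_rectangle u v a b c d :
  a < b -> c < d ->
  (forall s t, a <= s <= b -> c <= t <= d -> CRdiff u v s t) ->
  bdry_int u v a b c d = 0.
Proof.
  intros Hab Hcd HC.
  set (A := b - a). set (C := d - c).
  set (Phi := fun n (z : R * R) =>
    bdry_int u v (fst z) (fst z + A / 2 ^ n) (snd z) (snd z + C / 2 ^ n)).
  set (inR := fun n (z : R * R) =>
    a <= fst z /\ fst z + A / 2 ^ n <= b /\ c <= snd z /\ snd z + C / 2 ^ n <= d).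
  set (next := fun n (z z' : R * R) =>
    fst z <= fst z' /\ fst z' + A / 2 ^ (S n) <= fst z + A / 2 ^ n /\
    snd z <= snd z' /\ snd z' + C / 2 ^ (S n) <= snd z + C / 2 ^ n /\
    Rabs (Phi n z) <= 4 * Rabs (Phi (S n) z')).
  assert (HA : forall n, A / 2 ^ n = 2 * (A / 2 ^ (S n))).
  { intros n. pose proof (pow2_pos n). simpl. field. lra. }
  assert (HCC : forall n, C / 2 ^ n = 2 * (C / 2 ^ (S n))).
  { intros n. pose proof (pow2_pos n). simpl. field. lra. }
  assert (pA : forall n, 0 < A / 2 ^ n).
  { intros n. apply Rdiv_lt_0_compat; [unfold A; lra|apply pow2_pos]. }
  assert (pC : forall n, 0 < C / 2 ^ n).
  { intros n. apply Rdiv_lt_0_compat; [unfold C; lra|apply pow2_pos]. }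
  assert (Hstep : forall n z, inR n z -> exists z', next n z z').
  { intros n [x y] (h1 & h2 & h3 & h4). simpl in h1, h2, h3, h4.
    pose proof (pA (S n)). pose proof (pC (S n)). specialize (HA n). specialize (HCC n).
    assert (E : Phi n (x, y) = Phi (S n) (x, y) + Phi (S n) (x + A / 2 ^ S n, y)
      + Phi (S n) (x, y + C / 2 ^ S n) + Phi (S n) (x + A / 2 ^ S n, y + C / 2 ^ S n)).
    { unfold Phi. cbn [fst snd].
      rewrite (bdry_int_split u v x (x + A / 2 ^ S n) (x + A / 2 ^ n) y (y + C / 2 ^ S n) (y + C / 2 ^ n)).
      - replace (x + A / 2 ^ S n + A / 2 ^ S n) with (x + A / 2 ^ n) by lra.
        replace (y + C / 2 ^ S n + C / 2 ^ S n) with (y + C / 2 ^ n) by lra. reflexivity.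
      - lra.
      - lra.
      - intros s t Hs Ht. apply HC; lra. }
    assert (T : Rabs (Phi n (x, y)) <= Rabs (Phi (S n) (x, y)) + Rabs (Phi (S n) (x + A / 2 ^ S n, y))
      + Rabs (Phi (S n) (x, y + C / 2 ^ S n)) + Rabs (Phi (S n) (x + A / 2 ^ S n, y + C / 2 ^ S n))).
    { rewrite E. eapply Rle_trans; [apply Rabs_triang|]. apply Rplus_le_compat_r.
      eapply Rle_trans; [apply Rabs_triang|]. apply Rplus_le_compat_r. apply Rabs_triang. }
    destruct (Rle_dec (Rabs (Phi n (x, y))) (4 * Rabs (Phi (S n) (x, y)))) as [?|n1].
    { exists (x, y). unfold next; cbn [fst snd]. repeat split; lra. }
    destruct (Rle_dec (Rabs (Phi n (x, y))) (4 * Rabs (Phi (S n) (x + A / 2 ^ S n, y)))) as [?|n2].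
    { exists (x + A / 2 ^ S n, y). unfold next; cbn [fst snd]. repeat split; lra. }
    destruct (Rle_dec (Rabs (Phi n (x, y))) (4 * Rabs (Phi (S n) (x, y + C / 2 ^ S n)))) as [?|n3].
    { exists (x, y + C / 2 ^ S n). unfold next; cbn [fst snd]. repeat split; lra. }
    exists (x + A / 2 ^ S n, y + C / 2 ^ S n). unfold next; cbn [fst snd]. repeat split; lra. }
  (* Dependent choice through [epsilon]: a successor exists for rectangles inside the original one,
     and [Hin] shows that the sequence stays there. *)
  set (stp := fun n z => epsilon (inhabits z) (next n z)).
  set (z := fix z n := match n with O => (a, c) | S k => stp k (z k) end).
  assert (HA0 : A / 2 ^ 0 = A) by (simpl; field).
  assert (HC0 : C / 2 ^ 0 = C) by (simpl; field).
  assert (Hin : forall n, inR n (z n)).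
  { induction n as [|n IH].
    - unfold inR; simpl z. cbn [fst snd]. rewrite HA0, HC0. unfold A, C. lra.
    - pose proof (epsilon_spec (inhabits (z n)) (next n (z n)) (Hstep n _ IH)) as (k1 & k2 & k3 & k4 & _).
      change (epsilon (inhabits (z n)) (next n (z n))) with (z (S n)) in *.
      destruct IH as (h1 & h2 & h3 & h4). unfold inR. lra. }
  assert (Hnx : forall n, next n (z n) (z (S n))).
  { intros n. exact (epsilon_spec (inhabits (z n)) (next n (z n)) (Hstep n _ (Hin n))). }
  destruct (nested_limit (fun n => fst (z n)) (fun n => A / 2 ^ n)) as [s Hs].
  { intros n; apply (Hnx n). } { intros n; apply (Hnx n). } { intros n; left; apply pA. }
  destruct (nested_limit (fun n => snd (z n)) (fun n => C / 2 ^ n)) as [t Ht].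
  { intros n; apply (Hnx n). } { intros n; apply (Hnx n). } { intros n; left; apply pC. }
  assert (HPhi : forall n, Rabs (Phi 0%nat (a, c)) <= 4 ^ n * Rabs (Phi n (z n))).
  { induction n as [|n IH]; [simpl; lra|].
    pose proof (Hnx n) as (_ & _ & _ & _ & H5).
    pose proof (pow_lt 4 n ltac:(lra)). simpl pow. nra. }
  assert (E0 : Phi 0%nat (a, c) = bdry_int u v a b c d).
  { unfold Phi. cbn [fst snd]. rewrite HA0, HC0. unfold A, C. f_equal; ring. }
  rewrite <- E0.
  assert (Hle : forall eps, 0 < eps -> Rabs (Phi 0%nat (a, c)) <= eps * (2 * (A + C) ^ 2)).
  { intros eps He.
    destruct (HC s t) as (p & q & H).
    { pose proof (Hs 0%nat) as H0. cbv beta in H0. simpl z in H0. rewrite HA0 in H0. simpl in H0. unfold A in H0. lra. }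
    { pose proof (Ht 0%nat) as H0. cbv beta in H0. simpl z in H0. rewrite HC0 in H0. simpl in H0. unfold C in H0. lra. }
    destruct (H eps He) as (delta & Hd & Hloc).
    destruct (small_pow2 A delta Hd) as [N1 HN1]. destruct (small_pow2 C delta Hd) as [N2 HN2].
    set (n := (N1 + N2)%nat).
    specialize (HN1 n ltac:(unfold n; lia)). specialize (HN2 n ltac:(unfold n; lia)).
    specialize (Hs n). specialize (Ht n). cbv beta in Hs, Ht.
    eapply Rle_trans; [apply (HPhi n)|].
    destruct (Hin n) as (h1 & h2 & h3 & h4).
    assert (S1 : Rabs (Phi n (z n)) <= 2 * eps * ((fst (z n) + A / 2 ^ n - fst (z n)) + (snd (z n) + C / 2 ^ n - snd (z n))) ^ 2).
    { apply (bdry_int_small u v _ _ _ _ s t p q).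
      - lra.
      - lra.
      - lra.
      - intros s' t' Hs' Ht'. apply HC; lra.
      - intros s' t' Hs' Ht'. apply Hloc; apply Rabs_lt_between; lra. }
    apply Rle_trans with (4 ^ n * (2 * eps * ((fst (z n) + A / 2 ^ n - fst (z n)) + (snd (z n) + C / 2 ^ n - snd (z n))) ^ 2)).
    { apply Rmult_le_compat_l; [apply pow_le; lra|exact S1]. }
    (* The factor 4^n lost by bisection is the square of the factor 2^n by which the sides have
       shrunk. *)
    replace (4 ^ n) with (2 ^ n * 2 ^ n) by (rewrite <- Rpow_mult_distr; f_equal; ring).
    pose proof (pow2_pos n). apply Req_le. field. lra. }
  apply Rabs_eq_0. apply Rle_antisym; [|apply Rabs_pos].
  assert (HK : 0 <= 2 * (A + C) ^ 2) by (pose proof (pow2_ge_0 (A + C)); lra).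
  destruct (Rle_dec (Rabs (Phi 0%nat (a, c))) 0) as [Hz|Hz]; [exact Hz|].
  specialize (Hle (Rabs (Phi 0%nat (a, c)) / (2 * (2 * (A + C) ^ 2 + 1)))).
  assert (HP : 0 < Rabs (Phi 0%nat (a, c))) by lra.
  set (X := Rabs (Phi 0%nat (a, c))) in *. set (K := 2 * (A + C) ^ 2) in *.
  assert (HX : 0 < X / (2 * (K + 1))) by (apply Rdiv_lt_0_compat; lra).
  specialize (Hle HX).
  assert (EX : X = (X / (2 * (K + 1))) * (2 * (K + 1))) by (field; lra).
  nra.
Qed.

Lemma deriv_first_order (f : R -> R) x l : derivable_pt_lim f x l ->
  forall eta, 0 < eta -> exists delta, 0 < delta /\
    forall h, Rabs h < delta -> Rabs (f (x + h) - f x - l * h) <= eta * Rabs h.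
Proof.
  intros H eta He. destruct (H eta He) as [d Hd]. exists d. split; [apply cond_pos|].
  intros h Hh. destruct (Req_dec h 0) as [->|n].
  - rewrite Rplus_0_r, Rminus_diag, Rmult_0_r, Rminus_0_r, Rabs_R0. lra.
  - specialize (Hd h n Hh).
    replace (f (x + h) - f x - l * h) with (((f (x + h) - f x) / h - l) * h) by (field; exact n).
    rewrite Rabs_mult. apply Rmult_le_compat_r; [apply Rabs_pos|lra].
Qed.

Lemma Cexp_first_order eta : 0 < eta -> exists delta, 0 < delta /\
  forall x y, Rabs x < delta -> Rabs y < delta ->
    Cabs (Csub (Csub (Cmul (Cr (exp x)) (Ccis y)) Cone) (mkC x y)) <= eta * (Rabs x + Rabs y).
Proof.
  (* The errors below add up to at most e |x| + 8 e |y|, whence the 9. *)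
  intros He. set (e := Rmin 1 (eta / 9)).
  assert (e0 : 0 < e) by (apply Rmin_glb_lt; lra).
  assert (e1 : e <= 1) by apply Rmin_l. assert (e2 : e <= eta / 9) by apply Rmin_r.
  destruct (deriv_first_order exp 0 1) with (eta := e) as (d1 & D1 & H1).
  { rewrite <- exp_0. apply derivable_pt_lim_exp. } { exact e0. }
  destruct (deriv_first_order sin 0 1) with (eta := e) as (d2 & D2 & H2).
  { rewrite <- cos_0. apply derivable_pt_lim_sin. } { exact e0. }
  destruct (deriv_first_order cos 0 0) with (eta := e) as (d3 & D3 & H3).
  { replace 0 with (- sin 0) at 2 by (rewrite sin_0; ring). apply derivable_pt_lim_cos. } { exact e0. }
  exists (Rmin (Rmin d1 e) (Rmin d2 d3)). split.
  { apply Rmin_glb_lt; [apply Rmin_glb_lt; assumption|apply Rmin_glb_lt; assumption]. }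
  intros x y Hx Hy.
  assert (Hx1 : Rabs x < d1) by (eapply Rlt_le_trans; [exact Hx|]; eapply Rle_trans; [apply Rmin_l|apply Rmin_l]).
  assert (Hx2 : Rabs x < e) by (eapply Rlt_le_trans; [exact Hx|]; eapply Rle_trans; [apply Rmin_l|apply Rmin_r]).
  assert (Hy1 : Rabs y < d2) by (eapply Rlt_le_trans; [exact Hy|]; eapply Rle_trans; [apply Rmin_r|apply Rmin_l]).
  assert (Hy2 : Rabs y < d3) by (eapply Rlt_le_trans; [exact Hy|]; eapply Rle_trans; [apply Rmin_r|apply Rmin_r]).
  specialize (H1 x Hx1). specialize (H2 y Hy1). specialize (H3 y Hy2).
  rewrite Rplus_0_l, exp_0, Rmult_1_l in H1. rewrite Rplus_0_l, sin_0, Rmult_1_l, Rminus_0_r in H2.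
  rewrite Rplus_0_l, cos_0, Rmult_0_l, Rminus_0_r in H3.
  eapply Rle_trans; [apply Cabs_le_sum|]. simpl.
  set (X := exp x) in *. set (c := cos y) in *. set (s := sin y) in *.
  set (a := Rabs x) in *. set (b := Rabs y) in *.
  assert (a0 : 0 <= a) by apply Rabs_pos. assert (b0 : 0 <= b) by apply Rabs_pos.
  assert (HX : Rabs (X - 1) <= 2 * a).
  { replace (X - 1) with ((X - 1 - x) + x) by ring. eapply Rle_trans; [apply Rabs_triang|]. fold a. nra. }
  assert (HX3 : Rabs X <= 3).
  { replace X with ((X - 1) + 1) by ring. eapply Rle_trans; [apply Rabs_triang|]. rewrite Rabs_R1. nra. }
  assert (Hs : Rabs s <= 2 * b).
  { replace s with ((s - y) + y) by ring. eapply Rle_trans; [apply Rabs_triang|]. fold b. nra. }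
  replace (X * c - 0 * s + - (1) + - x) with ((X - 1 - x) + X * (c - 1)) by ring.
  replace (X * s + 0 * c + - 0 + - y) with ((X - 1) * s + (s - y)) by ring.
  assert (R1 : Rabs ((X - 1 - x) + X * (c - 1)) <= e * a + 3 * (e * b)).
  { eapply Rle_trans; [apply Rabs_triang|]. rewrite Rabs_mult.
    apply Rplus_le_compat; [exact H1|].
    apply Rmult_le_compat; try apply Rabs_pos; assumption. }
  assert (R2 : Rabs ((X - 1) * s + (s - y)) <= (2 * a) * (2 * b) + e * b).
  { eapply Rle_trans; [apply Rabs_triang|]. rewrite Rabs_mult.
    apply Rplus_le_compat; [|exact H2].
    apply Rmult_le_compat; try apply Rabs_pos; assumption. }
  assert (a * b <= e * b) by (apply Rmult_le_compat_r; lra).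
  assert (e * a <= eta / 9 * a) by (apply Rmult_le_compat_r; lra).
  assert (e * b <= eta / 9 * b) by (apply Rmult_le_compat_r; lra).
  assert (0 <= eta * a) by (apply Rmult_le_pos; lra).
  assert (0 <= eta * b) by (apply Rmult_le_pos; lra).
  lra.
Qed.

Lemma Cdiff_at_le h w : Cdiff_at h w -> exists L, forall eps, 0 < eps -> exists delta, 0 < delta /\
  forall k, Cabs k < delta -> Cabs (Csub (Csub (h (Cadd w k)) (h w)) (Cmul L k)) <= eps * Cabs k.
Proof.
  intros [L H]. exists L. intros eps He. destruct (H eps He) as (d & Hd & H1).
  exists d. split; [exact Hd|]. intros k Hk.
  destruct (Rle_lt_or_eq_dec _ _ (Cabs_nonneg k)) as [Hp|Hp].
  - apply H1; auto.
  - symmetry in Hp. rewrite (Cabs_0_eq k Hp).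
    replace (Csub (Csub (h (Cadd w Czero)) (h w)) (Cmul L Czero)) with (Cr 0).
    + rewrite Cabs_Cr, Rabs_R0. change Czero with (Cr 0). rewrite Cabs_Cr, Rabs_R0. lra.
    + replace (Cadd w Czero) with w by ring. change (Cr 0) with Czero. ring.
Qed.

Definition polar (s t : R) : Cx := Cmul (Cr (exp s)) (Ccis t).

Lemma Cabs_polar s t : Cabs (polar s t) = exp s.
Proof.
  unfold polar. rewrite Cabs_mul, Cabs_cis, Cabs_Cr, Rabs_pos_eq; [ring|left; apply exp_pos].
Qed.
Lemma polar_add s t x y : polar (s + x) (t + y) = Cmul (polar s t) (Cmul (Cr (exp x)) (Ccis y)).
Proof. unfold polar. rewrite exp_plus, Cr_mul, Ccis_add. ring. Qed.

(** Chain rule: with respect to s + i t the derivative of h(exp(s + i t)) is h'(w) w, the constant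
    [P]. *)
Lemma CRdiff_polar h s t : Cdiff_at h (polar s t) ->
  CRdiff (fun s t => cre (h (polar s t))) (fun s t => cim (h (polar s t))) s t.
Proof.
  intros H. destruct (Cdiff_at_le _ _ H) as [L HL]. clear H.
  set (w := polar s t) in *. set (P := Cmul L w).
  exists (cre P), (cim P). intros eps He.
  set (W := Cabs w + 1). assert (W1 : 1 <= W) by (unfold W; pose proof (Cabs_nonneg w); lra).
  set (e := Rmin 1 (eps / (W * (Cabs L + 3)))).
  pose proof (Cabs_nonneg L) as L0.
  assert (Kpos : 0 < W * (Cabs L + 3)) by (apply Rmult_lt_0_compat; lra).
  assert (e0 : 0 < e) by (apply Rmin_glb_lt; [lra|apply Rdiv_lt_0_compat; lra]).
  assert (e1 : e <= 1) by apply Rmin_l.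
  assert (e2 : e * (W * (Cabs L + 3)) <= eps).
  { apply Rle_div_r; [exact Kpos|]. apply Rmin_r. }
  destruct (HL e e0) as (d1 & D1 & H1). destruct (Cexp_first_order e e0) as (d2 & D2 & H2).
  exists (Rmin d2 (d1 / (4 * W))).
  assert (D3 : 0 < d1 / (4 * W)) by (apply Rdiv_lt_0_compat; lra).
  split; [apply Rmin_glb_lt; assumption|].
  intros s' t' Hs Ht.
  set (x := s' - s) in *. set (y := t' - t) in *.
  replace s' with (s + x) by (unfold x; ring). replace t' with (t + y) by (unfold y; ring).
  rewrite polar_add. fold w.
  specialize (H2 x y (Rlt_le_trans _ _ _ Hs (Rmin_l _ _)) (Rlt_le_trans _ _ _ Ht (Rmin_l _ _))).
  set (E := Cmul (Cr (exp x)) (Ccis y)) in *.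
  set (r := Csub (Csub E Cone) (mkC x y)) in *.
  set (N := Rabs x + Rabs y) in *.
  assert (N0 : 0 <= N) by (unfold N; pose proof (Rabs_pos x); pose proof (Rabs_pos y); lra).
  assert (Hk : Cabs (Csub E Cone) <= 2 * N).
  { replace (Csub E Cone) with (Cadd r (mkC x y)) by (unfold r; ring).
    eapply Rle_trans; [apply Cabs_add|]. pose proof (Cabs_le_sum (mkC x y)) as H3. simpl in H3. fold N in H3. nra. }
  set (k := Cmul w (Csub E Cone)).
  assert (Hk2 : Cabs k <= 2 * W * N).
  { unfold k. rewrite Cabs_mul. apply Rle_trans with (W * (2 * N)); [|lra].
    apply Rmult_le_compat; try apply Cabs_nonneg; [unfold W; lra|exact Hk]. }
  assert (HN : N < d1 / (2 * W)).
  { replace (d1 / (2 * W)) with (d1 / (4 * W) + d1 / (4 * W)) by (field; lra).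
    unfold N. apply Rplus_lt_compat; eapply Rlt_le_trans; try eassumption; apply Rmin_r. }
  assert (Hkd : Cabs k < d1).
  { eapply Rle_lt_trans; [exact Hk2|]. apply Rlt_div_r in HN; lra. }
  specialize (H1 k Hkd).
  replace (Cmul w E) with (Cadd w k) by (unfold k; ring).
  set (D := Csub (Csub (h (Cadd w k)) (h w)) (Cmul P (mkC x y))).
  assert (HD : Cabs D <= eps * N).
  { replace D with (Cadd (Csub (Csub (h (Cadd w k)) (h w)) (Cmul L k)) (Cmul P r))
      by (unfold D, P, k, r; ring).
    eapply Rle_trans; [apply Cabs_add|]. rewrite Cabs_mul. unfold P. rewrite Cabs_mul.
    apply Rle_trans with (e * (2 * W * N) + (Cabs L * W) * (e * N)).
    - apply Rplus_le_compat.
      + eapply Rle_trans; [exact H1|]. apply Rmult_le_compat_l; lra.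
      + apply Rmult_le_compat; [apply Rmult_le_pos; apply Cabs_nonneg|apply Cabs_nonneg| |exact H2].
        apply Rmult_le_compat_l; [exact L0|unfold W; lra].
    - replace (e * (2 * W * N) + Cabs L * W * (e * N)) with (e * (W * (Cabs L + 2)) * N) by ring.
      apply Rmult_le_compat_r; [exact N0|]. eapply Rle_trans; [|exact e2].
      apply Rmult_le_compat_l; [lra|]. apply Rmult_le_compat_l; lra. }
  replace (s + x - s) with x by ring. replace (t + y - t) with y by ring. fold N.
  split.
  - eapply Rle_trans; [|exact HD]. eapply Rle_trans; [|apply Cabs_cre]. apply Req_le.
    unfold D; simpl. f_equal; ring.
  - eapply Rle_trans; [|exact HD]. eapply Rle_trans; [|apply Cabs_cim]. apply Req_le.
    unfold D; simpl. f_equal; ring.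
Qed.

Definition disk_holo (h : Cx -> Cx) : Prop :=
  (forall w, Cabs w < 1 -> Cdiff_at h w) /\ (forall w, Cabs w <= 1 -> Ccont_disk_at h w).

Lemma exp_lt_1 s : s < 0 -> exp s < 1.
Proof. intros H. rewrite <- exp_0. now apply exp_increasing. Qed.

(** In these coordinates the vertical sides of the rectangle are full circles, and the horizontal
    sides cancel by 2 pi periodicity. *)
Lemma polar_mean_const h : (forall w, Cabs w < 1 -> Cdiff_at h w) -> forall a b, a < b -> b < 0 ->
  RInt (fun t => cre (h (polar b t))) 0 (2 * PI) = RInt (fun t => cre (h (polar a t))) 0 (2 * PI).
Proof.
  intros H a b Hab Hb.
  pose proof PI_RGT_0 as HPI.
  assert (G := goursat_rectangle (fun s t => cre (h (polar s t))) (fun s t => cim (h (polar s t)))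
    a b 0 (2 * PI) Hab ltac:(lra)).
  unfold bdry_int in G. cbv beta in G.
  rewrite (RInt_ext (fun s => cim (h (polar s (2 * PI)))) (fun s => cim (h (polar s 0)))) in G.
  - lapply G; [lra|]. intros s t Hs _. apply CRdiff_polar, H. rewrite Cabs_polar. apply exp_lt_1. lra.
  - intros s _. unfold polar. do 3 f_equal. apply Cx_eq; simpl.
    + rewrite cos_2PI, cos_0; reflexivity.
    + rewrite sin_2PI, sin_0; reflexivity.
Qed.

Lemma cis_lipschitz s t : Cabs (Csub (Ccis s) (Ccis t)) <= 2 * Rabs (s - t).
Proof.
  assert (T : forall x, Rabs (cos x - 1) <= Rabs x /\ Rabs (sin x) <= Rabs x).
  { intros x. split.
    - destruct (MVT_gen cos 0 x (fun x => - sin x)) as [c [_ Hc]].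
      + intros; auto_derive; auto; ring.
      + intros; apply continuity_cos.
      + rewrite cos_0 in Hc. rewrite Hc, Rminus_0_r, Rabs_mult, Rabs_Ropp.
        pose proof (SIN_bound c). pose proof (Rabs_pos x).
        assert (Rabs (sin c) <= 1) by (apply Rabs_le; lra). nra.
    - destruct (MVT_gen sin 0 x cos) as [c [_ Hc]].
      + intros; auto_derive; auto; ring.
      + intros; apply continuity_sin.
      + rewrite sin_0 in Hc. rewrite !Rminus_0_r in Hc. rewrite Hc, Rabs_mult.
        pose proof (COS_bound c). pose proof (Rabs_pos x).
        assert (Rabs (cos c) <= 1) by (apply Rabs_le; lra). nra. }
  replace (Csub (Ccis s) (Ccis t)) with (Cmul (Ccis t) (Csub (Ccis (s - t)) Cone)).
  - rewrite Cabs_mul, Cabs_cis, Rmult_1_l.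
    eapply Rle_trans; [apply Cabs_le_sum|]. simpl.
    destruct (T (s - t)) as [T1 T2].
    replace (cos (s - t) + - (1)) with (cos (s - t) - 1) by ring.
    replace (sin (s - t) + - 0) with (sin (s - t)) by ring. lra.
  - replace (Ccis s) with (Ccis (t + (s - t))) by (f_equal; ring).
    rewrite Ccis_add. ring.
Qed.

Lemma circle_continuous h t : Ccont_disk_at h (Ccis t) ->
  continuous (fun t => cre (h (Ccis t))) t.
Proof.
  intros H. apply continuity_pt_filterlim. intros eps He.
  destruct (H eps He) as (d & Hd & H1). exists (d / 2). split; [lra|].
  intros y [_ Hy]. simpl in *. unfold Rdist in *.
  eapply Rle_lt_trans; [|apply (H1 (Ccis y))].
  - replace (cre (h (Ccis y)) - cre (h (Ccis t))) with (cre (Csub (h (Ccis y)) (h (Ccis t)))) by (simpl; ring).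
    apply Cabs_cre.
  - rewrite Cabs_cis; lra.
  - eapply Rle_lt_trans; [apply cis_lipschitz|lra].
Qed.

(** Continuity at each point of the circle becomes uniform through compactness of the parameter
    interval. *)
Lemma circle_uniform_limit h : (forall w, Cabs w <= 1 -> Ccont_disk_at h w) ->
  forall eps, 0 < eps -> exists delta, 0 < delta /\ forall s t, - delta < s < 0 -> 0 <= t <= 2 * PI ->
    Rabs (cre (h (polar s t)) - cre (h (Ccis t))) <= eps.
Proof.
  intros H eps He.
  (* The factor 3 leaves room for a chord of length below 2 d, as the circle map is Lipschitz with
     constant 2, and for a radial displacement of at most d. *)
  assert (HD : forall x : R, exists d : posreal, forall w, Cabs w <= 1 -> Cabs (Csub w (Ccis x)) < 3 * d ->
     Cabs (Csub (h w) (h (Ccis x))) < eps / 2).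
  { intros x. destruct (H (Ccis x)) with (eps := eps / 2) as (d & Hd & H1).
    - rewrite Cabs_cis; lra.
    - lra.
    - assert (Hd3 : 0 < d / 3) by lra. exists (mkposreal _ Hd3). simpl. intros w Hw Hw2. apply H1; [exact Hw|lra]. }
  set (dl := fun x => epsilon (inhabits (mkposreal 1 Rlt_0_1)) (fun d : posreal => forall w, Cabs w <= 1 -> Cabs (Csub w (Ccis x)) < 3 * d ->
     Cabs (Csub (h w) (h (Ccis x))) < eps / 2)).
  assert (Hdl : forall x w, Cabs w <= 1 -> Cabs (Csub w (Ccis x)) < 3 * dl x -> Cabs (Csub (h w) (h (Ccis x))) < eps / 2).
  { intros x. exact (epsilon_spec _ _ (HD x)). }
  destruct (compactness_value_1d 0 (2 * PI) dl) as [d Hd].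
  (* For s > - ln (1 + d) one has exp s > 1 / (1 + d) >= 1 - d. *)
  exists (ln (1 + d)). assert (d0 := cond_pos d).
  split; [rewrite <- ln_1; apply ln_increasing; lra|].
  intros s t Hs Ht.
  apply Rnot_lt_le. intros Hlt.
  apply (Hd t Ht). intros (x & Hx & Hxt & Hdx).
  assert (B1 : 1 - exp s <= d).
  { assert (/ (1 + d) < exp s).
    { rewrite <- (exp_ln (/ (1 + d))) by (apply Rinv_0_lt_compat; lra).
      apply exp_increasing. rewrite ln_Rinv by lra. lra. }
    assert (1 - d <= / (1 + d)).
    { apply (Rmult_le_reg_r (1 + d)); [lra|]. rewrite Rinv_l by lra. nra. }
    lra. }
  assert (Hes := exp_lt_1 s ltac:(lra)). assert (Hep := exp_pos s).
  assert (Hc : Cabs (Csub (Ccis t) (Ccis x)) < 2 * dl x).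
  { eapply Rle_lt_trans; [apply cis_lipschitz|lra]. }
  assert (dx0 := cond_pos (dl x)).
  assert (P1 := Hdl x (Ccis t) ltac:(rewrite Cabs_cis; lra) ltac:(lra)).
  assert (P2 := Hdl x (polar s t) ltac:(rewrite Cabs_polar; lra)).
  lapply P2; clear P2; [intros P2|].
  - apply (Rlt_irrefl eps). eapply Rlt_trans; [exact Hlt|].
    replace (cre (h (polar s t)) - cre (h (Ccis t)))
      with (cre (Csub (Csub (h (polar s t)) (h (Ccis x))) (Csub (h (Ccis t)) (h (Ccis x))))) by (simpl; ring).
    eapply Rle_lt_trans; [apply Cabs_cre|]. unfold Csub at 1.
    eapply Rle_lt_trans; [apply Cabs_add|]. rewrite Cabs_opp. lra.
  - replace (Csub (polar s t) (Ccis x)) with (Cadd (Csub (polar s t) (Ccis t)) (Csub (Ccis t) (Ccis x))) by ring.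
    eapply Rle_lt_trans; [apply Cabs_add|].
    replace (Csub (polar s t) (Ccis t)) with (Cmul (Cr (exp s - 1)) (Ccis t)) by (unfold polar; cx_solve).
    rewrite Cabs_mul, Cabs_cis, Cabs_Cr, Rabs_left by lra. lra.
Qed.

(** The circle means agree for all radii below one. A small radius compares them with the value at
    the origin, a radius near one with the boundary mean. *)
Theorem mean_value_property h : disk_holo h ->
  RInt (fun t => cre (h (Ccis t))) 0 (2 * PI) = 2 * PI * cre (h Czero).
Proof.
  intros [Hd Hc]. pose proof PI_RGT_0 as HPI.
  assert (Exp : forall s, s < 0 -> ex_RInt (fun t => cre (h (polar s t))) 0 (2 * PI)).
  { intros s Hs. apply ex_RInt_cont; [lra|]. intros x _.
    apply (CRdiff_cont_u (fun s t => cre (h (polar s t))) (fun s t => cim (h (polar s t))) s x).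
    apply CRdiff_polar, Hd. rewrite Cabs_polar. now apply exp_lt_1. }
  assert (Ex0 : ex_RInt (fun t => cre (h (Ccis t))) 0 (2 * PI)).
  { apply ex_RInt_cont; [lra|]. intros x _. apply circle_continuous, Hc. rewrite Cabs_cis; lra. }
  assert (K : forall eps, 0 < eps ->
    Rabs (RInt (fun t => cre (h (Ccis t))) 0 (2 * PI) - 2 * PI * cre (h Czero)) <= eps * (4 * PI)).
  { intros eps He.
    destruct (circle_uniform_limit h Hc eps He) as (d1 & D1 & H1).
    assert (Z : Cabs Czero <= 1) by (change Czero with (Cr 0); rewrite Cabs_Cr, Rabs_R0; lra).
    destruct (Hc Czero Z eps He) as (d2 & D2 & H2).
    (* The radius exp b is close to 1, while exp a < d2 puts the inner circle into the neighbourhood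
       of the origin. *)
    set (b := - (d1 / 2)). set (a := Rmin (b - 1) (ln d2 - 1)).
    assert (Ha : a < b) by (pose proof (Rmin_l (b - 1) (ln d2 - 1)); unfold a; lra).
    assert (Ha2 : exp a < d2).
    { rewrite <- (exp_ln d2) by exact D2. apply exp_increasing.
      pose proof (Rmin_r (b - 1) (ln d2 - 1)); unfold a; lra. }
    assert (Hb : b < 0) by (unfold b; lra).
    pose proof (polar_mean_const h Hd a b Ha Hb) as E.
    assert (B1 : Rabs (RInt (fun t => cre (h (polar a t))) 0 (2 * PI) - cre (h Czero) * (2 * PI - 0)) <= eps * (2 * PI - 0)).
    { apply RInt_near_const; [lra|apply Exp; lra|]. intros x _.
      left. eapply Rle_lt_trans; [|apply (H2 (polar a x))].
      - replace (cre (h (polar a x)) - cre (h Czero)) with (cre (Csub (h (polar a x)) (h Czero))) by (simpl; ring).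
        apply Cabs_cre.
      - rewrite Cabs_polar. left. apply exp_lt_1. lra.
      - replace (Csub (polar a x) Czero) with (polar a x) by ring. now rewrite Cabs_polar. }
    assert (B2 : Rabs (RInt (fun t => cre (h (polar b t)) - cre (h (Ccis t))) 0 (2 * PI) - 0 * (2 * PI - 0)) <= eps * (2 * PI - 0)).
    { apply RInt_near_const; [lra| |].
      - apply (@ex_RInt_minus R_NormedModule); [apply Exp; lra|exact Ex0].
      - intros x Hx. rewrite Rminus_0_r. apply H1; [unfold b; lra|exact Hx]. }
    assert (E2 : RInt (fun t => cre (h (polar b t)) - cre (h (Ccis t))) 0 (2 * PI) =
      RInt (fun t => cre (h (polar b t))) 0 (2 * PI) - RInt (fun t => cre (h (Ccis t))) 0 (2 * PI)).
    { apply (@RInt_minus R_CompleteNormedModule); [apply Exp; lra|exact Ex0]. }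
    rewrite E2, E in B2.
    apply Rabs_le_between in B1. apply Rabs_le_between in B2. apply Rabs_le_between. lra. }
  set (D := RInt (fun t => cre (h (Ccis t))) 0 (2 * PI) - 2 * PI * cre (h Czero)) in *.
  assert (D = 0); [|unfold D in *; lra].
  apply Rabs_eq_0. apply Rle_antisym; [|apply Rabs_pos].
  apply Rnot_lt_le. intros HD.
  specialize (K (Rabs D / (8 * PI)) ltac:(apply Rdiv_lt_0_compat; lra)).
  replace (Rabs D / (8 * PI) * (4 * PI)) with (Rabs D / 2) in K by (field; lra). lra.
Qed.

(** * Uniqueness of the Iwasawa decomposition *)

Lemma Cdiff_const c w : Cdiff_at (fun _ => c) w.
Proof.
  exists Czero. intros eps He. exists 1. split; [lra|]. intros h _.
  replace (Csub (Csub c c) (Cmul Czero h)) with (Cr 0) by (change (Cr 0) with Czero; ring).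
  rewrite Cabs_Cr, Rabs_R0. apply Rmult_le_pos; [lra|apply Cabs_nonneg].
Qed.

Lemma Cdiff_add f g w : Cdiff_at f w -> Cdiff_at g w -> Cdiff_at (fun z => Cadd (f z) (g z)) w.
Proof.
  intros [L H] [M K]. exists (Cadd L M). intros eps He.
  destruct (H (eps / 2)) as (d1 & D1 & H1); [lra|]. destruct (K (eps / 2)) as (d2 & D2 & H2); [lra|].
  exists (Rmin d1 d2). split; [now apply Rmin_glb_lt|]. intros h [h0 hd].
  specialize (H1 h (conj h0 (Rlt_le_trans _ _ _ hd (Rmin_l _ _)))).
  specialize (H2 h (conj h0 (Rlt_le_trans _ _ _ hd (Rmin_r _ _)))).
  match goal with |- Cabs ?x <= _ => replace x with
    (Cadd (Csub (Csub (f (Cadd w h)) (f w)) (Cmul L h)) (Csub (Csub (g (Cadd w h)) (g w)) (Cmul M h))) by ring end.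
  eapply Rle_trans; [apply Cabs_add|]. lra.
Qed.

Lemma Cdiff_mul f g w : Cdiff_at f w -> Cdiff_at g w -> Cdiff_at (fun z => Cmul (f z) (g z)) w.
Proof.
  intros HF HG. apply Cdiff_at_le in HF. apply Cdiff_at_le in HG.
  destruct HF as [L H]. destruct HG as [M K].
  exists (Cadd (Cmul L (g w)) (Cmul (f w) M)). intros eps He.
  set (S := Cabs (f w) + Cabs (g w) + 2).
  pose proof (Cabs_nonneg (f w)) as f0. pose proof (Cabs_nonneg (g w)) as g0.
  pose proof (Cabs_nonneg L) as L0. pose proof (Cabs_nonneg M) as M0.
  assert (S0 : 0 < S) by (unfold S; lra).
  set (e := Rmin 1 (eps / S)).
  assert (e0 : 0 < e) by (apply Rmin_glb_lt; [lra|now apply Rdiv_lt_0_compat]).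
  assert (e1 : e <= 1) by apply Rmin_l.
  assert (e2 : e * S <= eps) by (apply Rle_div_r; [exact S0|apply Rmin_r]).
  destruct (H e e0) as (d1 & D1 & H1). destruct (K e e0) as (d2 & D2 & H2).
  set (T := Cabs L * (Cabs M + 1) + Cabs M + 1).
  assert (LM0 : 0 <= Cabs L * (Cabs M + 1)) by (apply Rmult_le_pos; lra).
  assert (T0 : 0 < T) by (unfold T; lra).
  assert (D3 : 0 < e / T) by now apply Rdiv_lt_0_compat.
  exists (Rmin (Rmin d1 d2) (e / T)). split; [now repeat apply Rmin_glb_lt|]. intros k [_ kd].
  assert (k1 : Cabs k < d1) by (eapply Rlt_le_trans; [exact kd|]; eapply Rle_trans; [apply Rmin_l|apply Rmin_l]).
  assert (k2 : Cabs k < d2) by (eapply Rlt_le_trans; [exact kd|]; eapply Rle_trans; [apply Rmin_l|apply Rmin_r]).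
  assert (k3 : Cabs k * T < e) by (apply Rlt_div_r; [exact T0|]; eapply Rlt_le_trans; [exact kd|apply Rmin_r]).
  pose proof (Cabs_nonneg k) as k0.
  specialize (H1 k k1). specialize (H2 k k2).
  set (df := Csub (Csub (f (Cadd w k)) (f w)) (Cmul L k)) in *.
  set (dg := Csub (Csub (g (Cadd w k)) (g w)) (Cmul M k)) in *.
  assert (Gd : Cabs (Csub (g (Cadd w k)) (g w)) <= (Cabs M + 1) * Cabs k).
  { replace (Csub (g (Cadd w k)) (g w)) with (Cadd dg (Cmul M k)) by (unfold dg; ring).
    eapply Rle_trans; [apply Cabs_add|]. rewrite Cabs_mul. nra. }
  assert (Gb : Cabs (g (Cadd w k)) <= Cabs (g w) + 1).
  { replace (g (Cadd w k)) with (Cadd (Csub (g (Cadd w k)) (g w)) (g w)) by ring.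
    eapply Rle_trans; [apply Cabs_add|].
    assert ((Cabs M + 1) * Cabs k <= Cabs k * T) by (unfold T; nra). lra. }
  match goal with |- Cabs ?x <= _ => replace x with
    (Cadd (Cmul df (g (Cadd w k))) (Cadd (Cmul (Cmul L k) (Csub (g (Cadd w k)) (g w))) (Cmul (f w) dg)))
    by (unfold df, dg; ring) end.
  eapply Rle_trans; [apply Cabs_add|].
  eapply Rle_trans; [apply Rplus_le_compat_l, Cabs_add|]. rewrite !Cabs_mul.
  assert (B1 : Cabs df * Cabs (g (Cadd w k)) <= (e * Cabs k) * (Cabs (g w) + 1))
    by (apply Rmult_le_compat; try apply Cabs_nonneg; assumption).
  assert (B2 : Cabs L * Cabs k * Cabs (Csub (g (Cadd w k)) (g w)) <= e * Cabs k).
  { apply Rle_trans with ((Cabs L * Cabs k) * ((Cabs M + 1) * Cabs k)).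
    - apply Rmult_le_compat_l; [now apply Rmult_le_pos|exact Gd].
    - replace ((Cabs L * Cabs k) * ((Cabs M + 1) * Cabs k))
        with ((Cabs L * (Cabs M + 1) * Cabs k) * Cabs k) by ring.
      apply Rmult_le_compat_r; [exact k0|]. unfold T in k3. nra. }
  assert (B3 : Cabs (f w) * Cabs dg <= Cabs (f w) * (e * Cabs k)) by (apply Rmult_le_compat_l; assumption).
  apply Rle_trans with (e * S * Cabs k); [unfold S; lra|].
  apply Rmult_le_compat_r; assumption.
Qed.

Lemma Ccont_const c w : Ccont_disk_at (fun _ => c) w.
Proof.
  intros eps He. exists 1. split; [lra|]. intros.
  replace (Csub c c) with (Cr 0) by (change (Cr 0) with Czero; ring).
  now rewrite Cabs_Cr, Rabs_R0.
Qed.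
Lemma Ccont_add f g w : Ccont_disk_at f w -> Ccont_disk_at g w -> Ccont_disk_at (fun z => Cadd (f z) (g z)) w.
Proof.
  intros H K eps He.
  destruct (H (eps / 2)) as (d1 & D1 & H1); [lra|]. destruct (K (eps / 2)) as (d2 & D2 & H2); [lra|].
  exists (Rmin d1 d2). split; [now apply Rmin_glb_lt|]. intros z z1 zd.
  specialize (H1 z z1 (Rlt_le_trans _ _ _ zd (Rmin_l _ _))).
  specialize (H2 z z1 (Rlt_le_trans _ _ _ zd (Rmin_r _ _))).
  replace (Csub (Cadd (f z) (g z)) (Cadd (f w) (g w))) with (Cadd (Csub (f z) (f w)) (Csub (g z) (g w))) by ring.
  eapply Rle_lt_trans; [apply Cabs_add|]. lra.
Qed.
Lemma Ccont_mul f g w : Ccont_disk_at f w -> Ccont_disk_at g w -> Ccont_disk_at (fun z => Cmul (f z) (g z)) w.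
Proof.
  intros H K eps He.
  set (S := Cabs (f w) + Cabs (g w) + 2).
  pose proof (Cabs_nonneg (f w)) as f0. pose proof (Cabs_nonneg (g w)) as g0.
  assert (S0 : 0 < S) by (unfold S; lra).
  set (e := Rmin 1 (eps / S)).
  assert (e0 : 0 < e) by (apply Rmin_glb_lt; [lra|now apply Rdiv_lt_0_compat]).
  assert (e1 : e <= 1) by apply Rmin_l.
  assert (e2 : e * S <= eps) by (apply Rle_div_r; [exact S0|apply Rmin_r]).
  destruct (H e e0) as (d1 & D1 & H1). destruct (K e e0) as (d2 & D2 & H2).
  exists (Rmin d1 d2). split; [now apply Rmin_glb_lt|]. intros z z1 zd.
  specialize (H1 z z1 (Rlt_le_trans _ _ _ zd (Rmin_l _ _))).
  specialize (H2 z z1 (Rlt_le_trans _ _ _ zd (Rmin_r _ _))).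
  replace (Csub (Cmul (f z) (g z)) (Cmul (f w) (g w)))
    with (Cadd (Cmul (Csub (f z) (f w)) (Csub (g z) (g w)))
      (Cadd (Cmul (Csub (f z) (f w)) (g w)) (Cmul (f w) (Csub (g z) (g w))))) by ring.
  eapply Rle_lt_trans; [apply Cabs_add|].
  eapply Rle_lt_trans; [apply Rplus_le_compat_l, Cabs_add|]. rewrite !Cabs_mul.
  pose proof (Cabs_nonneg (Csub (f z) (f w))). pose proof (Cabs_nonneg (Csub (g z) (g w))).
  unfold S in e2. nra.
Qed.

Lemma disk_holo_const c : disk_holo (fun _ => c).
Proof. split; intros; [apply Cdiff_const|apply Ccont_const]. Qed.
Lemma disk_holo_add f g : disk_holo f -> disk_holo g -> disk_holo (fun z => Cadd (f z) (g z)).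
Proof. intros [H1 H2] [K1 K2]. split; intros; [apply Cdiff_add|apply Ccont_add]; auto. Qed.
Lemma disk_holo_mul f g : disk_holo f -> disk_holo g -> disk_holo (fun z => Cmul (f z) (g z)).
Proof. intros [H1 H2] [K1 K2]. split; intros; [apply Cdiff_mul|apply Ccont_mul]; auto. Qed.
Lemma disk_holo_ext f g : (forall z, f z = g z) -> disk_holo f -> disk_holo g.
Proof.
  intros E [H1 H2]. split.
  - intros w Hw. destruct (H1 w Hw) as [L HL]. exists L. intros eps He.
    destruct (HL eps He) as (d & Hd & Hk). exists d. split; [exact Hd|]. intros. rewrite <- !E. auto.
  - intros w Hw eps He. destruct (H2 w Hw eps He) as (d & Hd & Hk). exists d. split; [exact Hd|].
    intros. rewrite <- !E. auto.
Qed.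
Lemma disk_holo_opp f : disk_holo f -> disk_holo (fun z => Copp (f z)).
Proof.
  intros H. apply disk_holo_ext with (fun z => Cmul (Copp Cone) (f z)); [intros; ring|].
  apply disk_holo_mul; [apply disk_holo_const|exact H].
Qed.

(** The primitive is nondecreasing with value 0 at both ends, hence zero, and its derivative is the
    integrand. *)
Lemma RInt_0_nonneg (f : R -> R) a b : a < b -> (forall x, continuous f x) -> (forall x, 0 <= f x) ->
  RInt f a b = 0 -> forall x, a < x < b -> f x = 0.
Proof.
  intros Hab Hc H0 HI x Hx.
  assert (E : forall c d, c <= d -> ex_RInt f c d) by (intros; apply ex_RInt_cont; auto).
  assert (P : forall c d, c <= d -> 0 <= RInt f c d) by (intros; apply RInt_ge_0; auto).
  assert (Z : forall y, a <= y <= b -> RInt f a y = 0).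
  { intros y Hy. pose proof (P a y ltac:(lra)). pose proof (P y b ltac:(lra)).
    assert (C : RInt f a y + RInt f y b = RInt f a b).
    { apply (@RInt_Chasles R_CompleteNormedModule); apply E; lra. }
    lra. }
  assert (D1 : is_derive (RInt f a) x (f x)).
  { apply (@is_derive_RInt R_NormedModule f (RInt f a) a x); [|apply Hc].
    exists (mkposreal (x - a) ltac:(lra)). intros y Hy.
    apply (@RInt_correct R_CompleteNormedModule). apply E.
    unfold ball in Hy; simpl in Hy. unfold AbsRing_ball, abs, minus, plus, opp in Hy; simpl in Hy.
    apply Rabs_lt_between in Hy. lra. }
  assert (D2 : is_derive (RInt f a) x 0).
  { apply (is_derive_ext_loc (fun _ => 0)).
    - assert (He : 0 < Rmin (x - a) (b - x)) by (apply Rmin_glb_lt; lra).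
      exists (mkposreal _ He). intros y Hy.
      unfold ball in Hy; simpl in Hy. unfold AbsRing_ball, abs, minus, plus, opp in Hy; simpl in Hy.
      pose proof (Rmin_l (x - a) (b - x)). pose proof (Rmin_r (x - a) (b - x)).
      apply Rabs_lt_between in Hy. symmetry; apply Z; lra.
    - apply is_derive_Reals. apply derivable_pt_lim_const. }
  apply is_derive_unique in D1. apply is_derive_unique in D2. congruence.
Qed.

(** The mean of Im h shows that h(0) is real. Then k = h - h(0) is real on the circle, so Re(k^2) is
    a nonnegative function there with mean Re(k(0)^2) = 0. *)
Lemma real_circle_const h : disk_holo h -> (forall w, Cabs w = 1 -> cim (h w) = 0) ->
  forall w, Cabs w = 1 -> h w = h Czero.
Proof.
  intros H Hr. pose proof PI_RGT_0 as HPI.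
  assert (I0 : cim (h Czero) = 0).
  { pose proof (mean_value_property (fun z => Cmul Ci (h z))) as M. lapply M; clear M; [intros M|].
    - rewrite (RInt_ext _ (fun _ => 0)) in M.
      + rewrite RInt_const in M. unfold scal in M; simpl in M. unfold mult in M; simpl in M. nra.
      + intros t _. simpl. rewrite Hr by apply Cabs_cis. ring.
    - apply disk_holo_mul; [apply disk_holo_const|exact H]. }
  set (k := fun z => Cadd (h z) (Copp (h Czero))).
  assert (Hk : disk_holo (fun z => Cmul (k z) (k z))).
  { assert (disk_holo k) by (apply disk_holo_add; [exact H|apply disk_holo_const]).
    now apply disk_holo_mul. }
  assert (E : forall w, Cabs w = 1 -> cre (Cmul (k w) (k w)) = (cre (h w) - cre (h Czero)) * (cre (h w) - cre (h Czero))).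
  { intros w Hw. simpl. rewrite (Hr w Hw), I0. ring. }
  assert (Z : forall t, 0 < t < 2 * PI -> cre (Cmul (k (Ccis t)) (k (Ccis t))) = 0).
  { apply RInt_0_nonneg.
    - lra.
    - intros t. apply (circle_continuous (fun z => Cmul (k z) (k z))). apply Hk. rewrite Cabs_cis; lra.
    - intros t. rewrite E by apply Cabs_cis. apply Rle_0_sqr.
    - rewrite (mean_value_property (fun z => Cmul (k z) (k z)) Hk). unfold k; simpl. ring. }
  assert (Z2 : forall t, 0 < t < 2 * PI -> h (Ccis t) = h Czero).
  { intros t Ht. specialize (Z t Ht). rewrite E in Z by apply Cabs_cis.
    apply Cx_eq; [|rewrite Hr by apply Cabs_cis; now rewrite I0].
    apply Rmult_integral in Z. lra. }
  (* The point 1 is an end of the parameter interval, where the integral argument says nothing; it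
     is reached by continuity. *)
  assert (Z1 : h (Ccis 0) = h Czero).
  { apply Cx_eq; [|rewrite Hr by apply Cabs_cis; now rewrite I0].
    destruct (Req_dec (cre (h (Ccis 0))) (cre (h Czero))) as [?|n]; [assumption|exfalso].
    pose proof (proj2 H (Ccis 0) ltac:(rewrite Cabs_cis; lra)
      (Rabs (cre (h (Ccis 0)) - cre (h Czero))) ltac:(apply Rabs_pos_lt; lra)) as (d & Hd & Hc).
    set (t := Rmin 1 (d / 3)).
    assert (t0 : 0 < t) by (apply Rmin_glb_lt; lra).
    assert (t1 : t <= 1) by apply Rmin_l. assert (t2 : t <= d / 3) by apply Rmin_r.
    specialize (Hc (Ccis t) ltac:(rewrite Cabs_cis; lra)).
    lapply Hc; clear Hc.
    - rewrite Z2 by (pose proof PI2_1; lra). intros Hc.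
      apply (Rlt_irrefl (Rabs (cre (h (Ccis 0)) - cre (h Czero)))).
      eapply Rle_lt_trans; [|exact Hc]. rewrite Rabs_minus_sym.
      exact (Cabs_cre (Csub (h Czero) (h (Ccis 0)))).
    - eapply Rle_lt_trans; [apply cis_lipschitz|]. rewrite Rminus_0_r, Rabs_pos_eq; lra. }
  intros w Hw. destruct (Cis_surj w Hw) as [t Ht].
  (* The vanishing is known for angles in (0, 2 pi), so the argument of w must be taken in [0, 2
     pi). *)
  assert (Q : exists t', 0 <= t' < 2 * PI /\ Ccis t' = w).
  { apply Cabs_1_normsq in Hw. unfold Cnormsq in Hw. destruct w as [x y]; simpl in Hw.
    assert (Hx : -1 <= x <= 1) by nra. pose proof (acos_bound x) as B.
    assert (S : sin (acos x) = sqrt (y * y)).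
    { rewrite sin_acos by lra. f_equal. unfold Rsqr. lra. }
    destruct (Rle_dec 0 y) as [Hy|Hy].
    - exists (acos x). split; [lra|]. apply Cx_eq; simpl; [apply cos_acos; lra|].
      rewrite S. now apply sqrt_square.
    - assert (S' : sin (acos x) = - y).
      { rewrite S. replace (y * y) with (- y * - y) by ring. apply sqrt_square; lra. }
      exists (2 * PI - acos x). split.
      + destruct (Req_dec (acos x) 0) as [e|n]; [rewrite e, sin_0 in S'; lra|lra].
      + apply Cx_eq; simpl.
        * rewrite cos_minus, cos_2PI, sin_2PI, cos_acos by lra. ring.
        * rewrite sin_minus, cos_2PI, sin_2PI. lra. }
  destruct Q as (t' & [[Ht0|Ht0] Ht1] & <-); [apply Z2; lra|now rewrite <- Ht0].
Qed.

(** W = V2 V1^-1 = F2^-1 F1 extends holomorphically to the disk and lies in the real form on the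
    circle, so its entries are constant; the twist kills the off-diagonal ones. The remaining
    diag(p, conj p) has |p| = 1, and p is a quotient of two positive numbers. *)
Theorem iwasawa_unique F1 V1 F2 V2 :
  InLoopSU F1 -> InLoopSU F2 -> InLoopPlusPos V1 -> InLoopPlusPos V2 ->
  (forall lam, Cabs lam = 1 -> Mmul (F1 lam) (V1 lam) = Mmul (F2 lam) (V2 lam)) ->
  forall lam, Cabs lam = 1 -> F1 lam = F2 lam.
Proof.
  rewrite !InLoopSU_iff.
  intros [F1s F1r] [F2s F2r] [V1s (G1 & G1e & G1d & G1c & G1p & i1 & _ & _)]
    [V2s (G2 & G2e & G2d & G2c & G2p & i2 & _ & _)] HE.
  assert (E : forall lam, Cabs lam = 1 -> Mmul (V2 lam) (Madj (V1 lam)) = Mmul (Madj (F2 lam)) (F1 lam)).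
  { intros lam Hl. destruct (F1s lam Hl) as [d1 _]. destruct (F2s lam Hl) as [d2 _].
    destruct (V1s lam Hl) as [e1 _].
    rewrite <- (Mmul_1l (V2 lam)), <- (Mmul_adj_l _ d2).
    rewrite <- (Mmul_assoc _ (F2 lam)), <- HE by exact Hl.
    rewrite <- !Mmul_assoc, Mmul_adj_r, Mmul_1r by exact e1. reflexivity. }
  set (W := fun z => Mmul (G2 z) (Madj (G1 z))).
  assert (WE : forall lam, Cabs lam = 1 -> W lam = Mmul (V2 lam) (Madj (V1 lam))).
  { intros lam Hl. unfold W. now rewrite G1e, G2e. }
  assert (WR : forall lam, Cabs lam = 1 -> RF (W lam)).
  { intros lam Hl. rewrite WE, E by exact Hl. apply RF_mul; [apply RF_adj|]; auto. }
  assert (WS : InLoopSL W).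
  { intros lam Hl. pose proof (InLoopSL_mul _ _ V2s (InLoopSL_adj _ V1s) lam Hl) as K.
    rewrite !WE by (rewrite ?Cabs_opp; exact Hl). exact K. }
  assert (a1 : disk_holo (fun z => a11 (G1 z))) by (split; intros; [now apply G1d|now apply G1c]).
  assert (b1 : disk_holo (fun z => a12 (G1 z))) by (split; intros; [now apply G1d|now apply G1c]).
  assert (c1 : disk_holo (fun z => a21 (G1 z))) by (split; intros; [now apply G1d|now apply G1c]).
  assert (d1 : disk_holo (fun z => a22 (G1 z))) by (split; intros; [now apply G1d|now apply G1c]).
  assert (a2 : disk_holo (fun z => a11 (G2 z))) by (split; intros; [now apply G2d|now apply G2c]).
  assert (b2 : disk_holo (fun z => a12 (G2 z))) by (split; intros; [now apply G2d|now apply G2c]).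
  assert (c2 : disk_holo (fun z => a21 (G2 z))) by (split; intros; [now apply G2d|now apply G2c]).
  assert (d2 : disk_holo (fun z => a22 (G2 z))) by (split; intros; [now apply G2d|now apply G2c]).
  assert (pW : disk_holo (fun z => a11 (W z))).
  { simpl. apply disk_holo_add; apply disk_holo_mul; try assumption; now apply disk_holo_opp. }
  assert (qW : disk_holo (fun z => a12 (W z))).
  { simpl. apply disk_holo_add; apply disk_holo_mul; try assumption; now apply disk_holo_opp. }
  assert (rW : disk_holo (fun z => a21 (W z))).
  { simpl. apply disk_holo_add; apply disk_holo_mul; try assumption; now apply disk_holo_opp. }
  assert (sW : disk_holo (fun z => a22 (W z))).
  { simpl. apply disk_holo_add; apply disk_holo_mul; try assumption; now apply disk_holo_opp. }
  (* A pair of holomorphic functions conjugate to each other on the circle has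
     real sum and purely imaginary difference there. *)
  assert (C : forall f g, disk_holo f -> disk_holo g ->
    (forall lam, Cabs lam = 1 -> g lam = Cconj (f lam)) ->
    forall lam, Cabs lam = 1 -> f lam = f Czero /\ g lam = g Czero).
  { intros f g Hf Hg Hfg lam Hl.
    assert (S : Cadd (f lam) (g lam) = Cadd (f Czero) (g Czero)).
    { apply (real_circle_const (fun z => Cadd (f z) (g z))); [now apply disk_holo_add| |exact Hl].
      intros w Hw. rewrite (Hfg w Hw). simpl. ring. }
    assert (D : Cmul Ci (Cadd (f lam) (Copp (g lam))) = Cmul Ci (Cadd (f Czero) (Copp (g Czero)))).
    { apply (real_circle_const (fun z => Cmul Ci (Cadd (f z) (Copp (g z))))); [| |exact Hl].
      - apply disk_holo_mul; [apply disk_holo_const|]. apply disk_holo_add; [exact Hf|now apply disk_holo_opp].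
      - intros w Hw. rewrite (Hfg w Hw). simpl. ring. }
    pose proof (f_equal cre S) as S1. pose proof (f_equal cim S) as S2.
    pose proof (f_equal cre D) as D1. pose proof (f_equal cim D) as D2. simpl in S1, S2, D1, D2.
    split; apply Cx_eq; lra. }
  assert (C1 := C _ _ pW sW (fun lam Hl => proj2 (WR lam Hl))).
  assert (C2 := C _ _ qW rW (fun lam Hl => proj1 (WR lam Hl))).
  assert (U1 : Cabs Cone = 1) by (change Cone with (Cr 1); now rewrite Cabs_Cr, Rabs_R1).
  (* Twisting changes the sign of the off-diagonal entry at -lambda, and a constant equal to its
     negative is zero. *)
  assert (Q0 : a12 (W Czero) = Czero).
  { destruct (WS Cone U1) as [_ T].
    assert (T' : a12 (W (Copp Cone)) = Copp (a12 (W Cone))) by (rewrite T; generalize (W Cone); intros; simpl; ring).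
    clear T. rename T' into T.
    rewrite (proj1 (C2 _ (Copp_unit _ U1))), (proj1 (C2 _ U1)) in T. revert T. generalize (a12 (W Czero)). intros q T.
    pose proof (f_equal cre T) as T1. pose proof (f_equal cim T) as T2. simpl in T1, T2.
    apply Cx_eq; simpl in *; lra. }
  assert (R0 : a21 (W Czero) = Czero).
  { rewrite <- (proj2 (C2 _ U1)), (proj1 (WR _ U1)), (proj1 (C2 _ U1)), Q0. apply Cconj_Czero. }
  set (p := a11 (W Czero)) in *. set (s := a22 (W Czero)) in *.
  assert (Wd : forall lam, Cabs lam = 1 -> W lam = mkM p Czero Czero s).
  { intros lam Hl. apply M2_eq; cbn [a11 a12 a21 a22].
    - apply (C1 lam Hl). - rewrite <- Q0. apply (C2 lam Hl).
    - rewrite <- R0. apply (C2 lam Hl). - apply (C1 lam Hl). }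
  assert (VW : forall lam, Cabs lam = 1 -> V2 lam = Mmul (mkM p Czero Czero s) (V1 lam)).
  { intros lam Hl. rewrite <- (Wd lam Hl), WE, <- Mmul_assoc by exact Hl.
    destruct (V1s lam Hl) as [e1 _]. now rewrite (Mmul_adj_l _ e1), Mmul_1r. }
  (* The relation V2 = W V1 is known on the circle, whereas positivity is imposed at the origin. The
     difference of the (1,1) entries vanishes on the circle and hence at 0. *)
  assert (HG : a11 (G2 Czero) = Cmul p (a11 (G1 Czero))).
  { set (h := fun z => Cadd (a11 (G2 z)) (Copp (Cmul p (a11 (G1 z))))).
    assert (hz : forall lam, Cabs lam = 1 -> h lam = Czero).
    { intros lam Hl. unfold h. rewrite G1e, G2e, VW by exact Hl. simpl. ring. }
    assert (h0 : h Cone = h Czero).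
    { apply real_circle_const; [| |exact U1].
      - apply disk_holo_add; [exact a2|]. apply disk_holo_opp. apply disk_holo_mul; [apply disk_holo_const|exact a1].
      - intros w Hw. now rewrite hz. }
    rewrite hz in h0 by exact U1.
    replace (a11 (G2 Czero)) with (Cadd (h Czero) (Cmul p (a11 (G1 Czero)))) by (unfold h; ring).
    rewrite <- h0. ring. }
  assert (ps : s = Cconj p).
  { destruct (C1 _ U1) as [e1 e2]. rewrite <- e1, <- e2. apply (WR _ U1). }
  assert (pd : Cmul p s = Cone).
  { destruct (WS Cone U1) as [d _]. rewrite (Wd _ U1) in d. rewrite <- d. unfold Mdet; simpl. ring. }
  assert (p1 : p = Cone).
  { clearbody p s. rewrite ps, Cmul_conj in pd. apply (f_equal cre) in pd. unfold Cnormsq in pd. simpl in pd.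
    pose proof (f_equal cre HG) as g1. pose proof (f_equal cim HG) as g2. simpl in g1, g2.
    rewrite i1 in g1, g2. rewrite i2 in g2.
    assert (ip : cim p = 0) by nra.
    assert (rp : 0 < cre p).
    { apply (Rmult_lt_reg_r (cre (a11 (G1 Czero)))); [exact G1p|]. lra. }
    apply Cx_eq; simpl; nra. }
  assert (s1 : s = Cone) by (rewrite ps, p1; apply Cconj_Cone).
  intros lam Hl. destruct (F1s lam Hl) as [fd1 _]. destruct (F2s lam Hl) as [fd2 _].
  assert (V12 : V2 lam = V1 lam).
  { rewrite (VW lam Hl), p1, s1. change (mkM Cone Czero Czero Cone) with Mid. apply Mmul_1l. }
  destruct (V1s lam Hl) as [e1 _].
  rewrite <- (Mmul_1r (F1 lam)), <- (Mmul_adj_r _ e1), Mmul_assoc, HE, V12 by exact Hl.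
  now rewrite <- Mmul_assoc, (Mmul_adj_r _ e1), Mmul_1r.
Qed.

(** * Translation in z as a left multiplication of frames *)

(** For traceless X the adjugate is -X, so adj(E) E has derivative zero along E = exp(tX). *)
Lemma Mdet_Mexp X t : Mtr X = Czero -> Mdet (Mexp X t) = Cone.
Proof.
  intros H.
  assert (E : Mmul (Madj (Mexp X t)) (Mexp X t) = Mid).
  { rewrite (Mderiv_0_const (fun t => Mmul (Madj (Mexp X t)) (Mexp X t))).
    - rewrite Mexp_0. msolve.
    - intros s. eapply Mderiv_eq; [apply Mderiv_mul; [apply Mderiv_adj|]; apply Mexp_deriv|].
      assert (T : a22 X = Copp (a11 X)).
      { unfold Mtr in H. replace (a22 X) with (Csub (Cadd (a11 X) (a22 X)) (a11 X)) by ring. rewrite H. ring. }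
      cbv beta. generalize (Mexp X s). intros A. apply M2_eq; simpl; rewrite T; ring. }
  apply (f_equal a11) in E. simpl in E. unfold Mdet. rewrite <- E. simpl. ring.
Qed.

(** The conjugate-linear automorphism of the matrix algebra whose fixed points are [RF]. Membership
    in the real form can thus be proved by uniqueness for linear equations. *)
Definition Mflip (A : M2) : M2 :=
  mkM (Cconj (a22 A)) (Cconj (a21 A)) (Cconj (a12 A)) (Cconj (a11 A)).

Lemma RF_flip A : RF A <-> Mflip A = A.
Proof.
  split.
  - intros [H1 H2]. apply M2_eq; simpl; rewrite ?H1, ?H2, ?Cconj_conj; reflexivity.
  - intros H. split; rewrite <- H at 1; reflexivity.
Qed.

Lemma RF_Mexp X t : RF X -> RF (Mexp X t).
Proof.
  intros H. apply RF_flip. apply (Mexp_ode_unique X (fun t => Mflip (Mexp X t))).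
  - rewrite Mexp_0. msolve; cx_solve.
  - intros s. apply RF_flip in H.
    destruct (Mexp_deriv X s) as (H1 & H2 & H3 & H4).
    assert (E : Mflip (Mmul X (Mexp X s)) = Mmul X (Mflip (Mexp X s))).
    { transitivity (Mmul (Mflip X) (Mflip (Mexp X s))); [|now rewrite H].
      apply M2_eq; simpl; cconj_simpl; ring. }
    rewrite <- E.
    split; [|split; [|split]]; simpl; apply Cderiv_conj; assumption.
Qed.

Lemma Mexp_sigma3 X t :
  Mexp (Mmul sigma3 (Mmul X sigma3)) t = Mmul sigma3 (Mmul (Mexp X t) sigma3).
Proof.
  symmetry.
  apply (Mexp_ode_unique (Mmul sigma3 (Mmul X sigma3)) (fun t => Mmul sigma3 (Mmul (Mexp X t) sigma3))).
  - rewrite Mexp_0. msolve.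
  - intros s. eapply Mderiv_eq; [apply Mderiv_mul_const_l, Mderiv_mul_const_r, Mexp_deriv|]. msolve.
Qed.

Lemma Dpot_trace a b c lam : Mtr (Dpot a b c lam) = Czero.
Proof. unfold Mtr; simpl. ring. Qed.
Lemma Dpot_RF a b c lam : Cabs lam = 1 -> RF (Dpot a b c lam).
Proof.
  intros H. unfold Dpot. rewrite (Cinv_unit _ H).
  split; cbn [a11 a12 a21 a22]; cconj_simpl; ring.
Qed.
Lemma Dpot_twist a b c lam : Cabs lam = 1 ->
  Dpot a b c (Copp lam) = Mmul sigma3 (Mmul (Dpot a b c lam) sigma3).
Proof.
  intros H. unfold Dpot. rewrite (Cinv_unit _ H), (Cinv_unit _ (Copp_unit _ H)), Cconj_opp. msolve.
Qed.

Lemma InLoopSU_exp a b c t : InLoopSU (fun lam => Mexp (Dpot a b c lam) t).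
Proof.
  apply InLoopSU_iff. split.
  - intros lam H. split.
    + apply Mdet_Mexp, Dpot_trace.
    + rewrite Dpot_twist by exact H. apply Mexp_sigma3.
  - intros lam H. apply RF_Mexp, Dpot_RF, H.
Qed.

Definition Ysym (h h' : R -> M2) (t : R) : M2 :=
  Madd (Mscal (Copp Cone) (Mmul (h' t) (Madj (h t))))
       (Mscal (Copp half_i) (Mmul (h t) (Mmul sigma3 (Madj (h t))))).

(** Reads off the coordinates: the off-diagonal entries of Y at angle 0 are the complex number x1 +
    i x2 and its conjugate, up to the factors i/2 and -i/2, and the height sits in the diagonal of
    the angular derivative of Y. *)
Lemma SymHat_elim (F : Loop) (p : R3) :
  (forall t, Mdet (F (Ccis t)) = Cone) -> SymHat F (XE p) ->
  exists F' Y', (forall t, Mderiv_th (fun s => F (Ccis s)) t (F' t)) /\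
    Mderiv_th (Ysym (fun s => F (Ccis s)) F') 0 Y' /\
    a12 (Ysym (fun s => F (Ccis s)) F' 0) = Cmul half_i (mkC (p1 p) (p2 p)) /\
    a21 (Ysym (fun s => F (Ccis s)) F' 0) = Cmul (Copp half_i) (mkC (p1 p) (- p2 p)) /\
    a11 Y' = Cmul Ci (Cr (p3 p)).
Proof.
  intros Hd (lF & H1 & lf & (Y' & HY & Elf) & HX).
  exists (fun t => Mscal Ci (lF t)), Y'.
  assert (Hf : forall t, fL3 F lF t = Ysym (fun s => F (Ccis s)) (fun t => Mscal Ci (lF t)) t).
  { intros t. unfold fL3, Ysym, Msub. rewrite (Minv_det1 _ (Hd t)). msolve. }
  assert (E : Mscal Ci (Mscal (Copp Ci) Y') = Y').
  { msolve; cx_solve. }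
  split; [|split; [|split; [|split]]].
  - intros t. destruct (H1 t) as (d & Hd1 & ->).
    assert (E' : Mscal Ci (Mscal (Copp Ci) d) = d) by (msolve; cx_solve).
    rewrite E'. exact Hd1.
  - eapply Mderiv_ext; [exact Hf|exact HY].
  - rewrite <- Hf. apply (f_equal a12) in HX. revert HX. generalize (fL3 F lF 0). intros A HX.
    simpl in HX. transitivity (Cadd (a12 A) (Cmul (Copp Cone) (Cmul half_i Czero))); [ring|].
    rewrite <- HX. unfold half_i. apply Cx_eq; simpl; field.
  - rewrite <- Hf. apply (f_equal a21) in HX. revert HX. generalize (fL3 F lF 0). intros A HX.
    simpl in HX. transitivity (Cadd (a21 A) (Cmul (Copp Cone) (Cmul half_i Czero))); [ring|].
    rewrite <- HX. unfold half_i. apply Cx_eq; simpl; field.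
  - apply (f_equal a11) in HX. rewrite Elf in HX. simpl in HX.
    transitivity (Cmul (Cr (-2)) (Cadd Czero (Cmul (Copp Cone) (Cmul half_i (Cmul (Copp Ci) (a11 Y')))))).
    + unfold half_i. apply Cx_eq; simpl; field.
    + rewrite <- HX. apply Cx_eq; simpl; field.
Qed.

Lemma Ysym_transform (h1 h1' h2 h2' M : R -> M2) (M' : M2) t :
  (forall s, Mdet (h1 s) = Cone) ->
  (forall s, h2 s = Mmul (M s) (h1 s)) ->
  Mderiv_th h1 t (h1' t) -> Mderiv_th h2 t (h2' t) -> Mderiv_th M t M' ->
  Ysym h2 h2' t = Madd (Mscal (Copp Cone) (Mmul M' (Madj (M t))))
    (Mmul (M t) (Mmul (Ysym h1 h1' t) (Madj (M t)))).
Proof.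
  intros Hd E H1 H2 HM.
  assert (E2 : h2' t = Madd (Mmul M' (h1 t)) (Mmul (M t) (h1' t))).
  { eapply Mderiv_unique; [exact H2|]. eapply Mderiv_ext; [intros s; symmetry; apply E|].
    now apply Mderiv_mul. }
  unfold Ysym. rewrite E2, E, Madj_mul.
  transitivity (Madd (Mscal (Copp Cone) (Mmul (Mmul M' (Mmul (h1 t) (Madj (h1 t)))) (Madj (M t))))
    (Mmul (M t) (Mmul (Madd (Mscal (Copp Cone) (Mmul (h1' t) (Madj (h1 t))))
       (Mscal (Copp half_i) (Mmul (h1 t) (Mmul sigma3 (Madj (h1 t)))))) (Madj (M t))))).
  - generalize (h1 t) (h1' t) (M t) (Madj (M t)). intros. msolve.
  - rewrite (Mmul_adj_r _ (Hd t)), Mmul_1r. reflexivity.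
Qed.

Definition transl (a b : Cx) (c : R) (S : Loop) (t : R) (lam : Cx) : M2 :=
  Mmul (S lam) (Mmul (Mexp (Dpot a b c lam) t) (Madj (S lam))).

Definition IsFrame (D : Cx -> M2) (S : Loop) (z : Cx) (F : Loop) : Prop :=
  exists Fh Vp : Loop, InLoopSU Fh /\ InLoopPlusPos Vp /\
    (forall lam, Cabs lam = 1 -> IsMexp (Mscal z (D lam)) (Mmul (Fh lam) (Vp lam))) /\
    F = fun lam => Mmul (S lam) (Fh lam).

Lemma SurfPt_frame D S z p : SurfPt D S z p -> exists F, IsFrame D S z F /\ SymHat F (XE p).
Proof.
  intros (Fh & V & H1 & H2 & H3 & H4). eexists. split; [|exact H4].
  exists Fh, V. split; [exact H1|]. split; [exact H2|]. split; [exact H3|reflexivity].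
Qed.

Lemma IsFrame_SU D S z F : InLoopSU S -> IsFrame D S z F -> InLoopSU F.
Proof. intros HS (Fh & V & H1 & _ & _ & ->). now apply InLoopSU_mul. Qed.

Lemma frame_translate a b c S z t F1 F2 :
  InLoopSU S -> IsFrame (Dpot a b c) S z F1 -> IsFrame (Dpot a b c) S (Cplus_real z t) F2 ->
  forall lam, Cabs lam = 1 -> F2 lam = Mmul (transl a b c S t lam) (F1 lam).
Proof.
  intros HS (Fh1 & V1 & U1 & P1 & E1 & ->) (Fh2 & V2 & U2 & P2 & E2 & ->).
  assert (K : forall lam, Cabs lam = 1 -> Mmul (Mexp (Dpot a b c lam) t) (Fh1 lam) = Fh2 lam).
  { apply (iwasawa_unique (fun lam => Mmul (Mexp (Dpot a b c lam) t) (Fh1 lam)) V1 Fh2 V2); try assumption.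
    - apply InLoopSU_mul; [apply InLoopSU_exp|assumption].
    - intros lam Hl. rewrite <- Mmul_assoc.
      eapply Mconv_unique; [|exact (E2 lam Hl)].
      replace (Mscal (Cplus_real z t) (Dpot a b c lam))
        with (Madd (Mscal (Cr t) (Dpot a b c lam)) (Mscal z (Dpot a b c lam))).
      + apply IsMexp_add; [|apply IsMexp_Mexp_scal|exact (E1 lam Hl)].
        rewrite !Mscal_mul_l, !Mscal_mul_r. unfold Mscal; simpl. f_equal; ring.
      + unfold Cplus_real. generalize (Dpot a b c lam). intros; msolve. }
  intros lam Hl. unfold transl. rewrite <- K by exact Hl.
  apply InLoopSU_iff in HS. destruct HS as [HS _]. destruct (HS lam Hl) as [d _].
  rewrite <- !Mmul_assoc. rewrite (Mmul_assoc (Madj (S lam))), (Mmul_adj_l _ d), Mmul_1l. reflexivity.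
Qed.

Lemma InLoopSU_transl a b c S t : InLoopSU S -> InLoopSU (transl a b c S t).
Proof.
  intros HS. unfold transl.
  apply (InLoopSU_mul S (fun lam => Mmul (Mexp (Dpot a b c lam) t) (Madj (S lam)))); [exact HS|].
  apply (InLoopSU_mul (fun lam => Mexp (Dpot a b c lam) t) (fun lam => Madj (S lam))); [apply InLoopSU_exp|].
  apply InLoopSU_iff in HS. apply InLoopSU_iff. destruct HS as [H1 H2]. split.
  - now apply InLoopSL_adj.
  - intros lam Hl. apply RF_adj, H2, Hl.
Qed.

Lemma InLoopSU_det S t : InLoopSU S -> Mdet (S (Ccis t)) = Cone.
Proof. intros [H _]. apply H, Cabs_cis. Qed.

(** The curve is F2 F1^-1, so its derivative in the angle is inherited from the two frames. *)
Lemma transl_curve_deriv a b c S t (F1 F2 : Loop) F1' F2' :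
  InLoopSU F1 ->
  (forall lam, Cabs lam = 1 -> F2 lam = Mmul (transl a b c S t lam) (F1 lam)) ->
  (forall s, Mderiv_th (fun s => F1 (Ccis s)) s (F1' s)) ->
  (forall s, Mderiv_th (fun s => F2 (Ccis s)) s (F2' s)) ->
  forall s, Mderiv_th (fun s => transl a b c S t (Ccis s)) s
    (Madd (Mmul (F2' s) (Madj (F1 (Ccis s)))) (Mmul (F2 (Ccis s)) (Madj (F1' s)))).
Proof.
  intros HF1 E H1 H2 s.
  eapply Mderiv_ext; [|apply (Mderiv_mul (fun s => F2 (Ccis s)) (fun s => Madj (F1 (Ccis s))));
    [apply H2|apply Mderiv_adj, H1]].
  intros u. simpl. rewrite E by apply Cabs_cis.
  rewrite <- Mmul_assoc, Mmul_adj_r, Mmul_1r; [reflexivity|now apply InLoopSU_det].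
Qed.

(** * A helicoidal surface has a potential with positive determinant *)

Definition hor (p : R3) : Cx := mkC (p1 p) (p2 p).

Lemma hor_helic alpha c s p :
  hor (act (helic alpha c s) p) = Cadd (Cmul alpha (Csub Cone (Ccis s))) (Cmul (Ccis s) (hor p)).
Proof. unfold hor, act, helic, nil_mul, p1, p2. apply Cx_eq; simpl; ring. Qed.

(** The horizontal half of the Sym data; the converse argument works with it alone. *)
Record SymData (F : Loop) (p : R3) (F' : R -> M2) : Prop := {
  sd_deriv : forall t, Mderiv_th (fun s => F (Ccis s)) t (F' t);
  sd_12 : a12 (Ysym (fun s => F (Ccis s)) F' 0) = Cmul half_i (hor p);
  sd_21 : a21 (Ysym (fun s => F (Ccis s)) F' 0) = Cmul (Copp half_i) (Cconj (hor p)) }.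

Lemma SymHat_data F p : InLoopSU F -> SymHat F (XE p) -> exists F', SymData F p F'.
Proof.
  intros HF HS. destruct (SymHat_elim F p (fun t => InLoopSU_det F t HF) HS)
    as (F' & Y' & H1 & _ & H2 & H3 & _).
  exists F'. constructor; assumption.
Qed.

Definition ysd (F : Loop) (F' : R -> M2) : M2 := Ysym (fun s => F (Ccis s)) F' 0.

Lemma ysd_transform a b c S t (F1 F2 : Loop) F1' F2' q1 q2 :
  InLoopSU S -> InLoopSU F1 ->
  (forall lam, Cabs lam = 1 -> F2 lam = Mmul (transl a b c S t lam) (F1 lam)) ->
  SymData F1 q1 F1' -> SymData F2 q2 F2' ->
  exists M', Mderiv_th (fun s => transl a b c S t (Ccis s)) 0 M' /\
    ysd F2 F2' = Madd (Mscal (Copp Cone) (Mmul M' (Madj (transl a b c S t Cone))))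
      (Mmul (transl a b c S t Cone) (Mmul (ysd F1 F1') (Madj (transl a b c S t Cone)))).
Proof.
  intros HS H1 E D1 D2.
  pose proof (transl_curve_deriv a b c S t F1 F2 F1' F2' H1 E (sd_deriv _ _ _ D1) (sd_deriv _ _ _ D2) 0) as HM.
  match type of HM with Mderiv_th _ _ ?m => exists m; revert HM; generalize m end.
  intros M' HM. split; [exact HM|].
  pose proof (Ysym_transform (fun s => F1 (Ccis s)) F1' (fun s => F2 (Ccis s)) F2'
    (fun s => transl a b c S t (Ccis s)) _ 0 (fun s => InLoopSU_det F1 s H1)
    (fun s => E _ (Cabs_cis s)) (sd_deriv _ _ _ D1 0) (sd_deriv _ _ _ D2 0) HM) as K.
  cbv beta in K. rewrite Ccis_0 in K. exact K.
Qed.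

(* The inhomogeneous term of the transformation law depends only on the
   translation t, so it cancels in the difference of two points. *)
Lemma difference_transform a b c S t (F1 F2 G1 G2 : Loop) F1' F2' G1' G2' p1 p2 q1 q2 :
  InLoopSU S -> InLoopSU F1 -> InLoopSU F2 ->
  (forall lam, Cabs lam = 1 -> G1 lam = Mmul (transl a b c S t lam) (F1 lam)) ->
  (forall lam, Cabs lam = 1 -> G2 lam = Mmul (transl a b c S t lam) (F2 lam)) ->
  SymData F1 p1 F1' -> SymData F2 p2 F2' -> SymData G1 q1 G1' -> SymData G2 q2 G2' ->
  let M := transl a b c S t Cone in
  Msub (ysd G2 G2') (ysd G1 G1') = Mmul M (Mmul (Msub (ysd F2 F2') (ysd F1 F1')) (Madj M)).
Proof.
  intros HS H1 H2 E1 E2 D1 D2 K1 K2 M.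
  destruct (ysd_transform a b c S t F1 G1 F1' G1' p1 q1 HS H1 E1 D1 K1) as (M1 & HM1 & ->).
  destruct (ysd_transform a b c S t F2 G2 F2' G2' p2 q2 HS H2 E2 D2 K2) as (M2 & HM2 & ->).
  rewrite (Mderiv_unique _ _ _ _ HM1 HM2). fold M.
  generalize (Mscal (Copp Cone) (Mmul M2 (Madj M))) (ysd F2 F2') (ysd F1 F1') (Madj M).
  intros. unfold Msub. msolve.
Qed.

Lemma Cderiv_cis_scal kappa t : Cderiv_th (fun t => Ccis (kappa * t)) t (Cmul (Cmul Ci (Cr kappa)) (Ccis (kappa * t))).
Proof.
  split; simpl.
  - apply is_derive_Reals. auto_derive; [trivial|ring].
  - apply is_derive_Reals. auto_derive; [trivial|ring].
Qed.

(** The conjugate u(t) = exp(tB) delta exp(-tB) solves u' = [B, u]. The (1,2) entry of this equation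
    gives the first identity at every small t. Differentiating that identity at 0 replaces the
    diagonal of u by off-diagonal entries and gives the second. *)
Lemma conj_flow_identity (B delta : M2) (beta kappa eps : R) :
  a11 B = Cmul Ci (Cr beta) -> a22 B = Copp (a11 B) -> a21 B = Cconj (a12 B) ->
  a21 delta = Cconj (a12 delta) -> 0 < eps ->
  (forall t, Rabs t < eps ->
     a12 (Mmul (Mexp B t) (Mmul delta (Madj (Mexp B t)))) = Cmul (Ccis (kappa * t)) (a12 delta)) ->
  let g := a12 B in let eta := a12 delta in
  Cmul g (Csub (a11 delta) (a22 delta)) = Cmul (Cmul Ci (Cr (2 * beta - kappa))) eta /\
  Cmul (Cmul (Cr 2) g) (Csub (Cmul g (Cconj eta)) (Cmul eta (Cconj g)))
    = Cmul (Cr (- kappa * (2 * beta - kappa))) eta.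
Proof.
  intros HB1 HB2 HB3 Hd He H g eta.
  set (u := fun t => Mmul (Mexp B t) (Mmul delta (Madj (Mexp B t)))).
  assert (U0 : u 0 = delta) by (unfold u; rewrite Mexp_0; msolve).
  assert (D : forall t, Mderiv_th u t (Msub (Mmul B (u t)) (Mmul (u t) B))).
  { intros t. unfold u. eapply Mderiv_eq.
    - apply Mderiv_mul; [apply Mexp_deriv|].
      apply Mderiv_mul_const_l. apply Mderiv_adj, Mexp_deriv.
    - rewrite Madj_mul. cbv beta. generalize (Mexp B t) (Madj (Mexp B t)). intros X Y.
      apply M2_eq; simpl; rewrite HB2; ring. }
  assert (E : forall t, Rabs t < eps ->
    Cmul g (Csub (a11 (u t)) (a22 (u t))) = Cmul (Cmul Ci (Cr (2 * beta - kappa))) (Cmul (Ccis (kappa * t)) eta)).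
  { intros t Ht. destruct (D t) as (_ & D12 & _ & _).
    assert (D12' : Cderiv_th (fun t => Cmul (Ccis (kappa * t)) eta) t
       (Cadd (Cmul (Cmul (Cmul Ci (Cr kappa)) (Ccis (kappa * t))) eta) (Cmul (Ccis (kappa * t)) Czero))).
    { apply (Cderiv_mul (fun t => Ccis (kappa * t)) (fun _ => eta)); [apply Cderiv_cis_scal|apply Cderiv_const]. }
    assert (P : Rabs t < eps) by exact Ht.
    eapply (Cderiv_loc _ (fun t => a12 (u t)) t _ (eps - Rabs t)) in D12'; [|lra|].
    - pose proof (Cderiv_unique _ _ _ _ D12 D12') as Q.
      assert (U12 : a12 (u t) = Cmul (Ccis (kappa * t)) eta) by (unfold u; exact (H t Ht)).
      revert Q U12. generalize (u t). intros A Q U12. cbn [a11 a12 a21 a22 Msub Madd Mmul Mscal] in Q.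
      rewrite U12, HB1, HB2, HB1 in Q. fold g in Q. fold eta in U12.
      replace (Cr (2 * beta - kappa)) with (Csub (Cadd (Cr beta) (Cr beta)) (Cr kappa)) by cx_solve.
      transitivity (Csub (Cadd (Cmul (Cmul Ci (Cr beta)) (Cmul (Ccis (kappa * t)) eta))
         (Cmul (Cmul Ci (Cr beta)) (Cmul (Ccis (kappa * t)) eta)))
         (Cadd (Cmul (Cmul (Cmul Ci (Cr kappa)) (Ccis (kappa * t))) eta) (Cmul (Ccis (kappa * t)) Czero))).
      + rewrite <- Q. ring.
      + ring.
    - intros s Hs. symmetry. unfold u. refine (H s _).
      replace s with ((s - t) + t) by ring. eapply Rle_lt_trans; [apply Rabs_triang|]. lra. }
  split.
  - specialize (E 0). rewrite Rabs_R0 in E. specialize (E He).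
    rewrite U0, Rmult_0_r, Ccis_0 in E. rewrite E. ring.
  - destruct (D 0) as (D11 & _ & _ & D22).
    assert (L : Cderiv_th (fun t => Cmul g (Csub (a11 (u t)) (a22 (u t)))) 0
      (Cadd (Cmul Czero (Csub (a11 (u 0)) (a22 (u 0)))) (Cmul g (Cadd (a11 (Msub (Mmul B (u 0)) (Mmul (u 0) B)))
         (Copp (a22 (Msub (Mmul B (u 0)) (Mmul (u 0) B)))))))).
    { apply (Cderiv_mul (fun _ => g)); [apply Cderiv_const|].
      apply Cderiv_add; [exact D11|]. apply Cderiv_opp, D22. }
    assert (R : Cderiv_th (fun t => Cmul (Cmul Ci (Cr (2 * beta - kappa))) (Cmul (Ccis (kappa * t)) eta)) 0
      (Cadd (Cmul Czero (Cmul (Ccis (kappa * 0)) eta)) (Cmul (Cmul Ci (Cr (2 * beta - kappa)))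
       (Cadd (Cmul (Cmul (Cmul Ci (Cr kappa)) (Ccis (kappa * 0))) eta) (Cmul (Ccis (kappa * 0)) Czero))))).
    { apply (Cderiv_mul (fun _ => Cmul Ci (Cr (2 * beta - kappa)))); [apply Cderiv_const|].
      apply (Cderiv_mul (fun t => Ccis (kappa * t)) (fun _ => eta)); [apply Cderiv_cis_scal|apply Cderiv_const]. }
    eapply (Cderiv_loc _ _ 0 _ eps He) in L; [|intros s Hs; apply E; now rewrite Rminus_0_r in Hs].
    pose proof (Cderiv_unique _ _ _ _ L R) as Q.
    rewrite U0, Rmult_0_r, Ccis_0 in Q. cbn [a11 a12 a21 a22 Msub Madd Mmul Mscal] in Q.
    rewrite Hd, HB2, HB3, HB1 in Q. fold g eta in Q.
    transitivity (Cmul (Cmul Ci (Cr (2 * beta - kappa)))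
       (Cadd (Cmul (Cmul (Cmul Ci (Cr kappa)) Cone) eta) (Cmul Cone Czero))).
    + replace (Cr 2) with (Cadd Cone Cone) by cx_solve.
      transitivity (Cadd (Cmul Czero (Cmul Cone eta)) (Cmul (Cmul Ci (Cr (2 * beta - kappa)))
       (Cadd (Cmul (Cmul (Cmul Ci (Cr kappa)) Cone) eta) (Cmul Cone Czero)))); [|ring].
      rewrite <- Q. ring.
    + apply Cx_eq; simpl; ring.
Qed.

Lemma transl_Mexp a b c S t lam : Mdet (S lam) = Cone ->
  transl a b c S t lam = Mexp (Mmul (S lam) (Mmul (Dpot a b c lam) (Madj (S lam)))) t.
Proof.
  intros d. unfold transl.
  apply (Mexp_ode_unique _ (fun t => Mmul (S lam) (Mmul (Mexp (Dpot a b c lam) t) (Madj (S lam))))).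
  - rewrite Mexp_0, Mmul_1l. now apply Mmul_adj_r.
  - intros s. eapply Mderiv_eq; [apply Mderiv_mul_const_l, Mderiv_mul_const_r, Mexp_deriv|].
    rewrite <- !Mmul_assoc. rewrite (Mmul_assoc (Madj (S lam)) (S lam)), (Mmul_adj_l _ d), Mmul_1l.
    reflexivity.
Qed.

Lemma RF_diag_imag B : RF B -> Mtr B = Czero ->
  exists beta, a11 B = Cmul Ci (Cr beta) /\ a22 B = Copp (a11 B).
Proof.
  intros [_ H2] H. exists (cim (a11 B)). unfold Mtr in H. rewrite H2 in H.
  pose proof (f_equal cre H) as H3. simpl in H3. split.
  - apply Cx_eq; simpl; lra.
  - rewrite H2. apply Cx_eq; simpl; lra.
Qed.

Lemma Mtr_conj S A : Mdet S = Cone -> Mtr (Mmul S (Mmul A (Madj S))) = Mtr A.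
Proof.
  intros d. transitivity (Cmul (Mdet S) (Mtr A)); [unfold Mtr, Mdet; simpl; ring|].
  rewrite d. ring.
Qed.
Lemma Mdet_conj S A : Mdet S = Cone -> Mdet (Mmul S (Mmul A (Madj S))) = Mdet A.
Proof. intros d. rewrite !Mdet_mul, Mdet_adj, d. ring. Qed.

Lemma Cr_0_eq0 x : Cr x = Czero -> x = 0.
Proof. apply (Cr_inj x 0). Qed.

(** Off the axis, the chords f(z + s) - f(z) and f(z - s) - f(z) supply two identities of the
    preceding kind. If the off-diagonal entry g of the generator B vanishes, the first identity
    gives 2 beta = kappa, and det B = beta^2 > 0. If g is nonzero, the second confines both chords,
    after multiplication by one and the same complex number, to a common real line, which two
    independent chords do not allow. *)
Lemma helicoidal_alternative a b c S f U alpha cc kappa :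
  InLoopSU S -> Generated (Dpot a b c) S f U -> kappa <> 0 ->
  Equivariant f U (fun t => helic alpha cc (kappa * t)) ->
  (exists r, 0 < r /\ Mdet (Dpot a b c Cone) = Cr r) \/
  (forall z, U z -> hor (f z) = alpha).
Proof.
  intros HS (HR & HO & HG) Hk HEq.
  destruct (excluded_middle_informative (forall z, U z -> hor (f z) = alpha)) as [?|Hn]; [now right|left].
  apply not_all_ex_not in Hn. destruct Hn as [z Hn]. apply imply_to_and in Hn. destruct Hn as [Hz Hn].
  destruct (HO z Hz) as (eps & Heps & Hball).
  assert (Hnear : forall s, Rabs s < eps -> U (Cplus_real z s)).
  { intros s Hs. apply Hball. unfold Cplus_real.
    replace (Csub (Cadd z (Cr s)) z) with (Cr s) by ring. now rewrite Cabs_Cr. }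
  assert (HF : forall w, U w -> exists F F', IsFrame (Dpot a b c) S w F /\ SymData F (f w) F').
  { intros w Hw. destruct (SurfPt_frame _ _ _ _ (HG w Hw)) as (F & H1 & H2).
    destruct (SymHat_data F _ (IsFrame_SU _ _ _ _ HS H1) H2) as [F' H3]. now exists F, F'. }
  assert (U1 : Cabs Cone = 1) by (rewrite <- Ccis_0; apply Cabs_cis).
  pose proof HS as HS'. apply InLoopSU_iff in HS'. destruct HS' as [HS1 HS2].
  destruct (HS1 Cone U1) as [dS _].
  set (B := Mmul (S Cone) (Mmul (Dpot a b c Cone) (Madj (S Cone)))).
  assert (BR : RF B).
  { unfold B. apply RF_mul; [now apply HS2|]. apply RF_mul; [now apply Dpot_RF|]. apply RF_adj. now apply HS2. }
  assert (Btr : Mtr B = Czero).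
  { unfold B. rewrite Mtr_conj by exact dS. apply Dpot_trace. }
  destruct (RF_diag_imag B BR Btr) as (beta & B1 & B2).
  set (eta0 := Cmul half_i (Csub (hor (f z)) alpha)).
  assert (hpos : half_i <> Czero).
  { intros E. apply (f_equal cim) in E. unfold half_i in E. simpl in E. lra. }
  assert (eta0n : eta0 <> Czero).
  { intros E. destruct (Cmul_eq0 _ _ E) as [E1|E1]; [now apply hpos|]. apply Hn.
    replace (hor (f z)) with (Cadd (Csub (hor (f z)) alpha) alpha) by ring. rewrite E1. ring. }
  assert (EqH : forall w t, U w -> U (Cplus_real w t) ->
    hor (f (Cplus_real w t)) = Cadd (Cmul alpha (Csub Cone (Ccis (kappa * t)))) (Cmul (Ccis (kappa * t)) (hor (f w)))).
  { intros w t Hw Hwt. rewrite (HEq w t Hw Hwt). apply hor_helic. }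
  assert (Key : forall s, Rabs s < eps / 2 ->
    exists v, let eta := Cmul (Csub (Ccis (kappa * s)) Cone) eta0 in
    Cmul (a12 B) v = Cmul (Cmul Ci (Cr (2 * beta - kappa))) eta /\
    Cmul (Cmul (Cr 2) (a12 B)) (Csub (Cmul (a12 B) (Cconj eta)) (Cmul eta (Cconj (a12 B))))
      = Cmul (Cr (- kappa * (2 * beta - kappa))) eta).
  { intros s Hs.
    assert (Uz2 : U (Cplus_real z s)) by (apply Hnear; lra).
    destruct (HF z Hz) as (F1 & F1' & I1 & D1).
    destruct (HF _ Uz2) as (F2 & F2' & I2 & D2).
    set (delta := Msub (ysd F2 F2') (ysd F1 F1')).
    assert (d12 : a12 delta = Cmul half_i (Csub (hor (f (Cplus_real z s))) (hor (f z)))).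
    { unfold delta. transitivity (Csub (a12 (ysd F2 F2')) (a12 (ysd F1 F1'))); [simpl; ring|].
      unfold ysd. rewrite (sd_12 _ _ _ D1), (sd_12 _ _ _ D2). ring. }
    assert (d21 : a21 delta = Cconj (a12 delta)).
    { rewrite d12. unfold delta. transitivity (Csub (a21 (ysd F2 F2')) (a21 (ysd F1 F1'))); [simpl; ring|].
      unfold ysd. rewrite (sd_21 _ _ _ D1), (sd_21 _ _ _ D2). unfold half_i. cconj_simpl. ring. }
    assert (d12' : a12 delta = Cmul (Csub (Ccis (kappa * s)) Cone) eta0).
    { rewrite d12, EqH by assumption. unfold eta0. ring. }
    exists (Csub (a11 delta) (a22 delta)). cbv zeta. rewrite <- d12'.
    apply (conj_flow_identity B delta beta kappa (eps / 2)); try assumption; [apply BR|lra|].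
    intros t Ht.
    assert (Uz1t : U (Cplus_real z t)) by (apply Hnear; lra).
    assert (Uz2t : U (Cplus_real (Cplus_real z s) t)).
    { replace (Cplus_real (Cplus_real z s) t) with (Cplus_real z (s + t)) by (unfold Cplus_real; cx_solve).
      apply Hnear. eapply Rle_lt_trans; [apply Rabs_triang|lra]. }
    destruct (HF _ Uz1t) as (G1 & G1' & J1 & K1).
    destruct (HF _ Uz2t) as (G2 & G2' & J2 & K2).
    pose proof (difference_transform a b c S t F1 F2 G1 G2 F1' F2' G1' G2' _ _ _ _ HS
      (IsFrame_SU _ _ _ _ HS I1) (IsFrame_SU _ _ _ _ HS I2)
      (frame_translate _ _ _ _ _ _ _ _ HS I1 J1) (frame_translate _ _ _ _ _ _ _ _ HS I2 J2)
      D1 D2 K1 K2) as E. cbv zeta in E.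
    rewrite (transl_Mexp a b c S t Cone dS) in E. fold B delta in E. rewrite <- E.
    transitivity (Csub (a12 (ysd G2 G2')) (a12 (ysd G1 G1'))); [simpl; ring|].
    unfold ysd. rewrite (sd_12 _ _ _ K1), (sd_12 _ _ _ K2), d12.
    rewrite !(EqH _ t) by assumption. ring. }
  (* This keeps all translates in the ball of radius eps, and 0 < |kappa| s <= 1/2 makes exp(i kappa
     s) - 1 and exp(-i kappa s) - 1 independent over the reals. *)
  set (s := Rmin (eps / 4) (/ (2 * Rabs kappa))).
  assert (kp : 0 < Rabs kappa) by now apply Rabs_pos_lt.
  assert (s0 : 0 < s) by (apply Rmin_glb_lt; [lra|apply Rinv_0_lt_compat; lra]).
  assert (s1 : s <= eps / 4) by apply Rmin_l.
  assert (s2 : Rabs kappa * s <= / 2).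
  { apply Rle_trans with (Rabs kappa * / (2 * Rabs kappa)).
    - apply Rmult_le_compat_l; [lra|apply Rmin_r].
    - apply Req_le. field. lra. }
  assert (ks : 0 < Rabs kappa * s) by now apply Rmult_lt_0_compat.
  assert (sinks : sin (kappa * s) <> 0 /\ cos (kappa * s) <> 1).
  { assert (Q : 0 < sin (Rabs kappa * s) ) by (apply sin_gt_0; [lra|pose proof PI2_1; lra]).
    assert (Q2 : sin (kappa * s) <> 0).
    { unfold Rabs in Q. destruct (Rcase_abs kappa); [|lra].
      replace (- kappa * s) with (- (kappa * s)) in Q by ring. rewrite sin_neg in Q. lra. }
    split; [exact Q2|]. intros Q3. pose proof (sin2_cos2 (kappa * s)) as Q4. rewrite Q3 in Q4.
    unfold Rsqr in Q4. apply Q2. nra. }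
  destruct sinks as [sn cn].
  destruct (Key s) as (v1 & K1 & K2); [rewrite Rabs_pos_eq; lra|].
  destruct (Key (- s)) as (v2 & K3 & K4); [rewrite Rabs_Ropp, Rabs_pos_eq; lra|].
  cbv zeta in K1, K2, K3, K4.
  set (e1 := Cmul (Csub (Ccis (kappa * s)) Cone) eta0) in *.
  set (e2 := Cmul (Csub (Ccis (kappa * - s)) Cone) eta0) in *.
  assert (e1n : e1 <> Czero).
  { intros E. destruct (Cmul_eq0 _ _ E) as [E1|E1]; [|now apply eta0n].
    apply (f_equal cim) in E1. simpl in E1. apply sn. lra. }
  destruct (excluded_middle_informative (a12 B = Czero)) as [g0|gn].
  - rewrite g0 in K1.
    assert (Z : Cmul (Cmul Ci (Cr (2 * beta - kappa))) e1 = Czero) by (rewrite <- K1; ring).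
    destruct (Cmul_eq0 _ _ Z) as [Z1|Z1]; [|contradiction].
    apply (f_equal cim) in Z1. simpl in Z1.
    exists (beta * beta). split; [assert (beta <> 0) by lra; nra|].
    rewrite <- (Mdet_conj (S Cone) _ dS). fold B.
    unfold Mdet. rewrite B2, B1, g0. apply Cx_eq; simpl; ring.
  - exfalso. apply eta0n.
    set (g := a12 B) in *.
    set (zt := Cmul (Cinv g) eta0).
    assert (ez : eta0 = Cmul g zt) by (unfold zt; field; exact gn).
    (* Dividing by g turns the second identity into one between a complex number and
       its imaginary part. *)
    assert (Im : forall y, Cmul (Cmul (Cr 2) g) (Csub (Cmul g (Cconj (Cmul y eta0))) (Cmul (Cmul y eta0) (Cconj g)))
        = Cmul (Cr (- kappa * (2 * beta - kappa))) (Cmul y eta0) ->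
      (kappa * (2 * beta - kappa) <> 0 -> cre (Cmul y zt) = 0) /\
      (kappa * (2 * beta - kappa) = 0 -> cim (Cmul y zt) = 0)).
    { intros y Hy. rewrite ez in Hy.
      set (x := Cmul y zt).
      assert (Hx : Cmul (Cr (2 * Cnormsq g)) (Csub (Cconj x) x) = Cmul (Cr (- kappa * (2 * beta - kappa))) x).
      { assert (W : Cmul g (Csub (Cmul (Cr (2 * Cnormsq g)) (Csub (Cconj x) x)) (Cmul (Cr (- kappa * (2 * beta - kappa))) x)) = Czero).
        { rewrite Cr_mul, <- (Cmul_conj g).
          replace (Cmul y (Cmul g zt)) with (Cmul g x) in Hy by (unfold x; ring).
          rewrite Cconj_mul in Hy.
          transitivity (Csub (Cmul (Cmul (Cr 2) g) (Csub (Cmul g (Cmul (Cconj g) (Cconj x))) (Cmul (Cmul g x) (Cconj g))))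
            (Cmul (Cr (- kappa * (2 * beta - kappa))) (Cmul g x))); [ring|]. rewrite Hy. ring. }
        destruct (Cmul_eq0 _ _ W) as [W1|W1]; [contradiction|].
        match type of W1 with Csub ?p ?q = _ => replace p with (Cadd (Csub p q) q) by ring; rewrite W1; ring end. }
      fold x. pose proof (Cnormsq_pos g gn) as gp. clearbody x. clear Hy ez zt e1 e2 e1n K1 K2 K3 K4 Key. clearbody g.
      pose proof (f_equal cre Hx) as Hr. pose proof (f_equal cim Hx) as Hi. simpl in Hr, Hi.
      split; intros k0.
      - assert (Q : (kappa * (2 * beta - kappa)) * cre x = 0) by nra.
        apply Rmult_integral in Q. lra.
      - assert (Q : Cnormsq g * cim x = 0) by nra. apply Rmult_integral in Q. lra. }
    apply Im in K2. apply Im in K4.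
    (* The two chords are (C - 1) + i Sn and (C - 1) - i Sn; adding and subtracting the two real
       equations isolates the real and imaginary parts of [zt]. *)
    assert (Zt : zt = Czero).
    { clearbody zt. replace (kappa * - s) with (- (kappa * s)) in K4 by ring.
      simpl in K2, K4. rewrite cos_neg, sin_neg in K4.
      set (C := cos (kappa * s)) in *. set (Sn := sin (kappa * s)) in *.
      destruct K2 as [K2a K2b]; destruct K4 as [K4a K4b].
      destruct (Req_dec (kappa * (2 * beta - kappa)) 0) as [k0|kn].
      - specialize (K2b k0). specialize (K4b k0).
        assert (Sn * cre zt = 0) as Q1 by lra. assert ((C - 1) * cim zt = 0) as Q2 by lra.
        apply Rmult_integral in Q1. apply Rmult_integral in Q2.
        apply Cx_eq; simpl; lra.
      - specialize (K2a kn). specialize (K4a kn).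
        assert (Sn * cim zt = 0) as Q1 by lra. assert ((C - 1) * cre zt = 0) as Q2 by lra.
        apply Rmult_integral in Q1. apply Rmult_integral in Q2.
        apply Cx_eq; simpl; lra. }
    rewrite ez, Zt. ring.
Qed.

Lemma derivable_pt_lim_loc_const (f : R -> R) x l k eps : 0 < eps ->
  (forall y, Rabs (y - x) < eps -> f y = k) -> derivable_pt_lim f x l -> l = 0.
Proof.
  intros He H D. apply (uniqueness_limite (fun _ => k) x); [|apply derivable_pt_lim_const].
  apply is_derive_Reals. apply is_derive_Reals in D. eapply is_derive_ext_loc; [|exact D].
  exists (mkposreal _ He). intros y Hy. apply H. exact Hy.
Qed.

(** Both partial derivatives are vertical, so their cross product is zero. *)
Lemma hor_constant_not_immersed f U alpha z : Copen U -> U z ->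
  (forall w, U w -> hor (f w) = alpha) -> ~ ImmersedAt f z.
Proof.
  intros HO Hz H (fx & fy & (X1 & X2 & _) & (Y1 & Y2 & _) & Hc).
  destruct (HO z Hz) as (e & He & Hb).
  assert (Hx : forall x, Rabs (x - cre z) < e -> hor (f (mkC x (cim z))) = alpha).
  { intros x Hx. apply H, Hb. replace (Csub (mkC x (cim z)) z) with (Cr (x - cre z)) by cx_solve.
    now rewrite Cabs_Cr. }
  assert (Hy : forall y, Rabs (y - cim z) < e -> hor (f (mkC (cre z) y)) = alpha).
  { intros y Hy. apply H, Hb. replace (Csub (mkC (cre z) y) z) with (Cmul Ci (Cr (y - cim z))) by cx_solve.
    rewrite Cabs_mul, Cabs_Cr. unfold Cabs, Cnormsq; simpl.
    replace (0 * 0 + 1 * 1) with 1 by ring. rewrite sqrt_1. lra. }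
  assert (x1 : p1 fx = 0) by (eapply (derivable_pt_lim_loc_const _ _ _ (cre alpha) e He); [|exact X1];
    intros x h; apply Hx in h; now rewrite <- h).
  assert (x2 : p2 fx = 0) by (eapply (derivable_pt_lim_loc_const _ _ _ (cim alpha) e He); [|exact X2];
    intros x h; apply Hx in h; now rewrite <- h).
  assert (y1 : p1 fy = 0) by (eapply (derivable_pt_lim_loc_const _ _ _ (cre alpha) e He); [|exact Y1];
    intros x h; apply Hy in h; now rewrite <- h).
  assert (y2 : p2 fy = 0) by (eapply (derivable_pt_lim_loc_const _ _ _ (cim alpha) e He); [|exact Y2];
    intros x h; apply Hy in h; now rewrite <- h).
  apply Hc. unfold cross. rewrite x1, x2, y1, y2. f_equal; [f_equal|]; ring.
Qed.

Theorem helicoidal_det_positive a b c S f U :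
  InLoopSU S -> Generated (Dpot a b c) S f U ->
  (exists z0, U z0 /\ ImmersedAt f z0) -> Helicoidal f U ->
  exists r : R, 0 < r /\ Mdet (Dpot a b c Cone) = Cr r.
Proof.
  intros HS HG (z0 & Hz0 & Him) (alpha & cc & kappa & Hk & HE).
  destruct (helicoidal_alternative _ _ _ _ _ _ _ _ _ HS HG Hk HE) as [?|H]; [assumption|].
  exfalso. revert Him. apply (hor_constant_not_immersed f U alpha); [apply HG|assumption|exact H].
Qed.

(** * The motion induced by a frame transformation that is diagonal at lambda = 1 *)

(** Conjugation by diag(m, conj m) multiplies the (1,2) entry of Y by m^2, and the inhomogeneous
    term -M' M^-1 adds -k1 m there: this is the horizontal law. The vertical law is the (1,1) entry
    of the differentiated transformation rule. *)
Lemma surface_transform (F1 F2 : Loop) p q (M M1 : R -> M2) (MM : M2) eps m k1 :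
  InLoopSU F1 -> InLoopSU F2 -> (forall s, F2 (Ccis s) = Mmul (M s) (F1 (Ccis s))) ->
  SymHat F1 (XE p) -> SymHat F2 (XE q) -> 0 < eps ->
  (forall s, Rabs s < eps -> Mderiv_th M s (M1 s)) -> Mderiv_th M1 0 MM ->
  (forall s, RF (M s)) -> (forall s, Mdet (M s) = Cone) ->
  a11 (M 0) = m -> a12 (M 0) = Czero -> a12 (M1 0) = k1 ->
  hor q = Cadd (Cmul (Cmul m m) (hor p)) (Cmul (Cmul (Cr 2) Ci) (Cmul k1 m)) /\
  p3 q = p3 p - cim (Cmul (a11 MM) (Cconj m)) - cre (Cmul k1 (Cconj (Cmul m (hor p)))).
Proof.
  intros HF1 HF2 E S1 S2 He HM HMM HR Hd Hm Hm12 Hk.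
  destruct (SymHat_elim F1 p (fun t => InLoopSU_det F1 t HF1) S1) as (F1' & Y1' & A1 & A2 & A3 & A4 & A5).
  destruct (SymHat_elim F2 q (fun t => InLoopSU_det F2 t HF2) S2) as (F2' & Y2' & B1 & B2 & B3 & B4 & B5).
  set (Y1 := Ysym (fun s => F1 (Ccis s)) F1') in *.
  set (Y2 := Ysym (fun s => F2 (Ccis s)) F2') in *.
  assert (T : forall s, Rabs s < eps -> Y2 s = Madd (Mscal (Copp Cone) (Mmul (M1 s) (Madj (M s))))
      (Mmul (M s) (Mmul (Y1 s) (Madj (M s))))).
  { intros s Hs.
    exact (Ysym_transform (fun s => F1 (Ccis s)) F1' (fun s => F2 (Ccis s)) F2' M (M1 s) s
      (fun s => InLoopSU_det F1 s HF1) E (A1 s) (B1 s) (HM s Hs)). }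
  assert (H0 : Rabs 0 < eps) by now rewrite Rabs_R0.
  assert (M0 : M 0 = mkM m Czero Czero (Cconj m)).
  { destruct (HR 0) as [r1 r2]. apply M2_eq; simpl; [exact Hm|exact Hm12| |].
    - now rewrite r1, Hm12, Cconj_Czero. - now rewrite r2, Hm. }
  assert (R1 : RF (M1 0)) by exact (RF_deriv M 0 (M1 0) HR (HM 0 H0)).
  assert (tr : Mtr (Mmul (M1 0) (Madj (M 0))) = Czero) by exact (det1_deriv_trace M 0 (M1 0) Hd (HM 0 H0)).
  assert (mm : Cmul m (Cconj m) = Cone).
  { rewrite <- (Hd 0), M0. unfold Mdet; simpl. ring. }
  destruct R1 as [r1 r2].
  set (m1 := a11 (M1 0)) in *.
  assert (tr' : Cadd (Cmul m1 (Cconj m)) (Cmul m (Cconj m1)) = Czero).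
  { rewrite <- tr, M0. unfold Mtr; simpl. fold m1. rewrite r2. ring. }
  split.
  - assert (Q : Cmul half_i (hor q) = Cadd (Copp (Cmul k1 m)) (Cmul (Cmul m m) (Cmul half_i (hor p)))).
    { change (Cmul half_i (mkC (p1 q) (p2 q))) with (Cmul half_i (hor q)) in B3.
      change (Cmul half_i (mkC (p1 p) (p2 p))) with (Cmul half_i (hor p)) in A3.
      rewrite <- B3, <- A3, (T 0 H0), M0, <- Hk. generalize (M1 0) (Y1 0). intros X Y. simpl. ring. }
    transitivity (Cmul (Cmul (Copp (Cr 2)) Ci) (Cmul half_i (hor q))).
    + unfold half_i. apply Cx_eq; simpl; field.
    + rewrite Q. generalize (hor p). intros w. unfold half_i. apply Cx_eq; simpl; field.
  - assert (D : Mderiv_th Y2 0 (Madd (Mscal (Copp Cone) (Madd (Mmul MM (Madj (M 0))) (Mmul (M1 0) (Madj (M1 0)))))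
        (Madd (Mmul (M1 0) (Mmul (Y1 0) (Madj (M 0))))
              (Mmul (M 0) (Madd (Mmul Y1' (Madj (M 0))) (Mmul (Y1 0) (Madj (M1 0)))))))).
    { apply (Mderiv_loc (fun s => Madd (Mscal (Copp Cone) (Mmul (M1 s) (Madj (M s))))
        (Mmul (M s) (Mmul (Y1 s) (Madj (M s))))) Y2 0 _ eps He).
      - intros s Hs. rewrite Rminus_0_r in Hs. now rewrite T.
      - assert (DA : Mderiv_th (fun s => Madj (M s)) 0 (Madj (M1 0))) by (apply Mderiv_adj, HM, H0).
        apply Mderiv_add.
        + apply Mderiv_scal_const. apply (Mderiv_mul M1 (fun s => Madj (M s))); assumption.
        + apply (Mderiv_mul M (fun s => Mmul (Y1 s) (Madj (M s)))); [apply HM, H0|].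
          apply (Mderiv_mul Y1 (fun s => Madj (M s))); assumption. }
    pose proof (f_equal a11 (Mderiv_unique _ _ _ _ B2 D)) as Q.
    rewrite B5, M0 in Q. cbn [a11 a12 a21 a22 Madd Mmul Mscal Madj] in Q.
    rewrite r1, r2, Hk, A5 in Q. fold m1 in Q.
    change (a12 (Y1 0) = Cmul half_i (hor p)) in A3.
    change (a21 (Y1 0) = Cmul (Copp half_i) (Cconj (hor p))) in A4.
    rewrite A3, A4 in Q.
    assert (Q2 : Cmul Ci (Cr (p3 q)) =
      Cadd (Cadd (Cmul (a11 (Y1 0)) (Cadd (Cmul m1 (Cconj m)) (Cmul m (Cconj m1)))) (Cmul (Cmul m (Cconj m)) (Cmul Ci (Cr (p3 p)))))
       (Cadd (Copp (Cadd (Cmul (a11 MM) (Cconj m)) (Csub (Cmul m1 (Cconj m1)) (Cmul k1 (Cconj k1)))))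
         (Csub (Cmul (Cmul k1 (Cconj m)) (Cmul (Copp half_i) (Cconj (hor p)))) (Cmul (Cmul m (Cconj k1)) (Cmul half_i (hor p)))))).
    { rewrite Q. ring. }
    (* The diagonal entry of Y is not a coordinate of the surface. It occurs only as a factor of the
       trace of M' M^-1, which is zero; the real terms |m1|^2 - |k1|^2 drop out with the imaginary
       part. *)
    rewrite tr', mm in Q2. clear Q D. clearbody m1.
    apply (f_equal cim) in Q2. revert Q2. generalize (a11 (Y1 0)) (hor p) (a11 MM). intros y w mm2 Q2.
    unfold half_i in Q2. simpl in Q2. simpl. lra.
Qed.

(** A two-jet at 0: the first derivative exists on a neighbourhood and is itself differentiable at
    0, which is the regularity of M that [surface_transform] asks for. *)
Record C2at (eps : R) (f : R -> Cx) (f0 f1 f2 : Cx) : Prop := {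
  c2_ex : exists f', (forall s, Rabs s < eps -> Cderiv_th f s (f' s)) /\ f' 0 = f1 /\ Cderiv_th f' 0 f2;
  c2_val : f 0 = f0 }.

Lemma C2at_add eps f f0 f1 f2 g g0 g1 g2 : 0 < eps -> C2at eps f f0 f1 f2 -> C2at eps g g0 g1 g2 ->
  C2at eps (fun s => Cadd (f s) (g s)) (Cadd f0 g0) (Cadd f1 g1) (Cadd f2 g2).
Proof.
  intros He [(f' & F1 & F2 & F3) F0] [(g' & G1 & G2 & G3) G0]. constructor.
  - exists (fun s => Cadd (f' s) (g' s)). split; [|split].
    + intros s Hs. apply Cderiv_add; auto.
    + now rewrite F2, G2.
    + now apply Cderiv_add.
  - now rewrite F0, G0.
Qed.
Lemma C2at_mul eps f f0 f1 f2 g g0 g1 g2 : 0 < eps -> C2at eps f f0 f1 f2 -> C2at eps g g0 g1 g2 ->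
  C2at eps (fun s => Cmul (f s) (g s)) (Cmul f0 g0) (Cadd (Cmul f1 g0) (Cmul f0 g1))
    (Cadd (Cadd (Cmul f2 g0) (Cmul f1 g1)) (Cadd (Cmul f1 g1) (Cmul f0 g2))).
Proof.
  intros He [(f' & F1 & F2 & F3) F0] [(g' & G1 & G2 & G3) G0].
  assert (H0 : Rabs 0 < eps) by now rewrite Rabs_R0.
  pose proof (F1 0 H0) as F10. pose proof (G1 0 H0) as G10.
  rewrite F2 in F10. rewrite G2 in G10. constructor.
  - exists (fun s => Cadd (Cmul (f' s) (g s)) (Cmul (f s) (g' s))). split; [|split].
    + intros s Hs. apply Cderiv_mul; auto.
    + now rewrite F2, G2, F0, G0.
    + rewrite <- F0, <- G0, <- F2, <- G2. rewrite <- F2 in F10. rewrite <- G2 in G10.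
      apply Cderiv_add; now apply Cderiv_mul.
  - now rewrite F0, G0.
Qed.
Lemma C2at_const eps c : C2at eps (fun _ => c) c Czero Czero.
Proof.
  constructor; [|reflexivity]. exists (fun _ => Czero).
  split; [|split]; intros; try apply Cderiv_const; reflexivity.
Qed.
Lemma C2at_real eps (f f' : R -> R) f2 :
  (forall s, Rabs s < eps -> is_derive f s (f' s)) -> is_derive f' 0 f2 ->
  C2at eps (fun s => Cr (f s)) (Cr (f 0)) (Cr (f' 0)) (Cr f2).
Proof.
  intros H1 H2. constructor; [|reflexivity]. exists (fun s => Cr (f' s)). split; [|split].
  - intros s Hs. apply Cderiv_Cr, is_derive_Reals, H1, Hs.
  - reflexivity.
  - apply Cderiv_Cr, is_derive_Reals, H2.
Qed.

(** * An explicit eigenframe of D(1) *)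

Record half_angle_data (b : Cx) (n l psi : R) : Prop := {
  ha_n : 0 < n; ha_l : 0 < l; ha_nl : n * n + l * l = 4;
  ha_b : b = mkC (n * cos psi - 1) (- (n * sin psi));
  ha_ell : ell b = l }.

(** This is the polar form 1 + b = n exp(-i psi). The radicand of [ell] is 4 - |1 + b|^2, whence n^2
    + l^2 = 4. *)
Lemma half_angle_exists b : Cabs (Cadd Cone b) < 2 -> b <> Copp Cone ->
  exists n l psi, half_angle_data b n l psi.
Proof.
  intros H1 H2. set (g := Cadd Cone b) in *.
  assert (gn : g <> Czero).
  { intros E. apply H2. replace b with (Csub g Cone) by (unfold g; ring). rewrite E. ring. }
  pose proof (Cabs_pos g gn) as np. set (n := Cabs g) in *.
  pose proof (Cabs_sqr g) as nn. fold n in nn.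
  destruct (Cis_surj (Cmul (Cr (/ n)) (Cconj g))) as [psi Hpsi].
  { rewrite Cabs_mul, Cabs_conj, Cabs_Cr, Rabs_pos_eq by (left; now apply Rinv_0_lt_compat).
    fold n. field. lra. }
  assert (Eb : b = mkC (n * cos psi - 1) (- (n * sin psi))).
  { pose proof (f_equal cre Hpsi) as K1. pose proof (f_equal cim Hpsi) as K2.
    cbn [cre cim Ccis Cmul Cr Cconj] in K1, K2. rewrite K1, K2.
    apply Cx_eq; unfold g; simpl; field; lra. }
  exists n, (ell b), psi.
  assert (L : 3 - 2 * cre b - Cnormsq b = 4 - n * n).
  { rewrite nn. unfold g, Cnormsq; simpl. ring. }
  assert (Lp : 0 < 4 - n * n) by nra.
  constructor; [exact np| | |exact Eb|reflexivity].
  - unfold ell. rewrite L. now apply sqrt_lt_R0.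
  - unfold ell. rewrite L, sqrt_sqrt; lra.
Qed.

(** [eigX] and [eigY] are the cosh and sinh of the hyperbolic rotation diagonalizing D(1); its
    doubled angle has cosh 2/l and sinh n/l. *)
Definition eigX (l : R) : R := sqrt ((2 + l) / (2 * l)).
Definition eigY (l : R) : R := sqrt ((2 - l) / (2 * l)).

Lemma eigXY b n l psi : half_angle_data b n l psi ->
  eigX l * eigX l = (2 + l) / (2 * l) /\ eigY l * eigY l = (2 - l) / (2 * l) /\
  eigX l * eigY l = n / (2 * l).
Proof.
  intros [n0 l0 nl _ _]. assert (l2 : l < 2) by nra.
  assert (P1 : 0 <= (2 + l) / (2 * l)) by (left; apply Rdiv_lt_0_compat; lra).
  assert (P2 : 0 <= (2 - l) / (2 * l)) by (left; apply Rdiv_lt_0_compat; lra).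
  unfold eigX, eigY. split; [|split]; [now apply sqrt_sqrt|now apply sqrt_sqrt|].
  rewrite <- sqrt_mult by assumption.
  replace ((2 + l) / (2 * l) * ((2 - l) / (2 * l))) with ((n / (2 * l)) * (n / (2 * l))).
  - apply sqrt_square. left; apply Rdiv_lt_0_compat; lra.
  - replace ((2 + l) / (2 * l) * ((2 - l) / (2 * l))) with ((4 - l * l) / (4 * (l * l))) by (field; lra).
    replace (4 - l * l) with (n * n) by lra. field. lra.
Qed.

(* The phase of the eigenvectors is chosen so that alpha comes out as stated:
   exp(i psi) = (1 + conj b) / |1 + b|. *)
Definition eigP (l psi : R) : M2 :=
  mkM (Cmul (Cr (eigX l)) (Ccis (psi / 2))) (Cmul (Cmul Ci (Cr (eigY l))) (Ccis (psi / 2)))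
      (Cmul (Copp (Cmul Ci (Cr (eigY l)))) (Ccis (- (psi / 2)))) (Cmul (Cr (eigX l)) (Ccis (- (psi / 2)))).

Lemma Ccis_opp t : Ccis (- t) = Cconj (Ccis t).
Proof. apply Cx_eq; simpl; [apply cos_neg|apply sin_neg]. Qed.
Lemma Ccis_conj_mul t : Cmul (Ccis t) (Cconj (Ccis t)) = Cone.
Proof.
  rewrite Cmul_conj. pose proof (Cabs_cis t) as H. apply Cabs_1_normsq in H. now rewrite H.
Qed.

Lemma eigP_RF l psi : RF (eigP l psi).
Proof. split; unfold eigP; cbn [a11 a12 a21 a22]; rewrite Ccis_opp; cconj_simpl; ring. Qed.

Lemma eigP_det b n l psi : half_angle_data b n l psi -> Mdet (eigP l psi) = Cone.
Proof.
  intros H. destruct (eigXY _ _ _ _ H) as (H1 & H2 & _). destruct H as [n0 l0 _ _ _].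
  unfold Mdet, eigP. cbn [a11 a12 a21 a22]. rewrite Ccis_opp.
  transitivity (Cmul (Cmul (Ccis (psi / 2)) (Cconj (Ccis (psi / 2)))) (Cr (eigX l * eigX l - eigY l * eigY l))).
  - cx_solve.
  - rewrite Ccis_conj_mul, H1, H2. apply Cx_eq; simpl; field; lra.
Qed.

Lemma eigP_good b n l psi : half_angle_data b n l psi ->
  good_eigenframe (Dpot Cone b 2 Cone) (ell b) (eigP l psi).
Proof.
  intros H. pose proof (eigP_det _ _ _ _ H) as Hd.
  destruct (eigXY _ _ _ _ H) as (H1 & H2 & H3).
  split; [exact Hd|split].
  - pose proof (eigP_RF l psi) as [R1 R2].
    assert (E : Cadd (Cmul (Cconj (a11 (eigP l psi))) (a11 (eigP l psi)))
       (Copp (Cmul (Cconj (a21 (eigP l psi))) (a21 (eigP l psi)))) = Cone).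
    { rewrite <- Hd. unfold Mdet. rewrite R1, R2, Cconj_conj. ring. }
    revert E R1 R2. generalize (eigP l psi). intros P E R1 R2.
    unfold Mstar. apply M2_eq; simpl.
    + etransitivity; [|exact E]. ring.
    + rewrite R1, R2, Cconj_conj. ring.
    + rewrite R1, R2, !Cconj_conj. ring.
    + rewrite R1, R2, !Cconj_conj in *. transitivity (Copp (Cadd (Cmul (Cconj (a11 P)) (a11 P)) (Copp (Cmul (a12 P) (Cconj (a12 P)))))); [ring|]. rewrite E. reflexivity.
  - destruct H as [n0 l0 nl Hb Hl]. rewrite Hl.
    assert (N1 : (2 - l) * eigX l = n * eigY l).
    { transitivity (2 * l * (eigY l * eigY l) * eigX l); [rewrite H2; field; lra|].
      transitivity (2 * l * (eigX l * eigY l) * eigY l); [ring|]. rewrite H3. field; lra. }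
    assert (N2 : (2 + l) * eigY l = n * eigX l).
    { transitivity (2 * l * (eigX l * eigX l) * eigY l); [rewrite H1; field; lra|].
      transitivity (2 * l * (eigX l * eigY l) * eigX l); [ring|]. rewrite H3. field; lra. }
    set (X := eigX l) in *. set (Y := eigY l) in *.
    set (tau := Ccis (psi / 2)).
    assert (tt : Cmul tau (Cconj tau) = Cone) by apply Ccis_conj_mul.
    assert (Eb : Cconj b = Csub (Cmul (Cr n) (Cmul tau tau)) Cone).
    { unfold tau. rewrite <- Ccis_add. replace (psi / 2 + psi / 2) with psi by field.
      rewrite Hb. apply Cx_eq; simpl; ring. }
    assert (Eb' : b = Csub (Cmul (Cr n) (Cmul (Cconj tau) (Cconj tau))) Cone).
    { rewrite <- (Cconj_conj b), Eb. cconj_simpl. reflexivity. }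
    assert (U1 : Cabs Cone = 1) by (rewrite <- Ccis_0; apply Cabs_cis).
    unfold Dpot, eigP. fold X Y. rewrite (Cinv_unit _ U1), Ccis_opp, Eb. fold tau.
    rewrite !Cconj_Cone, Eb'.
    assert (cN1 : Cmul (Csub (Cr 2) (Cr l)) (Cr X) = Cmul (Cr n) (Cr Y)).
    { rewrite <- Cr_mul, <- N1. cx_solve. }
    assert (cN2 : Cmul (Cadd (Cr 2) (Cr l)) (Cr Y) = Cmul (Cr n) (Cr X)).
    { rewrite <- Cr_mul, <- N2. cx_solve. }
    apply M2_eq; cbn [a11 a12 a21 a22 Mmul].
    + transitivity (Cmul (Cmul Ci tau) (Csub (Cmul (Cr 2) (Cr X)) (Cmul (Cmul (Cr n) (Cr Y)) (Cmul tau (Cconj tau))))); [ring|].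
      rewrite tt, <- cN1. ring.
    + transitivity (Cadd (Cmul (Cmul Ci Ci) (Cmul (Cmul (Cr 2) (Cr Y)) tau)) (Cmul (Cmul (Cr n) (Cr X)) (Cmul tau (Cmul tau (Cconj tau))))); [ring|].
      rewrite tt, <- cN2, Ci_sqr. transitivity (Cmul (Cr l) (Cmul (Cr Y) tau)); [ring|].
      transitivity (Copp (Cmul (Cmul Ci Ci) (Cmul (Cr l) (Cmul (Cr Y) tau)))); [rewrite Ci_sqr; ring|ring].
    + transitivity (Cadd (Cmul (Cmul Ci Ci) (Cmul (Cmul (Cr 2) (Cr Y)) (Cconj tau))) (Cmul (Cmul (Cr n) (Cr X)) (Cmul (Cconj tau) (Cmul tau (Cconj tau))))); [ring|].
      rewrite tt, <- cN2, Ci_sqr. transitivity (Cmul (Cr l) (Cmul (Cr Y) (Cconj tau))); [ring|].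
      transitivity (Copp (Cmul (Cmul Ci Ci) (Cmul (Cr l) (Cmul (Cr Y) (Cconj tau))))); [rewrite Ci_sqr; ring|ring].
    + transitivity (Copp (Cmul (Cmul Ci (Cconj tau)) (Csub (Cmul (Cr 2) (Cr X)) (Cmul (Cmul (Cr n) (Cr Y)) (Cmul tau (Cconj tau)))))); [ring|].
      rewrite tt, <- cN1. ring.
Qed.

Lemma Sinv_det P lam : Cabs lam = 1 -> Mdet P = Cone -> Mdet (Sinv_of P lam) = Cone.
Proof.
  intros Hl H. unfold Mdet, Sinv_of. cbn [a11 a12 a21 a22].
  transitivity (Cadd (Mdet P) (Cmul (Cmul (a12 P) (a21 P)) (Csub Cone (Cmul lam (Cinv lam))))); [unfold Mdet; ring|].
  rewrite H. replace (Cmul lam (Cinv lam)) with Cone; [ring|]. field. now apply unit_neq0.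
Qed.

Lemma S_of_adj P lam : Cabs lam = 1 -> Mdet P = Cone -> S_of P lam = Madj (Sinv_of P lam).
Proof. intros Hl H. unfold S_of. apply Minv_det1, Sinv_det; assumption. Qed.

Lemma S_of_SU P : Mdet P = Cone -> RF P -> InLoopSU (S_of P).
Proof.
  intros Hd [R1 R2]. apply InLoopSU_iff. split.
  - intros lam Hl. rewrite !S_of_adj by (rewrite ?Cabs_opp; assumption). split.
    + rewrite Mdet_adj. now apply Sinv_det.
    + assert (Hi : Cinv (Copp lam) = Copp (Cinv lam)).
      { rewrite !Cinv_unit by (rewrite ?Cabs_opp; assumption). apply Cconj_opp. }
      unfold Sinv_of. rewrite Hi. msolve.
  - intros lam Hl. rewrite S_of_adj by assumption. apply RF_adj. split; cbn [a11 a12 a21 a22 Sinv_of].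
    + rewrite R1, (Cinv_unit _ Hl), Cconj_mul. reflexivity.
    + exact R2.
Qed.

(** In the real form the second row is conjugate to the first, so the jets of the first row
    determine both derivative matrices. *)
Lemma surface_transform_C2 (F1 F2 : Loop) p q (M : R -> M2) eps (f g : R -> Cx) m f1 f2 k1 k2 :
  InLoopSU F1 -> InLoopSU F2 -> (forall s, F2 (Ccis s) = Mmul (M s) (F1 (Ccis s))) ->
  SymHat F1 (XE p) -> SymHat F2 (XE q) -> 0 < eps ->
  (forall s, RF (M s)) -> (forall s, Mdet (M s) = Cone) ->
  (forall s, Rabs s < eps -> a11 (M s) = f s /\ a12 (M s) = g s) ->
  C2at eps f m f1 f2 -> C2at eps g Czero k1 k2 ->
  hor q = Cadd (Cmul (Cmul m m) (hor p)) (Cmul (Cmul (Cr 2) Ci) (Cmul k1 m)) /\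
  p3 q = p3 p - cim (Cmul f2 (Cconj m)) - cre (Cmul k1 (Cconj (Cmul m (hor p)))).
Proof.
  intros HF1 HF2 E S1 S2 He HR Hd Hfg [(f' & A1 & A2 & A3) A0] [(g' & B1 & B2 & B3) B0].
  assert (H0 : Rabs 0 < eps) by now rewrite Rabs_R0.
  refine (surface_transform F1 F2 p q M (fun s => mkM (f' s) (g' s) (Cconj (g' s)) (Cconj (f' s)))
    (mkM f2 k2 (Cconj k2) (Cconj f2)) eps m k1 HF1 HF2 E S1 S2 He _ _ HR Hd _ _ _).
  - intros s Hs.
    assert (L : 0 < eps - Rabs s) by lra.
    assert (N : forall u, Rabs (u - s) < eps - Rabs s -> Rabs u < eps).
    { intros u Hu. replace u with ((u - s) + s) by ring. eapply Rle_lt_trans; [apply Rabs_triang|lra]. }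
    split; [|split; [|split]]; cbn [a11 a12 a21 a22].
    + apply (Cderiv_loc f _ s _ _ L); [|auto]. intros u Hu. symmetry. apply Hfg, N, Hu.
    + apply (Cderiv_loc g _ s _ _ L); [|auto]. intros u Hu. symmetry. apply Hfg, N, Hu.
    + apply (Cderiv_loc (fun u => Cconj (g u)) _ s _ _ L); [|apply Cderiv_conj; auto].
      intros u Hu. rewrite (proj1 (HR u)). f_equal. symmetry. apply Hfg, N, Hu.
    + apply (Cderiv_loc (fun u => Cconj (f u)) _ s _ _ L); [|apply Cderiv_conj; auto].
      intros u Hu. rewrite (proj2 (HR u)). f_equal. symmetry. apply Hfg, N, Hu.
  - split; [|split; [|split]]; cbn [a11 a12 a21 a22]; try apply Cderiv_conj; assumption.
  - rewrite <- A0. apply Hfg, H0.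
  - rewrite <- B0. apply Hfg, H0.
  - exact B2.
Qed.

Lemma Mexp_elliptic B r t : Mtr B = Czero -> Mdet B = Cr (r * r) -> r <> 0 ->
  Mexp B t = Madd (Mscal (Cr (cos (t * r))) Mid) (Mscal (Cr (sin (t * r) / r)) B).
Proof.
  intros Ht Hd Hr. symmetry.
  apply (Mexp_ode_unique B (fun t => Madd (Mscal (Cr (cos (t * r))) Mid) (Mscal (Cr (sin (t * r) / r)) B))).
  - rewrite Rmult_0_l, cos_0, sin_0. change (Cr 1) with Cone.
    replace (Cr (0 / r)) with Czero by (apply Cx_eq; simpl; field; exact Hr). msolve.
  - intros s. eapply Mderiv_eq.
    + apply Mderiv_add.
      * apply (Mderiv_scal (fun t => Cr (cos (t * r))) (fun _ => Mid)); [|apply Mderiv_const].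
        apply Cderiv_Cr. apply is_derive_Reals. auto_derive; [trivial|reflexivity].
      * apply (Mderiv_scal (fun t => Cr (sin (t * r) / r)) (fun _ => B)); [|apply Mderiv_const].
        apply Cderiv_Cr. apply is_derive_Reals. auto_derive; [trivial|reflexivity].
    + assert (T : a22 B = Copp (a11 B)).
      { unfold Mtr in Ht. replace (a22 B) with (Csub (Cadd (a11 B) (a22 B)) (a11 B)) by ring. rewrite Ht. ring. }
      assert (D : Cadd (Cmul (a11 B) (a11 B)) (Cmul (a12 B) (a21 B)) = Copp (Cmul (Cr r) (Cr r))).
      { rewrite <- Cr_mul, <- Hd. unfold Mdet. rewrite T. ring. }
      replace (Cr (1 * r * - sin (s * r))) with (Copp (Cmul (Cmul (Cr r) (Cr r)) (Cr (sin (s * r) / r))))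
        by (apply Cx_eq; simpl; field; exact Hr).
      replace (Cr (1 * r * cos (s * r) * / r)) with (Cr (cos (s * r)))
        by (apply Cx_eq; simpl; field; exact Hr).
      generalize (Cr (cos (s * r))) (Cr (sin (s * r) / r)) (Cr r) D. intros c k w D'.
      assert (D2 : Cmul w w = Copp (Cadd (Cmul (a11 B) (a11 B)) (Cmul (a12 B) (a21 B)))) by (rewrite D'; ring).
      apply M2_eq; simpl; rewrite ?T, ?D2; ring.
Qed.

(** * The conjugated potential and its second-order expansion at lambda = 1 *)

(** At lambda = exp(i th), S D S^-1 has diagonal i [eig_beta], -i [eig_beta] and upper entry
    [eig_gamma], and its determinant is [eig_d]. The first factor of [eig_gamma] vanishes at th = 0
    because S diagonalizes D(1). *)
Definition eig_beta (n l psi th : R) : R := l + 2 * n / l * (sin th * sin (th + psi)).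
Definition eig_gamma (l psi th : R) : Cx :=
  Cmul (Csub (Ccis th) (Cconj (Ccis th)))
    (Csub (Cmul (Cr (eigY l * eigY l)) (Cmul (Cmul (Ccis th) (Ccis th)) (Ccis psi)))
          (Cmul (Cr (eigX l * eigX l)) (Cconj (Ccis psi)))).
Definition eig_d (n l psi th : R) : R := l * l + 4 * n * (sin th * sin (th + psi)) - 4 * (sin th * sin th).

Lemma sin_Ci t : Cmul (Cmul (Cr 2) Ci) (Cr (sin t)) = Csub (Ccis t) (Cconj (Ccis t)).
Proof. cx_solve. Qed.

Lemma Dpot_det_circle b n l psi th : half_angle_data b n l psi ->
  Mdet (Dpot Cone b 2 (Ccis th)) = Cr (eig_d n l psi th).
Proof.
  intros [n0 l0 nl Hb _].
  pose proof (Dpot_RF Cone b 2 _ (Cabs_cis th)) as [R1 _].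
  assert (E : a12 (Dpot Cone b 2 (Ccis th)) = mkC (n * cos (th + psi)) (n * sin (th + psi) - 2 * sin th)).
  { unfold Dpot. cbn [a12]. rewrite (Cinv_unit _ (Cabs_cis th)), Hb, cos_plus, sin_plus.
    apply Cx_eq; simpl; ring. }
  unfold Mdet. rewrite R1, E. unfold Dpot. cbn [a11 a22].
  pose proof (sin2_cos2 (th + psi)) as S. unfold Rsqr in S.
  unfold eig_d. apply Cx_eq; simpl; [|ring].
  transitivity (4 - n * n * (sin (th + psi) * sin (th + psi) + cos (th + psi) * cos (th + psi))
     + 4 * n * (sin th * sin (th + psi)) - 4 * (sin th * sin th)); [ring|].
  rewrite S. lra.
Qed.

Lemma conj_potential b n l psi th : half_angle_data b n l psi ->
  let B := Mmul (S_of (eigP l psi) (Ccis th)) (Mmul (Dpot Cone b 2 (Ccis th)) (Madj (S_of (eigP l psi) (Ccis th)))) in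
  a11 B = Cmul Ci (Cr (eig_beta n l psi th)) /\ a12 B = eig_gamma l psi th.
Proof.
  intros H B. pose proof (eigP_det _ _ _ _ H) as Hd.
  destruct (eigXY _ _ _ _ H) as (H1 & H2 & H3). destruct H as [n0 l0 nl Hb _].
  unfold B. rewrite (S_of_adj _ _ (Cabs_cis th) Hd), Madj_adj. clear B Hd.
  assert (B1 : Cmul Ci (Cr (eig_beta n l psi th)) =
     Cmul Ci (Csub (Cr l) (Cmul (Cr (n / (2 * l))) (Cmul (Csub (Ccis th) (Cconj (Ccis th)))
        (Csub (Cmul (Ccis th) (Ccis psi)) (Cmul (Cconj (Ccis th)) (Cconj (Ccis psi)))))))).
  { rewrite <- Cconj_mul, <- Ccis_add, <- !sin_Ci. unfold eig_beta. f_equal. apply Cx_eq; simpl; field; lra. }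
  rewrite B1. unfold eig_gamma. clear B1.
  (* [R1] produces the eigenvalue l on the diagonal, and [R2] cancels the part of the off-diagonal
     entry that would survive at lambda = 1. *)
  assert (R1 : Csub (Cmul (Cr 2) (Cadd (Cmul (Cr (eigX l)) (Cr (eigX l))) (Cmul (Cr (eigY l)) (Cr (eigY l)))))
     (Cmul (Cmul (Cr 2) (Cr n)) (Cmul (Cr (eigX l)) (Cr (eigY l)))) = Cr l).
  { rewrite <- !Cr_mul, H1, H2, H3. apply Cx_eq; simpl; [|field; lra].
    transitivity ((4 - n * n) / l); [field; lra|]. replace (4 - n * n) with (l * l) by lra. field; lra. }
  assert (R2 : Cmul (Cr n) (Cadd (Cmul (Cr (eigX l)) (Cr (eigX l))) (Cmul (Cr (eigY l)) (Cr (eigY l))))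
     = Cmul (Cadd (Cr 2) (Cr 2)) (Cmul (Cr (eigX l)) (Cr (eigY l)))).
  { rewrite <- !Cr_mul, H1, H2, H3. apply Cx_eq; simpl; field; lra. }
  assert (R3 : Cr (n / (2 * l)) = Cmul (Cr (eigX l)) (Cr (eigY l))) by (rewrite <- Cr_mul, H3; reflexivity).
  rewrite R3, !Cr_mul. clear H1 H2 H3 R3.
  replace (Ccis psi) with (Cmul (Ccis (psi / 2)) (Ccis (psi / 2)))
    by (rewrite <- Ccis_add; f_equal; field).
  assert (Eb : b = Csub (Cmul (Cr n) (Cmul (Cconj (Ccis (psi / 2))) (Cconj (Ccis (psi / 2))))) Cone).
  { rewrite <- Cconj_mul, <- Ccis_add. replace (psi / 2 + psi / 2) with psi by field.
    rewrite Hb. apply Cx_eq; simpl; ring. }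
  assert (Eb' : Cconj b = Csub (Cmul (Cr n) (Cmul (Ccis (psi / 2)) (Ccis (psi / 2)))) Cone).
  { rewrite Eb. cconj_simpl. reflexivity. }
  unfold Sinv_of, Dpot, eigP, Madj. rewrite (Cinv_unit _ (Cabs_cis th)), Ccis_opp, Eb', Cconj_Cone.
  rewrite Eb, Cconj_mul. clear Eb Eb' Hb.
  pose proof (Ccis_conj_mul th) as L. pose proof (Ccis_conj_mul (psi / 2)) as T.
  (* Each unit complex number and its conjugate become independent symbols, tied only by the
     relation that their product is one, so [ring] can work modulo these relations. *)
  revert L T R1 R2. generalize (Ccis th) (Cconj (Ccis th)) (Ccis (psi / 2)) (Cconj (Ccis (psi / 2)))
    (Cr (eigX l)) (Cr (eigY l)) (Cr n) (Cr l).
  intros lam mu tau sg X Y cn cl L T R1 R2.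
  pose proof Ci_sqr as I2.
  split; cbn [a11 a12 a21 a22 Mmul Madj].
  - rewrite <- R1. clear R1 R2. replace (Cr 2) with (Cadd Cone Cone) by cx_solve. ring [L T I2].
  - transitivity (Cadd (Cmul lam (Csub (Cmul cn (Cadd (Cmul X X) (Cmul Y Y))) (Cmul (Cadd (Cr 2) (Cr 2)) (Cmul X Y))))
      (Cmul (Csub lam mu) (Csub (Cmul (Cmul Y Y) (Cmul (Cmul lam lam) (Cmul tau tau))) (Cmul (Cmul X X) (Cmul sg sg))))).
    + clear R1 R2. replace (Cr 2) with (Cadd Cone Cone) by cx_solve. ring [L T I2].
    + rewrite R2. ring.
Qed.

Lemma C2at_conj eps f f0 f1 f2 : C2at eps f f0 f1 f2 ->
  C2at eps (fun s => Cconj (f s)) (Cconj f0) (Cconj f1) (Cconj f2).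
Proof.
  intros [(f' & F1 & F2 & F3) F0]. constructor; [|now rewrite F0].
  exists (fun s => Cconj (f' s)). split; [|split].
  - intros; apply Cderiv_conj; auto. - now rewrite F2. - now apply Cderiv_conj.
Qed.
Lemma C2at_opp eps f f0 f1 f2 : C2at eps f f0 f1 f2 ->
  C2at eps (fun s => Copp (f s)) (Copp f0) (Copp f1) (Copp f2).
Proof.
  intros [(f' & F1 & F2 & F3) F0]. constructor; [|now rewrite F0].
  exists (fun s => Copp (f' s)). split; [|split].
  - intros; apply Cderiv_opp; auto. - now rewrite F2. - now apply Cderiv_opp.
Qed.
Lemma C2at_eq eps f f0 f1 f2 g0 g1 g2 : C2at eps f f0 f1 f2 -> f0 = g0 -> f1 = g1 -> f2 = g2 -> C2at eps f g0 g1 g2.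
Proof. now intros H <- <- <-. Qed.

Definition eig_d1 (n psi th : R) : R :=
  4 * n * (cos th * sin (th + psi) + sin th * cos (th + psi)) - 8 * (sin th * cos th).
Definition eig_r (n l psi th : R) : R := sqrt (eig_d n l psi th).
Definition eig_r1 (n l psi th : R) : R := eig_d1 n psi th / (2 * eig_r n l psi th).

Lemma eig_d_deriv n l psi th : is_derive (eig_d n l psi) th (eig_d1 n psi th).
Proof. unfold eig_d, eig_d1. auto_derive; [trivial|ring]. Qed.

Lemma eig_d_pos n l psi : 0 < l -> exists eps, 0 < eps /\ forall th, Rabs th < eps -> 0 < eig_d n l psi th.
Proof.
  intros Hl.
  assert (C : continuous (eig_d n l psi) 0).
  { apply (@ex_derive_continuous _ R_NormedModule). eexists. apply eig_d_deriv. }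
  apply continuity_pt_filterlim in C. destruct (C (l * l)) as (e & He & H); [nra|].
  exists e. split; [exact He|]. intros th Hth.
  destruct (Req_dec th 0) as [->|Hn].
  - unfold eig_d. rewrite sin_0. nra.
  - specialize (H th). simpl in H. unfold Rdist in H. rewrite Rminus_0_r in H.
    assert (Q : Rabs (eig_d n l psi th - eig_d n l psi 0) < l * l).
    { apply H. split; [split; [exact I|auto]|exact Hth]. }
    apply Rabs_lt_between in Q. unfold eig_d at 2 in Q. unfold eig_d at 3 in Q.
    rewrite sin_0 in Q. lra.
Qed.

Lemma eig_r_deriv n l psi th : 0 < eig_d n l psi th ->
  is_derive (eig_r n l psi) th (eig_r1 n l psi th).
Proof.
  intros H. unfold eig_r1, eig_r. pose proof (eig_d_deriv n l psi th) as D.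
  auto_derive.
  - split; [now eexists; apply D|]. split; [exact H|trivial].
  - rewrite (is_derive_unique (fun x : R => eig_d n l psi x) _ _ D). field. apply Rgt_not_eq, sqrt_lt_R0, H.
Qed.

Lemma eig_r_0 n l psi : 0 < l -> eig_r n l psi 0 = l.
Proof.
  intros H. unfold eig_r, eig_d. rewrite sin_0.
  replace (l * l + 4 * n * (0 * sin (0 + psi)) - 4 * (0 * 0)) with (l * l) by ring.
  apply sqrt_square; lra.
Qed.
Lemma eig_r1_0 n l psi : 0 < l -> eig_r1 n l psi 0 = 2 * n * sin psi / l.
Proof.
  intros H. unfold eig_r1. rewrite eig_r_0 by exact H. unfold eig_d1.
  rewrite sin_0, cos_0, Rplus_0_l. field. lra.
Qed.

(** Second derivative at 0 of r = sqrt d, namely d''/(2 l) - d'^2/(4 l^3) with d'(0) = 4 n sin psi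
    and d''(0) = 8 n cos psi - 8. The pitch will be -r''/(2 l). *)
Definition eig_r2 (n l psi : R) : R :=
  (8 * n * cos psi - 8) / (2 * l) - (4 * n * sin psi) * (4 * n * sin psi) / (4 * l * l * l).

Lemma eig_r1_deriv n l psi : 0 < l -> is_derive (eig_r1 n l psi) 0 (eig_r2 n l psi).
Proof.
  intros H. assert (D0 : 0 < eig_d n l psi 0) by (unfold eig_d; rewrite sin_0; nra).
  pose proof (eig_r_deriv n l psi 0 D0) as D. rewrite eig_r1_0 in D by exact H.
  unfold eig_r1, eig_d1. auto_derive.
  - split; [now eexists; apply D|]. split; [|trivial]. rewrite eig_r_0 by exact H. lra.
  - rewrite !(is_derive_unique (fun x : R => eig_r n l psi x) _ _ D), eig_r_0 by exact H. rewrite sin_0, cos_0, Rplus_0_l.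
    unfold eig_r2. field. lra.
Qed.

Lemma cos_r_C2 n l psi t eps : 0 < l -> (forall th, Rabs th < eps -> 0 < eig_d n l psi th) ->
  C2at eps (fun th => Cr (cos (t * eig_r n l psi th))) (Cr (cos (t * l)))
   (Cr (- (t * (2 * n * sin psi / l)) * sin (t * l)))
   (Cr (- t * eig_r2 n l psi * sin (t * l) - (t * (2 * n * sin psi / l)) * (t * (2 * n * sin psi / l)) * cos (t * l))).
Proof.
  intros Hl He.
  replace (cos (t * l)) with (cos (t * eig_r n l psi 0)) at 1 by now rewrite eig_r_0.
  replace (- (t * (2 * n * sin psi / l)) * sin (t * l))
    with (- (t * eig_r1 n l psi 0) * sin (t * eig_r n l psi 0)) by now rewrite eig_r_0, eig_r1_0.
  apply (C2at_real eps (fun th => cos (t * eig_r n l psi th)) (fun th => - (t * eig_r1 n l psi th) * sin (t * eig_r n l psi th))).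
  - intros s Hs. pose proof (eig_r_deriv n l psi s (He s Hs)) as D.
    auto_derive; [now eexists; apply D|]. rewrite !(is_derive_unique (fun x : R => eig_r n l psi x) _ _ D). ring.
  - assert (D0 : 0 < eig_d n l psi 0) by (unfold eig_d; rewrite sin_0; nra).
    pose proof (eig_r_deriv n l psi 0 D0) as D. rewrite eig_r1_0 in D by exact Hl.
    pose proof (eig_r1_deriv n l psi Hl) as D1.
    auto_derive; [split; [now eexists; apply D1|split; [now eexists; apply D|trivial]]|].
    rewrite !(is_derive_unique (fun x : R => eig_r n l psi x) _ _ D), !(is_derive_unique (fun x : R => eig_r1 n l psi x) _ _ D1), eig_r_0, eig_r1_0 by exact Hl. ring.
Qed.

Lemma sinc_r_C2 n l psi t eps : 0 < l -> (forall th, Rabs th < eps -> 0 < eig_d n l psi th) ->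
  let rho := 2 * n * sin psi / l in
  C2at eps (fun th => Cr (sin (t * eig_r n l psi th) / eig_r n l psi th)) (Cr (sin (t * l) / l))
   (Cr (rho * (t * cos (t * l) / l - sin (t * l) / (l * l))))
   (Cr (eig_r2 n l psi * (t * cos (t * l) / l - sin (t * l) / (l * l))
      + rho * rho * (- t * t * sin (t * l) / l - 2 * t * cos (t * l) / (l * l) + 2 * sin (t * l) / (l * l * l)))).
Proof.
  intros Hl He rho.
  assert (E : rho * (t * cos (t * l) / l - sin (t * l) / (l * l)) =
     eig_r1 n l psi 0 * (t * cos (t * eig_r n l psi 0) / eig_r n l psi 0 - sin (t * eig_r n l psi 0) / (eig_r n l psi 0 * eig_r n l psi 0)))
    by now rewrite eig_r_0, eig_r1_0.
  rewrite E.
  replace (sin (t * l) / l) with (sin (t * eig_r n l psi 0) / eig_r n l psi 0) at 1 by now rewrite eig_r_0.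
  apply (C2at_real eps (fun th => sin (t * eig_r n l psi th) / eig_r n l psi th)
    (fun th => eig_r1 n l psi th * (t * cos (t * eig_r n l psi th) / eig_r n l psi th - sin (t * eig_r n l psi th) / (eig_r n l psi th * eig_r n l psi th)))).
  - intros s Hs. pose proof (eig_r_deriv n l psi s (He s Hs)) as D.
    assert (rp : 0 < eig_r n l psi s) by (apply sqrt_lt_R0, He, Hs).
    auto_derive; [split; [now eexists; apply D|split; [now eexists; apply D|split; [lra|trivial]]]|].
    rewrite !(is_derive_unique (fun x : R => eig_r n l psi x) _ _ D). field. lra.
  - assert (D0 : 0 < eig_d n l psi 0) by (unfold eig_d; rewrite sin_0; nra).
    pose proof (eig_r_deriv n l psi 0 D0) as D. rewrite eig_r1_0 in D by exact Hl.
    pose proof (eig_r1_deriv n l psi Hl) as D1.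
    assert (X : ex_derive (eig_r n l psi) 0) by (eexists; apply D).
    assert (X1 : ex_derive (eig_r1 n l psi) 0) by (eexists; apply D1).
    auto_derive; [repeat split; try assumption; rewrite eig_r_0 by exact Hl; nra|].
    rewrite !(is_derive_unique (fun x : R => eig_r n l psi x) _ _ D), !(is_derive_unique (fun x : R => eig_r1 n l psi x) _ _ D1), eig_r_0, eig_r1_0 by exact Hl.
    unfold rho. field. lra.
Qed.

Lemma eig_beta_C2 eps n l psi : 0 < eps -> 0 < l ->
  C2at eps (fun th => Cr (eig_beta n l psi th)) (Cr l) (Cr (2 * n * sin psi / l)) (Cr (4 * n * cos psi / l)).
Proof.
  intros He Hl.
  assert (E0 : eig_beta n l psi 0 = l) by (unfold eig_beta; rewrite sin_0; ring).
  assert (E1 : 2 * n * sin psi / l = 2 * n / l * (cos 0 * sin (0 + psi) + sin 0 * cos (0 + psi))).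
  { rewrite sin_0, cos_0, Rplus_0_l. field; lra. }
  eapply C2at_eq; [|exact (f_equal Cr E0)|symmetry; exact (f_equal Cr E1)|reflexivity].
  apply (C2at_real eps (eig_beta n l psi) (fun th => 2 * n / l * (cos th * sin (th + psi) + sin th * cos (th + psi)))).
  - intros s _. unfold eig_beta. auto_derive; [trivial|ring].
  - auto_derive; [trivial|]. rewrite sin_0, cos_0, Rplus_0_l. field; lra.
Qed.

Lemma cis_C2 eps : C2at eps Ccis Cone Ci (Copp Cone).
Proof.
  constructor; [|apply Ccis_0]. exists (fun t => Cmul Ci (Ccis t)). split; [|split].
  - intros; apply Cderiv_cis.
  - rewrite Ccis_0. ring.
  - assert (H : Cderiv_th (fun t => Cmul Ci (Ccis t)) 0 (Cadd (Cmul Czero (Ccis 0)) (Cmul Ci (Cmul Ci (Ccis 0))))).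
    { apply (Cderiv_mul (fun _ => Ci) Ccis); [apply Cderiv_const|apply Cderiv_cis]. }
    replace (Copp Cone) with (Cadd (Cmul Czero (Ccis 0)) (Cmul Ci (Cmul Ci (Ccis 0)))); [exact H|].
    rewrite Ccis_0. cx_solve.
Qed.
Definition eig_gamma1 (l psi : R) : Cx :=
  Cmul (Cmul (Cr 2) Ci) (Csub (Cmul (Cr (eigY l * eigY l)) (Ccis psi)) (Cmul (Cr (eigX l * eigX l)) (Cconj (Ccis psi)))).

Lemma eig_gamma_C2 eps l psi : 0 < eps -> exists g2,
  C2at eps (eig_gamma l psi) Czero (eig_gamma1 l psi) g2.
Proof.
  intros He. eexists. unfold eig_gamma, Csub.
  eapply C2at_eq.
  - apply C2at_mul; [exact He| |].
    + apply C2at_add; [exact He|apply cis_C2|].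
      apply C2at_opp, C2at_conj, cis_C2.
    + apply C2at_add; [exact He| |apply C2at_opp, C2at_const].
      apply C2at_mul; [exact He|apply C2at_const|].
      apply C2at_mul; [exact He| |apply C2at_const].
      apply C2at_mul; [exact He|apply cis_C2|apply cis_C2].
  - rewrite Cconj_Cone. ring.
  - unfold eig_gamma1. rewrite Cconj_Cone, Cconj_Ci. replace (Cr 2) with (Cadd Cone Cone) by cx_solve. ring.
  - reflexivity.
Qed.

Definition eig_alpha (l psi : R) : Cx := mkC (4 * sin psi / (l * l)) (2 * cos psi / l).

(** Relates axis and second derivatives: it turns the coefficient of sin(tl) cos(tl) in the height
    into |alpha|^2, as the helicoidal motion requires. *)
Lemma eig_alpha_normsq n l psi : 0 < l -> n * n + l * l = 4 ->
  Cnormsq (eig_alpha l psi) = (4 * n * cos psi / l - eig_r2 n l psi) / l.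
Proof.
  intros Hl Hn. unfold Cnormsq, eig_alpha, eig_r2. cbn [cre cim].
  assert (S : cos psi * cos psi = 1 - sin psi * sin psi).
  { pose proof (sin2_cos2 psi) as S. unfold Rsqr in S. lra. }
  transitivity ((16 * (sin psi * sin psi) + 4 * (l * l) * (cos psi * cos psi)) / (l * l * l * l)); [field; lra|].
  transitivity ((4 * (n * n) * (sin psi * sin psi) + 4 * (l * l)) / (l * l * l * l)); [|field; lra].
  rewrite S. replace (n * n) with (4 - l * l) by lra. f_equal. ring.
Qed.

Lemma eig_gamma1_alpha b n l psi : half_angle_data b n l psi ->
  eig_gamma1 l psi = Cmul (Cr (- l)) (eig_alpha l psi).
Proof.
  intros H. destruct (eigXY _ _ _ _ H) as (H1 & H2 & _). destruct H as [n0 l0 nl _ _].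
  unfold eig_gamma1. rewrite H1, H2. unfold eig_alpha. apply Cx_eq; simpl; field; lra.
Qed.

(** At lambda = 1 the diagonal entry is m = exp(i t l), so the horizontal rotation is m^2 = exp(2 i
    l t). The off-diagonal derivative is k1 = -sin(tl) alpha, and 2 i k1 m = alpha (1 - exp(2 i l
    t)) is the translation about the axis. *)
Lemma eig_motion b n l psi z t p q : half_angle_data b n l psi ->
  SurfPt (Dpot Cone b 2) (S_of (eigP l psi)) z p ->
  SurfPt (Dpot Cone b 2) (S_of (eigP l psi)) (Cplus_real z t) q ->
  q = act (helic (eig_alpha l psi) (- eig_r2 n l psi / (2 * l)) (2 * l * t)) p.
Proof.
  intros H HP HQ.
  pose proof (eigP_det _ _ _ _ H) as Hd.
  assert (HS : InLoopSU (S_of (eigP l psi))) by (apply S_of_SU; [exact Hd|apply eigP_RF]).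
  destruct (SurfPt_frame _ _ _ _ HP) as (F1 & I1 & Sym1).
  destruct (SurfPt_frame _ _ _ _ HQ) as (F2 & I2 & Sym2).
  pose proof (frame_translate _ _ _ _ _ _ _ _ HS I1 I2) as E.
  assert (l0 : 0 < l) by apply H.
  destruct (eig_d_pos n l psi l0) as (eps & He & Hpos).
  set (S := S_of (eigP l psi)) in *.
  set (M := fun s => transl Cone b 2 S t (Ccis s)).
  pose proof (InLoopSU_transl Cone b 2 S t HS) as HM. apply InLoopSU_iff in HM. destruct HM as [HM1 HM2].
  pose proof (cos_r_C2 n l psi t eps l0 Hpos) as Cc.
  pose proof (sinc_r_C2 n l psi t eps l0 Hpos) as Cs.
  pose proof (eig_beta_C2 eps n l psi He l0) as Cb.
  destruct (eig_gamma_C2 eps l psi He) as [g2 Cg].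
  cbv zeta in Cs.
  pose proof (C2at_add _ _ _ _ _ _ _ _ _ He Cc (C2at_mul _ _ _ _ _ _ _ _ _ He Cs
    (C2at_mul _ _ _ _ _ _ _ _ _ He (C2at_const eps Ci) Cb))) as Cf.
  pose proof (C2at_mul _ _ _ _ _ _ _ _ _ He Cs Cg) as Ck. cbv beta in Cf, Ck.
  set (C := cos (t * l)) in *. set (Sn := sin (t * l)) in *.
  set (rho := 2 * n * sin psi / l) in *. set (R2 := eig_r2 n l psi) in *.
  assert (m0 : Cadd (Cr C) (Cmul (Cr (Sn / l)) (Cmul Ci (Cr l))) = mkC C Sn) by (apply Cx_eq; simpl; field; lra).
  rewrite m0 in Cf.
  replace (Cmul (Cr (Sn / l)) Czero) with Czero in Ck by ring.
  assert (B : forall s, Rabs s < eps -> a11 (M s) = Cadd (Cr (cos (t * eig_r n l psi s)))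
        (Cmul (Cr (sin (t * eig_r n l psi s) / eig_r n l psi s)) (Cmul Ci (Cr (eig_beta n l psi s)))) /\
      a12 (M s) = Cmul (Cr (sin (t * eig_r n l psi s) / eig_r n l psi s)) (eig_gamma l psi s)).
  { intros s Hs. specialize (Hpos s Hs).
    pose proof (InLoopSU_det S s HS) as dS.
    destruct (conj_potential b n l psi s H) as [B1 B2]. fold S in B1, B2.
    unfold M. rewrite transl_Mexp by exact dS.
    pose proof (Mtr_conj _ (Dpot Cone b 2 (Ccis s)) dS) as tB. rewrite Dpot_trace in tB.
    pose proof (Mdet_conj _ (Dpot Cone b 2 (Ccis s)) dS) as dB. rewrite (Dpot_det_circle _ _ _ _ _ H) in dB.
    revert B1 B2 tB dB. generalize (Mmul (S (Ccis s)) (Mmul (Dpot Cone b 2 (Ccis s)) (Madj (S (Ccis s))))).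
    intros A B1 B2 tB dB.
    rewrite (Mexp_elliptic A (eig_r n l psi s) t tB).
    - rewrite <- B1, <- B2. cbn [a11 a12 Madd Mscal Mid]. split; ring.
    - rewrite dB. f_equal. symmetry. apply sqrt_sqrt. lra.
    - apply Rgt_not_eq, sqrt_lt_R0, Hpos. }
  destruct (surface_transform_C2 F1 F2 p q M eps _ _ _ _ _ _ _ (IsFrame_SU _ _ _ _ HS I1) (IsFrame_SU _ _ _ _ HS I2)
    (fun s => E _ (Cabs_cis s)) Sym1 Sym2 He (fun s => HM2 _ (Cabs_cis s)) (fun s => proj1 (HM1 _ (Cabs_cis s))) B Cf Ck)
    as [Q1 Q2].
  clear Cc Cs Cb Cg Cf Ck B E HM1 HM2 M Sym1 Sym2 I1 I2 HP HQ HS.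
  rewrite (eig_gamma1_alpha _ _ _ _ H) in Q1, Q2.
  pose proof (eig_alpha_normsq n l psi l0 (ha_nl _ _ _ _ H)) as Na. fold R2 in Na.
  assert (k1 : Cadd (Cmul (Cr (rho * (t * C / l - Sn / (l * l)))) Czero) (Cmul (Cr (Sn / l)) (Cmul (Cr (- l)) (eig_alpha l psi)))
     = Cmul (Cr (- Sn)) (eig_alpha l psi)) by (apply Cx_eq; simpl; field; lra).
  rewrite k1 in Q1, Q2.
  assert (CS : C * C + Sn * Sn = 1).
  { pose proof (sin2_cos2 (t * l)) as X. unfold Rsqr in X. fold C Sn in X. lra. }
  assert (c2 : cos (2 * l * t) = C * C - Sn * Sn).
  { replace (2 * l * t) with (2 * (t * l)) by ring. apply cos_2a. }
  assert (s2 : sin (2 * l * t) = 2 * Sn * C).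
  { replace (2 * l * t) with (2 * (t * l)) by ring. apply sin_2a. }
  (* All terms in [rho], the slope of r at 0, cancel here. What remains is the drift t R2, which
     becomes the pitch, and a multiple of sin(tl) cos(tl). *)
  match type of Q2 with _ = _ - cim (Cmul ?f _) - _ =>
    assert (K : cim (Cmul f (Cconj (mkC C Sn))) = t * R2 + Sn * C * (4 * n * cos psi / l - R2) / l) end.
  { transitivity (t * R2 * (C * C + Sn * Sn) + Sn * C * (4 * n * cos psi / l - R2) / l); [|rewrite CS; ring].
    simpl. field. lra. }
  rewrite K in Q2. clear K.
  assert (Nb : Sn * C * (4 * n * cos psi / l - R2) / l = Sn * C * Cnormsq (eig_alpha l psi)).
  { rewrite Na. field. lra. }
  rewrite Nb in Q2.
  pose proof (f_equal cre Q1) as Q3. pose proof (f_equal cim Q1) as Q4. clear Q1 Nb Na k1 m0.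
  destruct q as [[q1 q2] q3]. destruct p as [[x1 x2] x3].
  unfold hor, p1, p2, p3 in Q2, Q3, Q4. cbn [fst snd] in Q2, Q3, Q4.
  unfold act, helic, nil_mul, p1, p2, p3. cbn [fst snd].
  revert Q2 Q3 Q4. generalize (eig_alpha l psi). intros al Q2 Q3 Q4.
  simpl in Q2, Q3, Q4 |- *. rewrite c2, s2.
  assert (CS2 : C * C = 1 - Sn * Sn) by lra.
  f_equal; [f_equal|].
  - rewrite Q3. ring [CS2].
  - rewrite Q4. ring [CS2].
  - rewrite Q2.
    transitivity (x3 - (t * R2 + Sn * C * Cnormsq al) + Sn * (cre al * (C * x1 - Sn * x2) + cim al * (C * x2 + Sn * x1))); [ring|].
    transitivity (x3 - (t * R2 + Sn * C * Cnormsq al) + Sn * ((C * C + Sn * Sn) * (cre al * (C * x1 - Sn * x2) + cim al * (C * x2 + Sn * x1)))); [rewrite CS; ring|].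
    field_simplify_eq; [|lra]. ring [CS2].
Qed.

Lemma alpha_of_eig b n l psi : half_angle_data b n l psi -> alpha_of b = eig_alpha l psi.
Proof.
  intros [n0 l0 nl Hb Hl]. unfold alpha_of. rewrite Hl.
  assert (Hs : sqrt (4 - l ^ 2) = n).
  { replace (4 - l ^ 2) with (n * n) by (simpl; lra). apply sqrt_square; lra. }
  rewrite Hs. unfold Cdiv.
  assert (C1 : cos psi * cos psi = 1 - sin psi * sin psi).
  { pose proof (sin2_cos2 psi) as S. unfold Rsqr in S. lra. }
  set (den := Cmul (Cmul (Cr (l ^ 2)) (Cadd Cone b)) (Cr n)).
  assert (D : den = Cmul (Cr (l * l * (n * n))) (Cconj (Ccis psi))).
  { unfold den. rewrite Hb. apply Cx_eq; simpl; ring. }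
  assert (Dn : den <> Czero).
  { rewrite D. intros E. destruct (Cmul_eq0 _ _ E) as [E1|E1].
    - apply Cr_0_eq0 in E1. assert (0 < l * l * (n * n)) by (apply Rmult_lt_0_compat; nra). lra.
    - pose proof (Cabs_cis psi) as A. rewrite <- Cabs_conj, E1 in A. change Czero with (Cr 0) in A.
      rewrite Cabs_Cr, Rabs_R0 in A. lra. }
  (* The numerator is compared with [eig_alpha] times the denominator; n^2 = (2 - l)(2 + l) absorbs
     its factor 2 + l. *)
  match goal with |- Cmul ?num _ = _ => assert (N : num = Cmul (eig_alpha l psi) den) end.
  { rewrite D, Hb. unfold eig_alpha.
    replace (l * l * (n * n)) with (l * l * ((2 - l) * (2 + l))) by (replace (n * n) with (4 - l * l) by lra; ring).
    assert (n2 : n * n = (2 - l) * (2 + l)) by (replace (n * n) with (4 - l * l) by lra; ring).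
    apply Cx_eq; simpl.
    - transitivity (- (2 + l) * (2 * (n * n) * cos psi * - sin psi)); [ring|]. rewrite n2. field. lra.
    - transitivity ((2 + l) * (4 * l - 8 + 2 * (n * n) * (cos psi * cos psi))); [ring|]. rewrite n2.
      transitivity ((2 - l) * (2 + l) * (2 * l * (cos psi * cos psi) - 4 * (1 - cos psi * cos psi))); [ring|].
      replace (1 - cos psi * cos psi) with (sin psi * sin psi) by lra. field. lra. }
  rewrite N. field. exact Dn.
Qed.

Lemma pitch_eig b n l psi : half_angle_data b n l psi -> pitch b = - eig_r2 n l psi / (2 * l).
Proof.
  intros [n0 l0 nl Hb Hl]. unfold pitch, pitch_num. rewrite Hl, Hb. unfold eig_r2, Cnormsq. cbn [cre cim].
  assert (C1 : sin psi * sin psi = 1 - cos psi * cos psi).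
  { pose proof (sin2_cos2 psi) as S. unfold Rsqr in S. lra. }
  assert (n2 : n * n = 4 - l * l) by lra.
  transitivity ((2 * (n * n) * (sin psi * sin psi) + (2 - 2 * n * cos psi) * (l * l)) / (l * l * l * l)); [|field; lra].
  replace (l ^ 4) with (l * l * l * l) by ring. f_equal.
  set (c := cos psi) in *. set (s := sin psi) in *.
  replace ((n * c - 1) * (n * c - 1) + - (n * s) * - (n * s)) with (n * n * (c * c + s * s) - 2 * n * c + 1) by ring.
  rewrite C1. replace (l * l) with (4 - n * n) by lra. ring.
Qed.

Theorem eig_equivariant b n l psi f U : half_angle_data b n l psi ->
  Generated (Dpot Cone b 2) (S_of (eigP l psi)) f U ->
  Equivariant f U (fun t => helic (alpha_of b) (pitch b) (2 * ell b * t)).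
Proof.
  intros H (_ & _ & HG) z t Hz Hzt.
  rewrite (alpha_of_eig _ _ _ _ H), (pitch_eig _ _ _ _ H), (ha_ell _ _ _ _ H).
  eapply eig_motion; [exact H|apply HG, Hz|apply HG, Hzt].
Qed.

(** * Comparison of two helicoidal motions along one orbit *)

Lemma helic_orbit_deriv alpha k w t :
  Cderiv_th (fun t => Cadd (Cmul alpha (Csub Cone (Ccis (k * t)))) (Cmul (Ccis (k * t)) w)) t
    (Cmul (Cmul (Cmul Ci (Cr k)) (Ccis (k * t))) (Csub w alpha)).
Proof.
  apply Cderiv_ext with (fun t => Cadd alpha (Cmul (Ccis (k * t)) (Csub w alpha))); [intros; ring|].
  replace (Cmul (Cmul (Cmul Ci (Cr k)) (Ccis (k * t))) (Csub w alpha))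
    with (Cadd Czero (Cadd (Cmul (Cmul (Cmul Ci (Cr k)) (Ccis (k * t))) (Csub w alpha)) (Cmul (Ccis (k * t)) Czero))) by ring.
  apply Cderiv_add; [apply Cderiv_const|].
  apply (Cderiv_mul (fun t => Ccis (k * t)) (fun _ => Csub w alpha)); [apply Cderiv_cis_scal|apply Cderiv_const].
Qed.

(** The first and second derivatives at t = 0 give k (w - alpha) = k' (w - alpha') and k^2 (w -
    alpha) = k'^2 (w - alpha'), hence k (k - k') (w - alpha) = 0. *)
Lemma helic_orbit_axis alpha alpha' k k' w : k <> 0 -> k' <> 0 ->
  (forall t, Cadd (Cmul alpha (Csub Cone (Ccis (k * t)))) (Cmul (Ccis (k * t)) w)
    = Cadd (Cmul alpha' (Csub Cone (Ccis (k' * t)))) (Cmul (Ccis (k' * t)) w)) ->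
  alpha = alpha' /\ (k = k' \/ w = alpha).
Proof.
  intros Hk Hk' H.
  assert (D : forall t, Cmul (Cmul (Cmul Ci (Cr k)) (Ccis (k * t))) (Csub w alpha)
     = Cmul (Cmul (Cmul Ci (Cr k')) (Ccis (k' * t))) (Csub w alpha')).
  { intros t. eapply Cderiv_unique; [apply helic_orbit_deriv|].
    eapply Cderiv_ext; [|apply helic_orbit_deriv]. intros s. symmetry. apply H. }
  assert (D2 : forall q kk t, Cderiv_th (fun t => Cmul (Cmul (Cmul Ci (Cr kk)) (Ccis (kk * t))) q) t
    (Cmul (Cmul (Cmul Ci (Cr kk)) (Cmul (Cmul Ci (Cr kk)) (Ccis (kk * t)))) q)).
  { intros q kk t. apply Cderiv_ext with (fun t => Cmul (Cmul (Cmul Ci (Cr kk)) q) (Ccis (kk * t))); [intros; ring|].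
    replace (Cmul (Cmul (Cmul Ci (Cr kk)) (Cmul (Cmul Ci (Cr kk)) (Ccis (kk * t)))) q)
      with (Cadd (Cmul Czero (Ccis (kk * t))) (Cmul (Cmul (Cmul Ci (Cr kk)) q) (Cmul (Cmul Ci (Cr kk)) (Ccis (kk * t))))) by ring.
    apply (Cderiv_mul (fun _ => Cmul (Cmul Ci (Cr kk)) q) (fun t => Ccis (kk * t))); [apply Cderiv_const|apply Cderiv_cis_scal]. }
  assert (E2 : Cmul (Cmul (Cmul Ci (Cr k)) (Cmul (Cmul Ci (Cr k)) (Ccis (k * 0)))) (Csub w alpha)
    = Cmul (Cmul (Cmul Ci (Cr k')) (Cmul (Cmul Ci (Cr k')) (Ccis (k' * 0)))) (Csub w alpha')).
  { eapply Cderiv_unique; [apply D2|]. eapply Cderiv_ext; [|apply D2]. intros s. symmetry. apply D. }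
  specialize (D 0). rewrite !Rmult_0_r, Ccis_0 in D. rewrite !Rmult_0_r, Ccis_0 in E2.
  pose proof (f_equal cre D) as d1. pose proof (f_equal cim D) as d2.
  pose proof (f_equal cre E2) as e1. pose proof (f_equal cim E2) as e2. simpl in d1, d2, e1, e2.
  assert (x1 : k * (cre w - cre alpha) = k' * (cre w - cre alpha')) by lra.
  assert (x2 : k * (cim w - cim alpha) = k' * (cim w - cim alpha')) by lra.
  assert (y1 : k * (k * (cre w - cre alpha)) = k' * (k' * (cre w - cre alpha'))) by lra.
  assert (y2 : k * (k * (cim w - cim alpha)) = k' * (k' * (cim w - cim alpha'))) by lra.
  rewrite <- x1 in y1. rewrite <- x2 in y2.
  assert (z1 : (k * (k - k')) * (cre w - cre alpha) = 0) by lra.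
  assert (z2 : (k * (k - k')) * (cim w - cim alpha) = 0) by lra.
  destruct (Req_dec k k') as [<-|Hn].
  - split; [|now left]. apply Rmult_eq_reg_l in x1; [|exact Hk]. apply Rmult_eq_reg_l in x2; [|exact Hk].
    apply Cx_eq; lra.
  - assert (N : k * (k - k') <> 0) by (apply Rmult_integral_contrapositive_currified; lra).
    apply Rmult_integral in z1. apply Rmult_integral in z2.
    assert (w1 : cre w = cre alpha) by (destruct z1; [contradiction|lra]).
    assert (w2 : cim w = cim alpha) by (destruct z2; [contradiction|lra]).
    rewrite w1, Rminus_diag, Rmult_0_r in x1. rewrite w2, Rminus_diag, Rmult_0_r in x2.
    symmetry in x1, x2. apply Rmult_integral in x1. apply Rmult_integral in x2.
    split; [|right]; apply Cx_eq; lra.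
Qed.

Lemma ell_pos b : Cabs (Cadd Cone b) < 2 -> 0 < ell b.
Proof.
  intros H. apply sqrt_lt_R0.
  pose proof (Cabs_nonneg (Cadd Cone b)). pose proof (Cabs_sqr (Cadd Cone b)) as Q.
  unfold Cnormsq in *. simpl in *. nra.
Qed.

(* A rotational structure has the same axis as the helicoidal one, whether or not
   the orbit of the real axis degenerates to a vertical line. *)
Lemma rotational_iff b f U : Cabs (Cadd Cone b) < 2 -> (forall x : R, U (Cr x)) ->
  Equivariant f U (fun t => helic (alpha_of b) (pitch b) (2 * ell b * t)) ->
  (Rotational f U <-> pitch_num b = 0).
Proof.
  intros Hb HU HE. pose proof (ell_pos b Hb) as lp. split.
  - intros (al & k & Hk & HR).
    set (l := ell b) in *.
    assert (T : forall t, act (helic (alpha_of b) (pitch b) (2 * l * t)) (f (Cr 0)) = act (helic al 0 (k * t)) (f (Cr 0))).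
    { intros t. rewrite <- HE, <- HR by (try apply HU; unfold Cplus_real; rewrite <- Cr_add; apply HU). reflexivity. }
    destruct (helic_orbit_axis (alpha_of b) al (2 * l) k (hor (f (Cr 0)))) as [Ha Hc].
    { lra. } { exact Hk. }
    { intros t. rewrite <- !hor_helic with (c := 0), <- T. rewrite !hor_helic. reflexivity. }
    specialize (T 1). rewrite <- Ha in T. apply (f_equal p3) in T.
    assert (P0 : pitch b = 0).
    { unfold act, helic, nil_mul, p1, p2, p3 in T. cbn [fst snd] in T.
      destruct Hc as [Hc|Hc].
      - rewrite <- Hc in T. rewrite !Rmult_1_r in T.
        assert (Q : pitch b * (2 * l) = 0) by lra. apply Rmult_integral in Q. lra.
      - rewrite <- Hc in T. unfold hor, p1, p2 in T. simpl in T.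
        destruct (f (Cr 0)) as [[x y] w]. unfold Cnormsq in T. simpl in T.
        rewrite !Rmult_1_r in T.
        (* On the axis the rotation fixes the horizontal point, and the correction from the group
           law cancels the sine term of [helic]. The height then changes by the pitch times the
           angle alone, whatever the speed. *)
        assert (V : forall s, - ((x * x + y * y) / 2) * sin s +
           / 2 * ((x * (1 + - cos s) - y * (0 + - sin s)) * (sin s * x + cos s * y) - (x * (0 + - sin s) + y * (1 + - cos s)) * (cos s * x - sin s * y)) = 0).
        { intros s. pose proof (sin2_cos2 s) as S. unfold Rsqr in S.
          transitivity (/ 2 * (x * x + y * y) * sin s * (1 - (sin s * sin s + cos s * cos s)) - / 2 * (x * x + y * y) * sin s * (1 - (sin s * sin s + cos s * cos s))); [|ring].
          rewrite S. assert (C : cos s * cos s = 1 - sin s * sin s) by lra. field_simplify. ring [C]. }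
        pose proof (V (2 * l)) as V1. pose proof (V k) as V2.
        assert (Q : pitch b * (2 * l) = 0) by lra. apply Rmult_integral in Q. lra. }
    unfold pitch in P0. fold l in P0.
    assert (L4 : 0 < l ^ 4) by (apply pow_lt; exact lp).
    apply (Rmult_eq_reg_r (-2 / l ^ 4)).
    + rewrite Rmult_0_l, <- P0. field. lra.
    + unfold Rdiv. apply Rmult_integral_contrapositive_currified; [lra|]. apply Rinv_neq_0_compat. lra.
  - intros H0. exists (alpha_of b), (2 * ell b). split; [lra|].
    assert (P0 : pitch b = 0) by (unfold pitch; rewrite H0; unfold Rdiv; ring).
    rewrite P0 in HE. exact HE.
Qed.

(** * Entire power series in the loop parameter *)

Definition fmaj (A K : R) (n : nat) : R := A * (K ^ n / INR (fact n)).

Lemma ex_series_fmaj A K : ex_series (fmaj A K).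
Proof.
  apply (ex_series_ext (fun n => scal A (K ^ n / INR (fact n)))); [intros; reflexivity|].
  apply (ex_series_scal A (fun n => K ^ n / INR (fact n))).
  exists (exp K). pose proof (is_exp_Reals K) as H. apply is_pseries_R in H.
  eapply is_series_ext; [|exact H]. intros n. simpl. unfold Rdiv. ring.
Qed.

Lemma fmaj_nonneg A K n : 0 <= A -> 0 <= K -> 0 <= fmaj A K n.
Proof.
  intros. unfold fmaj. apply Rmult_le_pos; [assumption|].
  apply Rdiv_le_0_compat; [now apply pow_le|apply INR_fact_lt_0].
Qed.
Lemma fmaj_mul A K B L n : fmaj A K n * (B * L ^ n) = fmaj (A * B) (K * L) n.
Proof. unfold fmaj. rewrite Rpow_mult_distr. unfold Rdiv. ring. Qed.
Lemma fmaj_le A K A' K' n : 0 <= A -> 0 <= K -> A <= A' -> K <= K' -> fmaj A K n <= fmaj A' K' n.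
Proof.
  intros. unfold fmaj. apply Rmult_le_compat; try lra.
  - apply Rdiv_le_0_compat; [now apply pow_le|apply INR_fact_lt_0].
  - apply Rmult_le_compat_r; [left; apply Rinv_0_lt_compat, INR_fact_lt_0|]. now apply pow_incr.
Qed.

(** Majorants A K^n / n! are stable under sums, shifts and geometric factors, so every power series
    with such coefficients is entire and can be recombined freely. *)
Definition Dom (u : nat -> Cx) : Prop :=
  exists A K, 0 <= A /\ 0 <= K /\ forall n, Cabs (u n) <= fmaj A K n.

Definition Csum (u : nat -> Cx) : Cx :=
  mkC (Series (fun n => cre (u n))) (Series (fun n => cim (u n))).

Lemma ex_series_dom (f : nat -> R) A K : (forall n, Rabs (f n) <= fmaj A K n) -> ex_series f.
Proof.
  intros H. apply (@ex_series_le R_AbsRing R_CompleteNormedModule f (fmaj A K)); [exact H|apply ex_series_fmaj].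
Qed.
Lemma Dom_re u : Dom u -> ex_series (fun n => cre (u n)).
Proof.
  intros (A & K & _ & _ & H). apply (ex_series_dom _ A K).
  intros n. eapply Rle_trans; [apply Cabs_cre|apply H].
Qed.
Lemma Dom_im u : Dom u -> ex_series (fun n => cim (u n)).
Proof.
  intros (A & K & _ & _ & H). apply (ex_series_dom _ A K).
  intros n. eapply Rle_trans; [apply Cabs_cim|apply H].
Qed.

Lemma Csum_ext u v : (forall n, u n = v n) -> Csum u = Csum v.
Proof. intros H. unfold Csum. f_equal; apply Series_ext; intros n; now rewrite H. Qed.
Lemma Csum_add u v : Dom u -> Dom v -> Csum (fun n => Cadd (u n) (v n)) = Cadd (Csum u) (Csum v).
Proof.
  intros Hu Hv. apply Cx_eq; simpl; apply Series_plus; auto using Dom_re, Dom_im.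
Qed.
Lemma Csum_scal c u : Dom u -> Csum (fun n => Cmul c (u n)) = Cmul c (Csum u).
Proof.
  intros Hu. pose proof (Dom_re _ Hu). pose proof (Dom_im _ Hu).
  apply Cx_eq; simpl.
  - rewrite (Series_minus (fun n => cre c * cre (u n)) (fun n => cim c * cim (u n))).
    + now rewrite !Series_scal_l.
    + now apply (ex_series_scal (cre c) (fun n => cre (u n))).
    + now apply (ex_series_scal (cim c) (fun n => cim (u n))).
  - rewrite (Series_plus (fun n => cre c * cim (u n)) (fun n => cim c * cre (u n))).
    + now rewrite !Series_scal_l.
    + now apply (ex_series_scal (cre c) (fun n => cim (u n))).
    + now apply (ex_series_scal (cim c) (fun n => cre (u n))).
Qed.
Lemma Csum_shift u : Dom u -> Csum u = Cadd (u 0%nat) (Csum (fun n => u (S n))).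
Proof.
  intros Hu. apply Cx_eq; simpl; apply Series_incr_1; auto using Dom_re, Dom_im.
Qed.
Lemma Csum_abs u A K : (forall n, Cabs (u n) <= fmaj A K n) -> Cabs (Csum u) <= 2 * Series (fmaj A K).
Proof.
  intros H. eapply Rle_trans; [apply Cabs_le_sum|]. simpl.
  assert (T : forall f : nat -> R, (forall n, Rabs (f n) <= fmaj A K n) -> Rabs (Series f) <= Series (fmaj A K)).
  { intros f Hf. eapply Rle_trans; [apply Series_Rabs|].
    - apply (ex_series_dom _ A K). intros n. now rewrite Rabs_Rabsolu.
    - apply Series_le; [|apply ex_series_fmaj]. intros n; split; [apply Rabs_pos|apply Hf]. }
  pose proof (T (fun n => cre (u n))) as T1. pose proof (T (fun n => cim (u n))) as T2.
  lapply T1; [intros T1'|intros n; eapply Rle_trans; [apply Cabs_cre|apply H]].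
  lapply T2; [intros T2'|intros n; eapply Rle_trans; [apply Cabs_cim|apply H]].
  lra.
Qed.

Lemma Dom_add u v : Dom u -> Dom v -> Dom (fun n => Cadd (u n) (v n)).
Proof.
  intros (A & K & a0 & k0 & H) (B & L & b0 & l0 & G). exists (A + B), (Rmax K L).
  pose proof (Rmax_l K L). pose proof (Rmax_r K L).
  split; [lra|]. split; [lra|]. intros n. eapply Rle_trans; [apply Cabs_add|].
  replace (fmaj (A + B) (Rmax K L) n) with (fmaj A (Rmax K L) n + fmaj B (Rmax K L) n) by (unfold fmaj; ring).
  apply Rplus_le_compat; [eapply Rle_trans; [apply H|]|eapply Rle_trans; [apply G|]]; apply fmaj_le; lra.
Qed.
Lemma Dom_geo u v B L : 0 <= B -> 0 <= L -> (forall n, Cabs (v n) <= B * L ^ n) -> Dom u ->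
  Dom (fun n => Cmul (v n) (u n)).
Proof.
  intros b0 l0 G (A & K & a0 & k0 & H). exists (A * B), (K * L).
  split; [now apply Rmult_le_pos|]. split; [now apply Rmult_le_pos|]. intros n.
  rewrite Cabs_mul, <- fmaj_mul, Rmult_comm.
  apply Rmult_le_compat; auto using Cabs_nonneg.
Qed.
Lemma Dom_scal c u : Dom u -> Dom (fun n => Cmul c (u n)).
Proof.
  apply (Dom_geo u (fun _ => c) (Cabs c) 1); [apply Cabs_nonneg|lra|].
  intros n. rewrite pow1. lra.
Qed.
Lemma Dom_shift u : Dom u -> Dom (fun n => u (S n)).
Proof.
  intros (A & K & a0 & k0 & H). exists (A * K), K.
  split; [now apply Rmult_le_pos|]. split; [exact k0|]. intros n.
  eapply Rle_trans; [apply H|]. unfold fmaj. rewrite Rmult_assoc.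
  apply Rmult_le_compat_l; [exact a0|].
  simpl pow. unfold Rdiv. rewrite Rmult_assoc. apply Rmult_le_compat_l; [exact k0|].
  apply Rmult_le_compat_l; [now apply pow_le|].
  apply Rinv_le_contravar; [apply INR_fact_lt_0|].
  apply le_INR. simpl. lia.
Qed.

Fixpoint Cpow (w : Cx) (n : nat) : Cx := match n with O => Cone | S k => Cmul w (Cpow w k) end.

Lemma Cabs_Cone : Cabs Cone = 1.
Proof. change Cone with (Cr 1). now rewrite Cabs_Cr, Rabs_R1. Qed.
Lemma Cabs_pow w n : Cabs (Cpow w n) = Cabs w ^ n.
Proof. induction n as [|n IH]; simpl; [apply Cabs_Cone|now rewrite Cabs_mul, IH]. Qed.
Lemma Cpow_opp w n : Cpow (Copp w) n = Cmul (Cpow (Copp Cone) n) (Cpow w n).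
Proof. induction n as [|n IH]; simpl; [ring|rewrite IH; ring]. Qed.

Definition CPS (c : nat -> Cx) (w : Cx) : Cx := Csum (fun n => Cmul (Cpow w n) (c n)).
Definition CPSd (c : nat -> Cx) (n : nat) : Cx := Cmul (Cr (INR (S n))) (c (S n)).

Lemma Dom_CPS c w : Dom c -> Dom (fun n => Cmul (Cpow w n) (c n)).
Proof.
  apply (Dom_geo c (Cpow w) 1 (Cabs w)); [lra|apply Cabs_nonneg|].
  intros n. rewrite Cabs_pow. lra.
Qed.

Lemma INR_le_pow2 n : INR n <= 2 ^ n.
Proof.
  induction n as [|n IH]; [simpl; lra|]. rewrite S_INR. simpl pow.
  pose proof (pow_R1_Rle 2 n ltac:(lra)). lra.
Qed.

Lemma Dom_INR c : Dom c -> Dom (fun n => Cmul (Cr (INR n)) (c n)).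
Proof.
  apply (Dom_geo c (fun n => Cr (INR n)) 1 2); [lra|lra|].
  intros n. rewrite Cabs_Cr, Rabs_pos_eq by apply pos_INR. rewrite Rmult_1_l. apply INR_le_pow2.
Qed.
Lemma Dom_CPSd c : Dom c -> Dom (CPSd c).
Proof. intros H. apply (Dom_shift (fun n => Cmul (Cr (INR n)) (c n))), Dom_INR, H. Qed.

(** The remainder of w^n beyond first order. The value [pred 0 = 0] is harmless, since its
    coefficient [INR 0] is zero. *)
Definition pow_err (w h : Cx) (n : nat) : Cx :=
  Csub (Csub (Cpow (Cadd w h) n) (Cpow w n)) (Cmul (Cmul (Cr (INR n)) (Cpow w (pred n))) h).

(** Induction through err(n+1) = (w + h) err(n) + n w^(n-1) h^2. *)
Lemma pow_err_bound w h X n : Cabs w <= X -> Cabs (Cadd w h) <= X -> 1 <= X ->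
  Cabs (pow_err w h n) <= (INR n * INR n * X ^ n) * (Cabs h * Cabs h).
Proof.
  intros Hw Hwh HX. pose proof (Cabs_nonneg h) as h0.
  assert (hh : 0 <= Cabs h * Cabs h) by now apply Rmult_le_pos.
  induction n as [|n IH].
  - replace (pow_err w h 0) with (Cr 0) by (unfold pow_err; simpl; change (Cr 0) with Czero; ring).
    rewrite Cabs_Cr, Rabs_R0. simpl. lra.
  - assert (E : pow_err w h (S n) = Cadd (Cmul (Cadd w h) (pow_err w h n))
       (Cmul (Cmul (Cr (INR n)) (Cpow w (pred n))) (Cmul h h))).
    { unfold pow_err. rewrite S_INR. destruct n as [|k].
      - simpl. change (Cr 0) with Czero. replace (Cr (0 + 1)) with Cone by cx_solve. ring.
      - simpl pred. simpl Cpow. rewrite Cr_add. change (Cr 1) with Cone. ring. }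
    rewrite E. eapply Rle_trans; [apply Cabs_add|]. rewrite !Cabs_mul, Cabs_Cr, Cabs_pow.
    rewrite (Rabs_pos_eq (INR n)) by apply pos_INR. rewrite S_INR.
    pose proof (pos_INR n) as n0. pose proof (Cabs_nonneg w) as w0.
    assert (Xn : 1 <= X ^ n) by now apply pow_R1_Rle.
    assert (P : Cabs w ^ pred n <= X ^ n).
    { apply Rle_trans with (X ^ pred n); [now apply pow_incr|]. apply Rle_pow; [exact HX|lia]. }
    assert (B1 : Cabs (Cadd w h) * Cabs (pow_err w h n) <= X * ((INR n * INR n * X ^ n) * (Cabs h * Cabs h)))
      by (apply Rmult_le_compat; auto using Cabs_nonneg).
    assert (B2 : INR n * Cabs w ^ pred n * (Cabs h * Cabs h) <= INR n * X ^ n * (Cabs h * Cabs h))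
      by (apply Rmult_le_compat_r; [exact hh|]; now apply Rmult_le_compat_l).
    simpl pow.
    assert (B3 : INR n * X ^ n <= INR n * (X * X ^ n)).
    { apply Rmult_le_compat_l; [exact n0|]. nra. }
    assert (B4 : 0 <= (INR n + 1) * (X * X ^ n)) by (apply Rmult_le_pos; nra).
    apply Rle_trans with ((X * (INR n * INR n * X ^ n) + INR n * X ^ n) * (Cabs h * Cabs h)); [lra|].
    apply Rmult_le_compat_r; [exact hh|]. nra.
Qed.

(** A quadratic remainder, uniform for |h| <= 1. It yields both complex differentiability and the
    chain rule along real curves. *)
Lemma CPS_second_order c w : Dom c -> exists C, 0 <= C /\ forall h, Cabs h <= 1 ->
  Cabs (Csub (Csub (CPS c (Cadd w h)) (CPS c w)) (Cmul (CPS (CPSd c) w) h)) <= C * (Cabs h * Cabs h).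
Proof.
  intros Hc. pose proof Hc as (A & K & a0 & k0 & H).
  set (X := Cabs w + 1). assert (X1 : 1 <= X) by (unfold X; pose proof (Cabs_nonneg w); lra).
  assert (KX : 0 <= K * (4 * X)) by (apply Rmult_le_pos; lra).
  (* From n <= 2^n one gets n^2 X^n <= (4 X)^n; the factor 2 comes from bounding real and imaginary
     parts separately. *)
  exists (2 * Series (fmaj A (K * (4 * X)))). split.
  { assert (0 <= Series (fmaj A (K * (4 * X)))); [|lra].
    replace 0 with (Series (fun n => 0 * fmaj A (K * (4 * X)) n)).
    - apply Series_le; [|apply ex_series_fmaj]. intros n. pose proof (fmaj_nonneg A _ n a0 KX). lra.
    - rewrite Series_scal_l. ring. }
  intros h Hh.
  assert (D3 : Dom (fun n => Cmul (Cmul (Cmul (Cr (INR n)) (Cpow w (pred n))) h) (c n))).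
  { apply (Dom_geo c _ (Cabs h * 1) (2 * X)); [pose proof (Cabs_nonneg h); lra|lra| |exact Hc].
    intros n. rewrite !Cabs_mul, Cabs_Cr, Cabs_pow, Rabs_pos_eq by apply pos_INR.
    rewrite Rmult_1_r, Rmult_comm. apply Rmult_le_compat_l; [apply Cabs_nonneg|].
    rewrite Rpow_mult_distr. apply Rmult_le_compat; [apply pos_INR|apply pow_le, Cabs_nonneg|apply INR_le_pow2|].
    apply Rle_trans with (X ^ pred n); [apply pow_incr; split; [apply Cabs_nonneg|unfold X; lra]|].
    apply Rle_pow; [exact X1|lia]. }
  assert (E : Csub (Csub (CPS c (Cadd w h)) (CPS c w)) (Cmul (CPS (CPSd c) w) h)
     = Csum (fun n => Cmul (pow_err w h n) (c n))).
  { assert (E1 : Cmul (CPS (CPSd c) w) h = Csum (fun n => Cmul (Cmul (Cmul (Cr (INR n)) (Cpow w (pred n))) h) (c n))).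
    { rewrite (Csum_shift (fun n => Cmul (Cmul (Cmul (Cr (INR n)) (Cpow w (pred n))) h) (c n))).
      - simpl INR at 1. simpl pred. unfold CPS.
        replace (Cmul (Csum (fun n => Cmul (Cpow w n) (CPSd c n))) h) with (Cmul h (Csum (fun n => Cmul (Cpow w n) (CPSd c n)))) by ring.
        rewrite <- Csum_scal by apply Dom_CPS, Dom_CPSd, Hc.
        rewrite (Csum_ext (fun n => Cmul h (Cmul (Cpow w n) (CPSd c n)))
           (fun n => Cmul (Cmul (Cmul (Cr (INR (S n))) (Cpow w n)) h) (c (S n)))).
        + change (Cr 0) with Czero. ring.
        + intros n. unfold CPSd. ring.
      - exact D3. }
    rewrite E1. unfold CPS.
    assert (D1 := Dom_CPS c (Cadd w h) Hc). assert (D2 := Dom_CPS c w Hc).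
    transitivity (Cadd (Csum (fun n => Cmul (Cpow (Cadd w h) n) (c n)))
       (Cadd (Cmul (Copp Cone) (Csum (fun n => Cmul (Cpow w n) (c n))))
         (Cmul (Copp Cone) (Csum (fun n => Cmul (Cmul (Cmul (Cr (INR n)) (Cpow w (pred n))) h) (c n)))))); [ring|].
    rewrite <- !Csum_scal, <- !Csum_add by (auto using Dom_scal, Dom_add).
    apply Csum_ext. intros n. unfold pow_err. ring. }
  rewrite E. clear E.
  assert (Hwh : Cabs (Cadd w h) <= X) by (eapply Rle_trans; [apply Cabs_add|unfold X; lra]).
  pose proof (Cabs_nonneg h) as h0.
  eapply Rle_trans.
  - apply (Csum_abs _ (A * (Cabs h * Cabs h)) (K * (4 * X))).
    intros n. rewrite Cabs_mul, Rmult_comm, <- fmaj_mul.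
    apply Rmult_le_compat; [apply Cabs_nonneg|apply Cabs_nonneg|apply H|].
    eapply Rle_trans; [apply (pow_err_bound w h X n); [unfold X; lra|exact Hwh|exact X1]|].
    rewrite Rmult_comm. apply Rmult_le_compat_l; [now apply Rmult_le_pos|].
    replace (4 * X) with (2 * 2 * X) by ring. rewrite !Rpow_mult_distr.
    apply Rmult_le_compat_r; [apply pow_le; lra|].
    apply Rmult_le_compat; auto using pos_INR, INR_le_pow2.
  - apply Req_le. rewrite (Series_ext (fmaj (A * (Cabs h * Cabs h)) (K * (4 * X))) (fun n => (Cabs h * Cabs h) * fmaj A (K * (4 * X)) n))
      by (intros n; unfold fmaj; ring).
    rewrite Series_scal_l. ring.
Qed.

Lemma CPS_Cdiff c w : Dom c -> Cdiff_at (CPS c) w.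
Proof.
  intros Hc. destruct (CPS_second_order c w Hc) as (C & C0 & H).
  exists (CPS (CPSd c) w). intros eps He. exists (Rmin 1 (eps / (C + 1))).
  assert (E0 : 0 < eps / (C + 1)) by (apply Rdiv_lt_0_compat; lra).
  split; [apply Rmin_glb_lt; lra|]. intros h [h0 hd].
  pose proof (Rmin_l 1 (eps / (C + 1))). pose proof (Rmin_r 1 (eps / (C + 1))).
  eapply Rle_trans; [apply H; lra|].
  assert (Q : Cabs h * (C + 1) <= eps) by (apply Rle_div_r; lra).
  rewrite <- Rmult_assoc. apply Rmult_le_compat_r; [lra|]. nra.
Qed.

Lemma Cdiff_Ccont g w : Cdiff_at g w -> Ccont_disk_at g w.
Proof.
  intros H. apply Cdiff_at_le in H. destruct H as [L H]. intros eps He.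
  destruct (H 1 Rlt_0_1) as (d & Hd & H1). pose proof (Cabs_nonneg L) as L0.
  exists (Rmin d (eps / (Cabs L + 1))).
  assert (E0 : 0 < eps / (Cabs L + 1)) by (apply Rdiv_lt_0_compat; lra).
  split; [apply Rmin_glb_lt; lra|]. intros z _ Hz.
  specialize (H1 (Csub z w) (Rlt_le_trans _ _ _ Hz (Rmin_l _ _))).
  replace (Cadd w (Csub z w)) with z in H1 by ring.
  assert (Q : Cabs (Csub z w) * (Cabs L + 1) < eps).
  { apply Rlt_div_r; [lra|]. eapply Rlt_le_trans; [exact Hz|apply Rmin_r]. }
  replace (Csub (g z) (g w)) with (Cadd (Csub (Csub (g z) (g w)) (Cmul L (Csub z w))) (Cmul L (Csub z w))) by ring.
  eapply Rle_lt_trans; [apply Cabs_add|]. rewrite (Cabs_mul L). lra.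
Qed.

Lemma CPS_disk_holo c : Dom c -> disk_holo (CPS c).
Proof. intros H. split; intros; [|apply Cdiff_Ccont]; now apply CPS_Cdiff. Qed.

Lemma Cderiv_first_order (g : R -> Cx) t l : Cderiv_th g t l ->
  forall eps, 0 < eps -> exists d, 0 < d /\ forall s, Rabs s < d ->
    Cabs (Csub (Csub (g (t + s)) (g t)) (Cmul l (Cr s))) <= eps * Rabs s.
Proof.
  intros [H1 H2] eps He.
  destruct (deriv_first_order _ _ _ H1 (eps / 2)) as (d1 & D1 & K1); [lra|].
  destruct (deriv_first_order _ _ _ H2 (eps / 2)) as (d2 & D2 & K2); [lra|].
  exists (Rmin d1 d2). split; [now apply Rmin_glb_lt|]. intros s Hs.
  specialize (K1 s (Rlt_le_trans _ _ _ Hs (Rmin_l _ _))).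
  specialize (K2 s (Rlt_le_trans _ _ _ Hs (Rmin_r _ _))).
  eapply Rle_trans; [apply Cabs_le_sum|]. simpl.
  replace (cre (g (t + s)) + - cre (g t) + - (cre l * s - cim l * 0)) with (cre (g (t + s)) - cre (g t) - cre l * s) by ring.
  replace (cim (g (t + s)) + - cim (g t) + - (cre l * 0 + cim l * s)) with (cim (g (t + s)) - cim (g t) - cim l * s) by ring.
  lra.
Qed.

Lemma Cderiv_from_first_order (g : R -> Cx) t l :
  (forall eps, 0 < eps -> exists d, 0 < d /\ forall s, Rabs s < d ->
    Cabs (Csub (Csub (g (t + s)) (g t)) (Cmul l (Cr s))) <= eps * Rabs s) -> Cderiv_th g t l.
Proof.
  intros H. split; intros eps He; destruct (H (eps / 2)) as (d & Hd & H1); try lra;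
    exists (mkposreal d Hd); intros h hn hd; specialize (H1 h hd).
  - replace ((cre (g (t + h)) - cre (g t)) / h - cre l)
      with (cre (Csub (Csub (g (t + h)) (g t)) (Cmul l (Cr h))) / h) by (simpl; field; exact hn).
    unfold Rdiv. rewrite Rabs_mult, Rabs_inv. pose proof (Rabs_pos_lt _ hn).
    apply Rlt_div_l; [assumption|]. eapply Rle_lt_trans; [apply Cabs_cre|]. nra.
  - replace ((cim (g (t + h)) - cim (g t)) / h - cim l)
      with (cim (Csub (Csub (g (t + h)) (g t)) (Cmul l (Cr h))) / h) by (simpl; field; exact hn).
    unfold Rdiv. rewrite Rabs_mult, Rabs_inv. pose proof (Rabs_pos_lt _ hn).
    apply Rlt_div_l; [assumption|]. eapply Rle_lt_trans; [apply Cabs_cim|]. nra.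
Qed.

Lemma Cderiv_CPS_comp c (g : R -> Cx) t l : Dom c -> Cderiv_th g t l ->
  Cderiv_th (fun s => CPS c (g s)) t (Cmul (CPS (CPSd c) (g t)) l).
Proof.
  intros Hc Hg. apply Cderiv_from_first_order. intros eps He.
  destruct (CPS_second_order c (g t) Hc) as (C & C0 & H).
  set (P := CPS (CPSd c) (g t)). pose proof (Cabs_nonneg P) as P0. pose proof (Cabs_nonneg l) as l0.
  set (e := eps / (2 * (Cabs P + 1))).
  assert (e0 : 0 < e) by (apply Rdiv_lt_0_compat; lra).
  destruct (Cderiv_first_order g t l Hg (Rmin e 1)) as (d & Hd & H1); [apply Rmin_glb_lt; lra|].
  set (T := (C + 1) * (Cabs l + 1) * (Cabs l + 1)).
  assert (T0 : 0 < T) by (unfold T; repeat apply Rmult_lt_0_compat; lra).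
  exists (Rmin d (Rmin (/ (Cabs l + 1)) (eps / (2 * T)))).
  assert (I0 : 0 < / (Cabs l + 1)) by (apply Rinv_0_lt_compat; lra).
  assert (I1 : 0 < eps / (2 * T)) by (apply Rdiv_lt_0_compat; lra).
  split; [repeat apply Rmin_glb_lt; assumption|]. intros s Hs.
  assert (s1 : Rabs s < d) by (eapply Rlt_le_trans; [exact Hs|apply Rmin_l]).
  assert (s2 : Rabs s < / (Cabs l + 1)).
  { eapply Rlt_le_trans; [exact Hs|]. eapply Rle_trans; [apply Rmin_r|apply Rmin_l]. }
  assert (s3 : Rabs s < eps / (2 * T)).
  { eapply Rlt_le_trans; [exact Hs|]. eapply Rle_trans; [apply Rmin_r|apply Rmin_r]. }
  specialize (H1 s s1). set (h := Csub (g (t + s)) (g t)) in *.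
  pose proof (Rabs_pos s) as s0.
  pose proof (Rmin_l e 1) as m1. pose proof (Rmin_r e 1) as m2.
  assert (hb : Cabs h <= (Cabs l + 1) * Rabs s).
  { replace h with (Cadd (Csub h (Cmul l (Cr s))) (Cmul l (Cr s))) by ring.
    eapply Rle_trans; [apply Cabs_add|]. rewrite (Cabs_mul l), Cabs_Cr. nra. }
  assert (h1 : Cabs h <= 1).
  { eapply Rle_trans; [exact hb|]. apply Rmult_le_reg_l with (/ (Cabs l + 1)); [exact I0|].
    rewrite <- Rmult_assoc, Rinv_l by lra. lra. }
  specialize (H h h1). replace (Cadd (g t) h) with (g (t + s)) in H by (unfold h; ring). fold P in H.
  replace (Csub (Csub (CPS c (g (t + s))) (CPS c (g t))) (Cmul (Cmul P l) (Cr s)))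
    with (Cadd (Csub (Csub (CPS c (g (t + s))) (CPS c (g t))) (Cmul P h)) (Cmul P (Csub h (Cmul l (Cr s))))) by ring.
  eapply Rle_trans; [apply Cabs_add|]. rewrite (Cabs_mul P).
  assert (B1 : C * (Cabs h * Cabs h) <= eps / 2 * Rabs s).
  { apply Rle_trans with (T * Rabs s * Rabs s).
    - unfold T. pose proof (Cabs_nonneg h).
      assert (Cabs h * Cabs h <= ((Cabs l + 1) * Rabs s) * ((Cabs l + 1) * Rabs s)) by (apply Rmult_le_compat; lra).
      assert (0 <= Cabs h * Cabs h) by now apply Rmult_le_pos.
      apply Rle_trans with ((C + 1) * (((Cabs l + 1) * Rabs s) * ((Cabs l + 1) * Rabs s))); [|apply Req_le; ring].
      apply Rmult_le_compat; lra.
    - apply Rmult_le_compat_r; [exact s0|].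
      apply Rlt_div_r in s3; [|lra]. lra. }
  assert (B2 : Cabs P * Cabs (Csub h (Cmul l (Cr s))) <= eps / 2 * Rabs s).
  { apply Rle_trans with (Cabs P * (e * Rabs s)).
    - apply Rmult_le_compat_l; [exact P0|]. eapply Rle_trans; [exact H1|]. now apply Rmult_le_compat_r.
    - rewrite <- Rmult_assoc. apply Rmult_le_compat_r; [exact s0|].
      assert (Q : e * (2 * (Cabs P + 1)) = eps) by (unfold e; field; lra). lra. }
  lra.
Qed.

Lemma series_tail_small (M : nat -> R) : ex_series M -> forall eps, 0 < eps -> exists N, forall n, (N <= n)%nat ->
  Series (fun k => M (S n + k)%nat) < eps.
Proof.
  intros HM eps He. pose proof (Series_correct _ HM) as H.
  apply is_series_Reals in H. destruct (H eps He) as [N HN]. exists N. intros n Hn.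
  specialize (HN n Hn). unfold Rdist in HN.
  rewrite (Series_incr_n M (S n)) in HN; [|lia|exact HM]. simpl pred in HN.
  apply Rabs_lt_between in HN. lra.
Qed.

Lemma CVU_series (t : nat -> R -> R) (M : nat -> R) c (r : posreal) :
  ex_series M -> (forall n y, Boule c r y -> Rabs (t n y) <= M n) ->
  CVU (fun n y => sum_f_R0 (fun k => t k y) n) (fun y => Series (fun n => t n y)) c r.
Proof.
  intros HM Ht eps He. destruct (series_tail_small M HM eps He) as [N HN]. exists N.
  intros n y Hn Hy.
  assert (Ex : ex_series (fun n => t n y)).
  { apply (@ex_series_le R_AbsRing R_CompleteNormedModule _ M); [|exact HM]. intros k. exact (Ht k y Hy). }
  rewrite (Series_incr_n (fun n => t n y) (S n)); [|lia|exact Ex]. simpl pred.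
  replace (sum_f_R0 (fun k => t k y) n + Series (fun k => t (S n + k)%nat y) - sum_f_R0 (fun k => t k y) n)
    with (Series (fun k => t (S n + k)%nat y)) by ring.
  eapply Rle_lt_trans; [|apply (HN n Hn)].
  assert (ExM : ex_series (fun k => M (S n + k)%nat)) by now apply (ex_series_incr_n M (S n)).
  eapply Rle_trans; [apply Series_Rabs|].
  - apply (@ex_series_le R_AbsRing R_CompleteNormedModule _ (fun k => M (S n + k)%nat)); [|exact ExM].
    intros k. change (Rabs (Rabs (t (S n + k)%nat y)) <= M (S n + k)%nat). rewrite Rabs_Rabsolu. now apply Ht.
  - apply Series_le; [|exact ExM]. intros k. split; [apply Rabs_pos|now apply Ht].
Qed.

(** Termwise differentiation on a ball around c: the Weierstrass test makes both the series and its
    derived series converge uniformly there. *)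
Lemma series_derive (t t' : nat -> R -> R) (M M' : nat -> R) c (r : posreal) :
  ex_series M -> ex_series M' ->
  (forall n y, Boule c r y -> derivable_pt_lim (t n) y (t' n y)) ->
  (forall n y, Boule c r y -> continuity_pt (t' n) y) ->
  (forall n y, Boule c r y -> Rabs (t n y) <= M n) ->
  (forall n y, Boule c r y -> Rabs (t' n y) <= M' n) ->
  derivable_pt_lim (fun y => Series (fun n => t n y)) c (Series (fun n => t' n c)).
Proof.
  intros HM HM' HD HC HB HB'.
  assert (cc : Boule c r c) by (unfold Boule; rewrite Rminus_diag, Rabs_R0; apply cond_pos).
  apply (derivable_pt_lim_CVU (fun n y => sum_f_R0 (fun k => t k y) n) (fun n y => sum_f_R0 (fun k => t' k y) n)
    (fun y => Series (fun n => t n y)) (fun y => Series (fun n => t' n y)) c c r cc).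
  - intros y n Hy. induction n as [|n IH]; simpl; [now apply HD|].
    apply (derivable_pt_lim_plus (fun y => sum_f_R0 (fun k => t k y) n) (t (S n))); [exact IH|now apply HD].
  - intros y Hy.
    assert (Ex : ex_series (fun n => t n y)).
    { apply (@ex_series_le R_AbsRing R_CompleteNormedModule _ M); [|exact HM]. intros k. exact (HB k y Hy). }
    apply is_series_Reals, Series_correct, Ex.
  - now apply CVU_series with M'.
  - apply CVU_continuity with (fn := fun n y => sum_f_R0 (fun k => t' k y) n).
    + now apply CVU_series with M'.
    + intros n y Hy. induction n as [|n IH]; simpl; [now apply HC|].
      apply (continuity_pt_plus (fun y => sum_f_R0 (fun k => t' k y) n) (t' (S n))); [exact IH|now apply HC].
Qed.

(** * Iterated integrals with alternating weights *)

(** Picard iterates of an off-diagonal linear system: the two weights swap at each recursion, and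
    the first argument is the outermost weight. *)
Fixpoint iterint (wa wb : R -> R) (n : nat) : R -> R :=
  match n with
  | O => fun _ => 1
  | S k => fun x => RInt (fun y => wa y * iterint wb wa k y) 0 x
  end.

Lemma iterint_continuous wa wb n : (forall x, continuous wa x) -> (forall x, continuous wb x) ->
  forall x, continuous (iterint wa wb n) x.
Proof.
  revert wa wb. induction n as [|n IH]; intros wa wb Ha Hb x; simpl.
  - apply continuous_const.
  - apply (@ex_derive_continuous _ R_NormedModule). eexists.
    apply (@is_derive_RInt R_NormedModule (fun y => wa y * iterint wb wa n y) _ 0 x).
    + exists (mkposreal 1 Rlt_0_1). intros y _. apply (@RInt_correct R_CompleteNormedModule).
      apply (@ex_RInt_continuous R_CompleteNormedModule). intros z _.
      apply (continuous_mult wa (iterint wb wa n)); [apply Ha|now apply IH].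
    + apply (continuous_mult wa (iterint wb wa n)); [apply Ha|now apply IH].
Qed.

Lemma iterint_deriv wa wb n x : (forall x, continuous wa x) -> (forall x, continuous wb x) ->
  is_derive (iterint wa wb (S n)) x (wa x * iterint wb wa n x).
Proof.
  intros Ha Hb.
  assert (C : forall z, continuous (fun y => wa y * iterint wb wa n y) z).
  { intros z. apply (continuous_mult wa (iterint wb wa n)); [apply Ha|now apply iterint_continuous]. }
  simpl. apply (@is_derive_RInt R_NormedModule (fun y => wa y * iterint wb wa n y) _ 0 x); [|apply C].
  exists (mkposreal 1 Rlt_0_1). intros y _. apply (@RInt_correct R_CompleteNormedModule).
  apply (@ex_RInt_continuous R_CompleteNormedModule). intros z _. apply C.
Qed.

Lemma iterint_0 wa wb n : iterint wa wb (S n) 0 = 0.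
Proof. simpl. exact (@RInt_point R_CompleteNormedModule 0 (fun y => wa y * iterint wb wa n y)). Qed.

(** The mean value theorem applied to c x^(n+1)/(n+1) - sg F(x) with sg = 1 and sg = -1, whose
    derivative is nonnegative on [0, T]. *)
Lemma deriv_power_bound (F f : R -> R) c n T : 0 <= T ->
  (forall x, is_derive F x (f x)) -> F 0 = 0 ->
  (forall x, 0 <= x <= T -> Rabs (f x) <= c * x ^ n) ->
  forall x, 0 <= x <= T -> Rabs (F x) <= c / INR (S n) * x ^ (S n).
Proof.
  intros HT HF F0 Hf x Hx.
  assert (n0 : INR (S n) <> 0) by (apply not_0_INR; lia).
  assert (K : forall sg, sg = 1 \/ sg = -1 -> 0 <= c / INR (S n) * x ^ (S n) - sg * F x).
  { intros sg Hsg.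
    assert (D : forall y, is_derive (fun y => c / INR (S n) * y ^ (S n) - sg * F y) y (c * y ^ n - sg * f y)).
    { intros y. pose proof (HF y) as D. auto_derive; [exists (f y); exact D|].
      rewrite (is_derive_unique (fun x : R => F x) _ _ D). simpl pred.
      change (match n with 0%nat => 1 | S _ => INR n + 1 end) with (INR (S n)). field. exact n0. }
    destruct (MVT_gen (fun y => c / INR (S n) * y ^ (S n) - sg * F y) 0 x (fun y => c * y ^ n - sg * f y)) as [z [Hz E]].
    - intros y _. apply D.
    - intros y _. apply continuity_pt_filterlim.
      apply (@ex_derive_continuous _ R_NormedModule (fun y => c / INR (S n) * y ^ (S n) - sg * F y)). eexists; apply D.
    - rewrite F0 in E. rewrite Rmin_left, Rmax_right in Hz by lra.
      specialize (Hf z ltac:(lra)). apply Rabs_le_between in Hf.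
      assert (P : 0 <= (c * z ^ n - sg * f z) * (x - 0)) by (apply Rmult_le_pos; [destruct Hsg; subst; lra|lra]).
      rewrite pow_i in E by lia. lra. }
  pose proof (K 1 (or_introl eq_refl)). pose proof (K (-1) (or_intror eq_refl)).
  apply Rabs_le_between. lra.
Qed.

(** Each integration raises the power of x by one and divides by the new exponent, which builds the
    factorial. Negative x are treated by reflection. *)
Lemma iterint_bound wa wb W T n : 0 <= T -> (forall x, continuous wa x) -> (forall x, continuous wb x) ->
  (forall x, - T <= x <= T -> Rabs (wa x) <= W) -> (forall x, - T <= x <= T -> Rabs (wb x) <= W) ->
  forall x, - T <= x <= T -> Rabs (iterint wa wb n x) <= (W * Rabs x) ^ n / INR (fact n).
Proof.
  intros HT. revert wa wb.
  induction n as [|n IH]; intros wa wb Ha Hb Wa Wb x Hx.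
  - simpl. rewrite Rabs_R1. lra.
  - assert (W0 : 0 <= W) by (eapply Rle_trans; [apply Rabs_pos|apply (Wa 0); lra]).
    assert (fn : 0 < INR (fact n)) by apply INR_fact_lt_0.
    assert (Sn : 0 < INR (S n)) by (apply lt_0_INR; lia).
    set (c := W * (W ^ n / INR (fact n))).
    assert (B : forall y, - T <= y <= T -> Rabs (wa y * iterint wb wa n y) <= c * Rabs y ^ n).
    { intros y Hy. rewrite Rabs_mult. unfold c.
      replace (W * (W ^ n / INR (fact n)) * Rabs y ^ n) with (W * ((W * Rabs y) ^ n / INR (fact n)))
        by (rewrite Rpow_mult_distr; field; lra).
      apply Rmult_le_compat; try apply Rabs_pos; [now apply Wa|now apply IH]. }
    assert (E : forall u, c / INR (S n) * u ^ (S n) = (W * u) ^ (S n) / INR (fact (S n))).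
    { intros u. unfold c. rewrite fact_simpl, mult_INR, Rpow_mult_distr. simpl pow. field. lra. }
    rewrite <- E.
    destruct (Rle_dec 0 x) as [H0|H0].
    + rewrite (Rabs_pos_eq x H0).
      apply (deriv_power_bound (iterint wa wb (S n)) (fun y => wa y * iterint wb wa n y) c n T); try lra.
      * intros y. now apply iterint_deriv.
      * apply iterint_0.
      * intros y Hy. eapply Rle_trans; [apply B; lra|]. rewrite Rabs_pos_eq by lra. lra.
    + rewrite (Rabs_left x) by lra.
      pose proof (deriv_power_bound (fun y => iterint wa wb (S n) (- y)) (fun y => - (wa (- y) * iterint wb wa n (- y))) c n T HT) as P.
      replace (iterint wa wb (S n) x) with (iterint wa wb (S n) (- - x)) by (f_equal; ring).
      apply P; [| | |lra].
      * intros y. pose proof (iterint_deriv wa wb n (- y) Ha Hb) as D.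
        evar_last; [apply (is_derive_comp (iterint wa wb (S n)) (fun y => - y)); [exact D|auto_derive; [trivial|reflexivity]]|].
        unfold scal; simpl. unfold mult; simpl. ring.
      * rewrite Ropp_0. apply iterint_0.
      * intros y Hy. rewrite Rabs_Ropp. eapply Rle_trans; [apply B; lra|]. rewrite Rabs_Ropp, Rabs_pos_eq by lra. lra.
Qed.

(** * The factor V_+ as a power series in the loop parameter *)

Lemma continuous_bounded (w : R -> R) T : (forall x, continuous w x) -> 0 <= T ->
  exists W, forall x, - T <= x <= T -> Rabs (w x) <= W.
Proof.
  intros Hw HT. destruct (continuity_ab_maj (fun x => Rabs (w x)) (- T) T) as (m & Hm & _).
  - lra.
  - intros x _. apply continuity_pt_filterlim. apply (continuous_comp w Rabs); [apply Hw|].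
    apply continuity_pt_filterlim, Rcontinuity_abs.
  - now exists (Rabs (w m)).
Qed.

Definition gen (k : nat -> Cx) (wa wb : R -> R) (x : R) : Cx :=
  Csum (fun n => Cmul (k n) (Cr (iterint wa wb n x))).

Lemma Dom_iterint wa wb x : (forall x, continuous wa x) -> (forall x, continuous wb x) ->
  Dom (fun n => Cr (iterint wa wb n x)).
Proof.
  intros Ha Hb. pose proof (Rabs_pos x) as x0.
  destruct (continuous_bounded wa (Rabs x) Ha x0) as [W1 H1].
  destruct (continuous_bounded wb (Rabs x) Hb x0) as [W2 H2].
  assert (W0 : 0 <= Rmax W1 W2).
  { apply Rle_trans with (Rabs (wa 0)); [apply Rabs_pos|]. eapply Rle_trans; [apply H1; lra|apply Rmax_l]. }
  exists 1, (Rmax W1 W2 * Rabs x). split; [lra|]. split; [now apply Rmult_le_pos|].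
  intros n. rewrite Cabs_Cr. unfold fmaj. rewrite Rmult_1_l.
  apply (iterint_bound wa wb (Rmax W1 W2) (Rabs x)); try assumption.
  - intros y Hy. eapply Rle_trans; [now apply H1|apply Rmax_l].
  - intros y Hy. eapply Rle_trans; [now apply H2|apply Rmax_r].
  - apply Rabs_le_between. lra.
Qed.

(** Differentiating an iterated integral releases its outermost weight, hence the shift in k and the
    exchange of the weights. *)
Lemma gen_deriv k wa wb L x : (forall x, continuous wa x) -> (forall x, continuous wb x) ->
  0 <= L -> (forall n, Cabs (k n) <= L ^ n) ->
  Cderiv_th (gen k wa wb) x (Cmul (Cr (wa x)) (gen (fun n => k (S n)) wb wa x)).
Proof.
  intros Ha Hb HL Hk.
  set (T := Rabs x + 1). assert (T0 : 0 <= T) by (unfold T; pose proof (Rabs_pos x); lra).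
  destruct (continuous_bounded wa T Ha T0) as [W1 H1].
  destruct (continuous_bounded wb T Hb T0) as [W2 H2].
  set (W := Rmax W1 W2).
  assert (Wa : forall y, - T <= y <= T -> Rabs (wa y) <= W) by (intros; eapply Rle_trans; [now apply H1|apply Rmax_l]).
  assert (Wb : forall y, - T <= y <= T -> Rabs (wb y) <= W) by (intros; eapply Rle_trans; [now apply H2|apply Rmax_r]).
  assert (W0 : 0 <= W) by (eapply Rle_trans; [apply Rabs_pos|apply (Wa 0); lra]).
  assert (BT : forall y, Boule x (mkposreal 1 Rlt_0_1) y -> - T <= y <= T).
  { intros y Hy. unfold Boule in Hy. simpl in Hy. apply Rabs_le_between. unfold T.
    replace y with ((y - x) + x) by ring. eapply Rle_trans; [apply Rabs_triang|]. lra. }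
  assert (IB : forall ua ub n y, (forall x, continuous ua x) -> (forall x, continuous ub x) ->
     (forall y, - T <= y <= T -> Rabs (ua y) <= W) -> (forall y, - T <= y <= T -> Rabs (ub y) <= W) ->
     - T <= y <= T -> Rabs (iterint ua ub n y) <= fmaj 1 (W * T) n).
  { intros ua ub n y Ca Cb Ba Bb Hy. eapply Rle_trans; [apply (iterint_bound ua ub W T n T0 Ca Cb Ba Bb y Hy)|].
    unfold fmaj. rewrite Rmult_1_l. apply Rmult_le_compat_r; [left; apply Rinv_0_lt_compat, INR_fact_lt_0|].
    apply pow_incr. split; [apply Rmult_le_pos; [exact W0|apply Rabs_pos]|].
    apply Rmult_le_compat_l; [exact W0|]. now apply Rabs_le_between. }
  (* Derivative of the n-th iterated integral: the index drops by one, and the constant term n = 0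
     contributes nothing. *)
  set (dA := fun n y => match n with O => 0 | S m => wa y * iterint wb wa m y end).
  set (M := fmaj 1 (W * T * L)).
  set (M' := fun n => match n with O => 0 | S m => fmaj (W * L) (W * T * L) m end).
  assert (EM' : ex_series M').
  { apply ex_series_incr_1. apply ex_series_fmaj. }
  assert (Key : forall part : Cx -> R, (forall z, Rabs (part z) <= Cabs z) ->
    derivable_pt_lim (fun y => Series (fun n => part (k n) * iterint wa wb n y)) x
      (Series (fun n => part (k n) * dA n x))).
  { intros part Hp.
    apply (series_derive (fun n y => part (k n) * iterint wa wb n y) (fun n y => part (k n) * dA n y) M M' x (mkposreal 1 Rlt_0_1)).
    - apply ex_series_fmaj.
    - exact EM'.
    - intros [|n] y _; unfold dA.
      + rewrite Rmult_0_r. simpl. apply derivable_pt_lim_const.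
      + apply (derivable_pt_lim_scal (iterint wa wb (S n))). apply is_derive_Reals. now apply iterint_deriv.
    - intros [|n] y _; unfold dA.
      + apply continuity_pt_const. intros u v; reflexivity.
      + apply (continuity_pt_scal (fun y => wa y * iterint wb wa n y)). apply continuity_pt_filterlim.
        apply (continuous_mult wa (iterint wb wa n)); [apply Ha|now apply iterint_continuous].
    - intros n y Hy. rewrite Rabs_mult.
      apply Rle_trans with (L ^ n * fmaj 1 (W * T) n).
      + apply Rmult_le_compat; try apply Rabs_pos.
        * eapply Rle_trans; [apply Hp|apply Hk].
        * apply IB; auto.
      + apply Req_le. unfold M, fmaj. rewrite !Rpow_mult_distr. field. apply INR_fact_neq_0.
    - intros [|n] y Hy; unfold dA, M'.
      + rewrite Rmult_0_r, Rabs_R0. lra.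
      + rewrite !Rabs_mult.
        apply Rle_trans with (L ^ (S n) * (W * fmaj 1 (W * T) n)).
        * apply Rmult_le_compat; [apply Rabs_pos|apply Rmult_le_pos; apply Rabs_pos|eapply Rle_trans; [apply Hp|apply Hk]|].
          apply Rmult_le_compat; try apply Rabs_pos; [apply Wa; auto|apply IB; auto].
        * apply Req_le. unfold fmaj. rewrite !Rpow_mult_distr. simpl pow. field. apply INR_fact_neq_0. }
  assert (DB : Dom (fun n => Cmul (k (S n)) (Cr (iterint wb wa n x)))).
  { apply (Dom_geo _ (fun n => k (S n)) L L HL HL); [intros n; apply (Hk (S n))|now apply Dom_iterint]. }
  assert (Part : forall part : Cx -> R, (forall z y, part (Cmul z (Cr y)) = part z * y) ->
    (ex_series (fun n => part (Cmul (k (S n)) (Cr (iterint wb wa n x))))) ->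
    Series (fun n => part (k n) * dA n x) = wa x * Series (fun n => part (Cmul (k (S n)) (Cr (iterint wb wa n x))))).
  { intros part Hp Hex.
    assert (E : forall n, part (k (S n)) * dA (S n) x = wa x * part (Cmul (k (S n)) (Cr (iterint wb wa n x)))).
    { intros n. rewrite Hp. unfold dA. ring. }
    rewrite Series_incr_1.
    - unfold dA at 1. rewrite (Series_ext _ _ E), Series_scal_l. ring.
    - apply ex_series_incr_1. eapply ex_series_ext; [intros n; symmetry; apply E|].
      apply (ex_series_scal (wa x) (fun n => part (Cmul (k (S n)) (Cr (iterint wb wa n x))))). exact Hex. }
  split.
  - pose proof (Key cre Cabs_cre) as K.
    rewrite (Part cre) in K; [|intros; simpl; ring|exact (Dom_re _ DB)].
    apply is_derive_Reals. apply is_derive_Reals in K.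
    evar_last; [eapply is_derive_ext; [|exact K]; intros y; simpl; apply Series_ext; intros n; simpl; ring|].
    simpl. ring.
  - pose proof (Key cim Cabs_cim) as K.
    rewrite (Part cim) in K; [|intros; simpl; ring|exact (Dom_im _ DB)].
    apply is_derive_Reals. apply is_derive_Reals in K.
    evar_last; [eapply is_derive_ext; [|exact K]; intros y; simpl; apply Series_ext; intros n; simpl; ring|].
    simpl. ring.
Qed.

(** Coefficients that solve r' = i lambda bb wa s, s' = i lambda wb r with initial values (x0, y0)
    as series in lambda; each order in lambda passes from one unknown to the other. *)
Fixpoint coefs (bb x0 y0 : Cx) (n : nat) : Cx * Cx :=
  match n with
  | O => (x0, y0)
  | S k => (Cmul (Cmul Ci bb) (snd (coefs bb x0 y0 k)), Cmul Ci (fst (coefs bb x0 y0 k)))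
  end.

Lemma Cabs_Ci : Cabs Ci = 1.
Proof. unfold Cabs, Cnormsq; simpl. replace (0 * 0 + 1 * 1) with 1 by ring. apply sqrt_1. Qed.

Lemma coefs_bound bb x0 y0 n : Cabs x0 <= 1 -> Cabs y0 <= 1 ->
  Cabs (fst (coefs bb x0 y0 n)) <= (1 + Cabs bb) ^ n /\ Cabs (snd (coefs bb x0 y0 n)) <= (1 + Cabs bb) ^ n.
Proof.
  intros Hx Hy. pose proof (Cabs_nonneg bb) as b0.
  induction n as [|n [IH1 IH2]]; simpl; [split; assumption|].
  assert (P : 0 <= (1 + Cabs bb) ^ n) by (apply pow_le; lra).
  rewrite !Cabs_mul, Cabs_Ci, !Rmult_1_l. split.
  - apply Rmult_le_compat; try apply Cabs_nonneg; lra.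
  - nra.
Qed.

Definition rfun (wa wb : R -> R) (bb x0 y0 : Cx) (x : R) : Cx -> Cx :=
  CPS (fun n => Cmul (fst (coefs bb x0 y0 n)) (Cr (iterint wa wb n x))).
Definition sfun (wa wb : R -> R) (bb x0 y0 : Cx) (x : R) : Cx -> Cx :=
  CPS (fun n => Cmul (snd (coefs bb x0 y0 n)) (Cr (iterint wb wa n x))).

Lemma Dom_rcoef wa wb bb x0 y0 x : (forall x, continuous wa x) -> (forall x, continuous wb x) ->
  Cabs x0 <= 1 -> Cabs y0 <= 1 ->
  Dom (fun n => Cmul (fst (coefs bb x0 y0 n)) (Cr (iterint wa wb n x))).
Proof.
  intros Ha Hb Hx Hy. pose proof (Cabs_nonneg bb) as b0.
  apply (Dom_geo _ (fun n => fst (coefs bb x0 y0 n)) 1 (1 + Cabs bb)); [lra|lra| |now apply Dom_iterint].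
  intros n. rewrite Rmult_1_l. now apply coefs_bound.
Qed.
Lemma Dom_scoef wa wb bb x0 y0 x : (forall x, continuous wa x) -> (forall x, continuous wb x) ->
  Cabs x0 <= 1 -> Cabs y0 <= 1 ->
  Dom (fun n => Cmul (snd (coefs bb x0 y0 n)) (Cr (iterint wb wa n x))).
Proof.
  intros Ha Hb Hx Hy. pose proof (Cabs_nonneg bb) as b0.
  apply (Dom_geo _ (fun n => snd (coefs bb x0 y0 n)) 1 (1 + Cabs bb)); [lra|lra| |now apply Dom_iterint].
  intros n. rewrite Rmult_1_l. now apply coefs_bound.
Qed.

Lemma rfun_gen wa wb bb x0 y0 x lam :
  rfun wa wb bb x0 y0 x lam = gen (fun n => Cmul (Cpow lam n) (fst (coefs bb x0 y0 n))) wa wb x.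
Proof. unfold rfun, CPS, gen. apply Csum_ext. intros n. ring. Qed.
Lemma sfun_gen wa wb bb x0 y0 x lam :
  sfun wa wb bb x0 y0 x lam = gen (fun n => Cmul (Cpow lam n) (snd (coefs bb x0 y0 n))) wb wa x.
Proof. unfold sfun, CPS, gen. apply Csum_ext. intros n. ring. Qed.

Lemma gen_scal c k wa wb L x : (forall x, continuous wa x) -> (forall x, continuous wb x) ->
  0 <= L -> (forall n, Cabs (k n) <= L ^ n) ->
  gen (fun n => Cmul c (k n)) wa wb x = Cmul c (gen k wa wb x).
Proof.
  intros Ha Hb HL Hk. unfold gen. rewrite <- Csum_scal.
  - apply Csum_ext. intros n. ring.
  - apply (Dom_geo _ k 1 L); [lra|exact HL|intros n; rewrite Rmult_1_l; apply Hk|now apply Dom_iterint].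
Qed.

Lemma rsfun_deriv wa wb bb x0 y0 lam x : (forall x, continuous wa x) -> (forall x, continuous wb x) ->
  Cabs x0 <= 1 -> Cabs y0 <= 1 ->
  Cderiv_th (fun x => rfun wa wb bb x0 y0 x lam) x
    (Cmul (Cr (wa x)) (Cmul (Cmul lam (Cmul Ci bb)) (sfun wa wb bb x0 y0 x lam))) /\
  Cderiv_th (fun x => sfun wa wb bb x0 y0 x lam) x
    (Cmul (Cr (wb x)) (Cmul (Cmul lam Ci) (rfun wa wb bb x0 y0 x lam))).
Proof.
  intros Ha Hb Hx Hy.
  pose proof (Cabs_nonneg bb) as b0. pose proof (Cabs_nonneg lam) as l0.
  set (L := Cabs lam * (1 + Cabs bb)).
  assert (L0 : 0 <= L) by (apply Rmult_le_pos; lra).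
  assert (K1 : forall n, Cabs (Cmul (Cpow lam n) (fst (coefs bb x0 y0 n))) <= L ^ n).
  { intros n. unfold L. rewrite Cabs_mul, Cabs_pow, Rpow_mult_distr.
    apply Rmult_le_compat_l; [now apply pow_le|now apply coefs_bound]. }
  assert (K2 : forall n, Cabs (Cmul (Cpow lam n) (snd (coefs bb x0 y0 n))) <= L ^ n).
  { intros n. unfold L. rewrite Cabs_mul, Cabs_pow, Rpow_mult_distr.
    apply Rmult_le_compat_l; [now apply pow_le|now apply coefs_bound]. }
  split.
  - apply Cderiv_ext with (gen (fun n => Cmul (Cpow lam n) (fst (coefs bb x0 y0 n))) wa wb);
      [intros s; symmetry; apply rfun_gen|].
    rewrite sfun_gen, <- (gen_scal _ _ _ _ L x Hb Ha L0 K2).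
    replace (gen (fun n => Cmul (Cmul lam (Cmul Ci bb)) (Cmul (Cpow lam n) (snd (coefs bb x0 y0 n)))) wb wa x)
      with (gen (fun n => (fun n => Cmul (Cpow lam n) (fst (coefs bb x0 y0 n))) (S n)) wb wa x).
    + exact (gen_deriv _ wa wb L x Ha Hb L0 K1).
    + unfold gen. apply Csum_ext. intros n. cbn [coefs fst Cpow]. ring.
  - apply Cderiv_ext with (gen (fun n => Cmul (Cpow lam n) (snd (coefs bb x0 y0 n))) wb wa);
      [intros s; symmetry; apply sfun_gen|].
    rewrite rfun_gen, <- (gen_scal _ _ _ _ L x Ha Hb L0 K1).
    replace (gen (fun n => Cmul (Cmul lam Ci) (Cmul (Cpow lam n) (fst (coefs bb x0 y0 n)))) wa wb x)
      with (gen (fun n => (fun n => Cmul (Cpow lam n) (snd (coefs bb x0 y0 n))) (S n)) wa wb x).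
    + exact (gen_deriv _ wb wa L x Hb Ha L0 K2).
    + unfold gen. apply Csum_ext. intros n. cbn [coefs snd Cpow]. ring.
Qed.

Lemma CPS_const c w : Dom c -> (forall n, c (S n) = Czero) -> CPS c w = c 0%nat.
Proof.
  intros Hc H. unfold CPS. rewrite Csum_shift by now apply Dom_CPS.
  rewrite (Csum_ext _ (fun n => Cmul Czero (c (S n)))) by (intros n; rewrite H; ring).
  rewrite Csum_scal by now apply Dom_shift. simpl. ring.
Qed.
Lemma CPS_at_0 c : Dom c -> CPS c Czero = c 0%nat.
Proof.
  intros Hc. unfold CPS. rewrite Csum_shift by now apply Dom_CPS.
  rewrite (Csum_ext _ (fun n => Cmul Czero (c (S n)))) by (intros n; simpl; ring).
  rewrite Csum_scal by now apply Dom_shift. simpl. ring.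
Qed.
Lemma CPS_opp c w sg : Dom c -> (forall n, Cmul (Cpow (Copp Cone) n) (c n) = Cmul sg (c n)) ->
  CPS c (Copp w) = Cmul sg (CPS c w).
Proof.
  intros Hc H. unfold CPS. rewrite <- Csum_scal by now apply Dom_CPS.
  apply Csum_ext. intros n. rewrite Cpow_opp.
  transitivity (Cmul (Cpow w n) (Cmul (Cpow (Copp Cone) n) (c n))); [ring|]. rewrite H. ring.
Qed.

(* In the first column only even powers occur in r and odd ones in s, in the
   second column it is the other way round. *)
Lemma coefs_parity bb x0 y0 sg n : Cmul sg sg = Cone ->
  Cmul sg x0 = x0 -> Cmul (Copp sg) y0 = y0 ->
  Cmul (Cpow (Copp Cone) n) (fst (coefs bb x0 y0 n)) = Cmul sg (fst (coefs bb x0 y0 n)) /\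
  Cmul (Cpow (Copp Cone) n) (snd (coefs bb x0 y0 n)) = Cmul (Copp sg) (snd (coefs bb x0 y0 n)).
Proof.
  intros Hs Hx Hy. induction n as [|n [IH1 IH2]]; simpl.
  - rewrite Hx, Hy. split; ring.
  - split.
    + transitivity (Copp (Cmul (Cmul Ci bb) (Cmul (Cpow (Copp Cone) n) (snd (coefs bb x0 y0 n))))); [ring|].
      rewrite IH2. ring.
    + transitivity (Copp (Cmul Ci (Cmul (Cpow (Copp Cone) n) (fst (coefs bb x0 y0 n))))); [ring|].
      rewrite IH1. ring.
Qed.

(** * Iwasawa decomposition of exp(i y D) *)

(** The value of q^2 forced by isospectrality: det [Amat] must not depend on x, so q^2 - exp(-2x) -
    N exp(2x) keeps its initial value 3 - N, where q(0) = 2. *)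
Definition Qf (N x : R) : R := 3 - N + exp (- (2 * x)) + N * exp (2 * x).
Definition qf (N x : R) : R := sqrt (Qf N x).

(** Multiplied by e = exp(2x), this is the quadratic N e^2 + (3 - N) e + 1. For N <= 3 no
    coefficient is negative; for 3 < N < 9 the discriminant (N - 1)(N - 9) is negative. *)
Lemma Qf_pos N x : 0 <= N < 9 -> 0 < Qf N x.
Proof.
  intros HN. unfold Qf. rewrite exp_Ropp. pose proof (exp_pos (2 * x)) as E.
  set (e := exp (2 * x)) in *.
  apply (Rmult_lt_reg_r e); [exact E|]. rewrite Rmult_0_l.
  replace ((3 - N + / e + N * e) * e) with (N * e * e + (3 - N) * e + 1) by (field; lra).
  destruct (Rle_dec N 3) as [H|H].
  - assert (0 <= N * (e * e)) by (apply Rmult_le_pos; nra). nra.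
  - apply (Rmult_lt_reg_l (4 * N)); [lra|]. rewrite Rmult_0_r.
    replace (4 * N * (N * e * e + (3 - N) * e + 1)) with ((2 * N * e + (3 - N)) * (2 * N * e + (3 - N)) + (N - 1) * (9 - N)) by ring.
    pose proof (Rle_0_sqr (2 * N * e + (3 - N))) as S. unfold Rsqr in S. nra.
Qed.
Lemma qf_pos N x : 0 <= N < 9 -> 0 < qf N x.
Proof. intros H. now apply sqrt_lt_R0, Qf_pos. Qed.
Lemma qf_0 N : qf N 0 = 2.
Proof.
  unfold qf, Qf. rewrite Rmult_0_r, Ropp_0, exp_0. replace (3 - N + 1 + N * 1) with (2 * 2) by ring.
  apply sqrt_square. lra.
Qed.
Lemma qf_deriv N x : 0 <= N < 9 ->
  is_derive (qf N) x ((N * exp (2 * x) - exp (- (2 * x))) / qf N x).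
Proof.
  intros H. pose proof (Qf_pos N x H) as P. pose proof (qf_pos N x H) as P'. unfold qf, Qf in *.
  auto_derive; [exact P|]. field. lra.
Qed.
(** [w1f] and [w2f] are the weights left in the off-diagonal of [etaM] once its diagonal -1/2, 1/2
    has been absorbed into the factors exp(-x/2), exp(x/2) of [Vplus]. *)
Definition w1f (N x : R) : R := exp (2 * x) / qf N x.
Definition w2f (N x : R) : R := exp (- (2 * x)) / qf N x.
Lemma w1f_continuous N : 0 <= N < 9 -> forall x, continuous (w1f N) x.
Proof.
  intros H x. pose proof (qf_pos N x H). apply (@ex_derive_continuous _ R_NormedModule).
  pose proof (qf_deriv N x H) as D. unfold w1f. auto_derive. split; [eexists; exact D|lra].
Qed.
Lemma w2f_continuous N : 0 <= N < 9 -> forall x, continuous (w2f N) x.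
Proof.
  intros H x. pose proof (qf_pos N x H). apply (@ex_derive_continuous _ R_NormedModule).
  pose proof (qf_deriv N x H) as D. unfold w2f. auto_derive. split; [eexists; exact D|lra].
Qed.

(* The imaginary part y of z as a function of the logarithm x of the metric factor:
   dy/dx = 1 / (2 q), which integrates the elliptic equation for x(y). *)
Definition Yf (N x : R) : R := RInt (fun u => / (2 * qf N u)) 0 x.

Lemma Yf_integrand_continuous N : 0 <= N < 9 -> forall x, continuous (fun u => / (2 * qf N u)) x.
Proof.
  intros H x. pose proof (qf_pos N x H). apply (@ex_derive_continuous _ R_NormedModule).
  pose proof (qf_deriv N x H) as D. auto_derive. split; [eexists; exact D|]. lra.
Qed.
Lemma Yf_deriv N x : 0 <= N < 9 -> is_derive (Yf N) x (/ (2 * qf N x)).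
Proof.
  intros H. apply (@is_derive_RInt R_NormedModule (fun u => / (2 * qf N u)) _ 0 x); [|now apply Yf_integrand_continuous].
  exists (mkposreal 1 Rlt_0_1). intros y _. apply (@RInt_correct R_CompleteNormedModule).
  apply (@ex_RInt_continuous R_CompleteNormedModule). intros z _. now apply Yf_integrand_continuous.
Qed.
Lemma Yf_0 N : Yf N 0 = 0.
Proof. exact (@RInt_point R_CompleteNormedModule 0 (fun u => / (2 * qf N u))). Qed.

Lemma Yf_increasing N x y : 0 <= N < 9 -> x < y -> Yf N x < Yf N y.
Proof.
  intros H Hxy.
  destruct (MVT_gen (Yf N) x y (fun u => / (2 * qf N u))) as [z [_ E]].
  - intros u _. now apply Yf_deriv.
  - intros u _. apply continuity_pt_filterlim. apply (@ex_derive_continuous _ R_NormedModule).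
    eexists. now apply Yf_deriv.
  - pose proof (qf_pos N z H). assert (0 < / (2 * qf N z)) by (apply Rinv_0_lt_compat; lra).
    assert (0 < / (2 * qf N z) * (y - x)) by (apply Rmult_lt_0_compat; lra). lra.
Qed.

Lemma Yf_surjective N : 0 <= N < 9 -> exists eps, 0 < eps /\ forall y, Rabs y < eps -> exists x, Yf N x = y.
Proof.
  intros H. pose proof (Yf_increasing N 0 1 H Rlt_0_1) as H1.
  pose proof (Yf_increasing N (-1) 0 H ltac:(lra)) as H2. rewrite Yf_0 in H1, H2.
  exists (Rmin (Yf N 1) (- Yf N (-1))). split; [apply Rmin_glb_lt; lra|].
  intros y Hy. pose proof (Rmin_l (Yf N 1) (- Yf N (-1))). pose proof (Rmin_r (Yf N 1) (- Yf N (-1))).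
  apply Rabs_lt_between in Hy.
  destruct (IVT_gen (Yf N) (-1) 1 y) as [x [_ Hx]].
  - intros u. apply continuity_pt_filterlim. apply (@ex_derive_continuous _ R_NormedModule).
    eexists. now apply Yf_deriv.
  - rewrite Rmin_left, Rmax_right by lra. lra.
  - now exists x.
Qed.

Definition Vplus (b : Cx) (x : R) (lam : Cx) : M2 :=
  let N := Cnormsq b in
  let r x0 y0 := rfun (w1f N) (w2f N) (Cconj b) x0 y0 x lam in
  let s x0 y0 := sfun (w1f N) (w2f N) (Cconj b) x0 y0 x lam in
  mkM (Cmul (Cr (exp (- (x / 2)))) (r Cone Czero)) (Cmul (Cr (exp (- (x / 2)))) (r Czero Cone))
      (Cmul (Cr (exp (x / 2))) (s Cone Czero)) (Cmul (Cr (exp (x / 2))) (s Czero Cone)).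

(** The coefficient in V' = eta V: the diagonal of (i/2q) A plus twice its part of degree one in
    lambda. With this choice (i/2q) A - eta is su(1,1)-valued on the circle. *)
Definition etaM (b : Cx) (x : R) (lam : Cx) : M2 :=
  let q := qf (Cnormsq b) x in
  mkM (Cr (- / 2)) (Cmul (Cmul Ci lam) (Cmul (Cconj b) (Cr (exp x / q))))
      (Cmul (Cmul Ci lam) (Cr (exp (- x) / q))) (Cr (/ 2)).

(** The Lax matrix V_+ D V_+^-1. It is again a degree one potential, with exp(-x), b exp x and q in
    place of 1, b and 2. *)
Definition Amat (b : Cx) (x : R) (lam : Cx) : M2 :=
  let q := qf (Cnormsq b) x in
  mkM (Cmul Ci (Cr q)) (Cadd (Cmul (Cinv lam) (Cr (exp (- x)))) (Cmul lam (Cmul (Cconj b) (Cr (exp x)))))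
      (Cadd (Cmul (Cinv lam) (Cmul b (Cr (exp x)))) (Cmul lam (Cr (exp (- x))))) (Copp (Cmul Ci (Cr q))).

Lemma Cabs_Czero : Cabs Czero = 0.
Proof. change Czero with (Cr 0). now rewrite Cabs_Cr, Rabs_R0. Qed.
Lemma Cone_le1 : Cabs Cone <= 1. Proof. rewrite Cabs_Cone. lra. Qed.
Lemma Czero_le1 : Cabs Czero <= 1. Proof. rewrite Cabs_Czero. lra. Qed.

Lemma exp_half x : exp (x / 2) * exp (x / 2) = exp x.
Proof. rewrite <- exp_plus. f_equal. field. Qed.

Lemma Vplus_deriv b x lam : Cnormsq b < 9 ->
  Mderiv_th (fun x => Vplus b x lam) x (Mmul (etaM b x lam) (Vplus b x lam)).
Proof.
  intros HN. pose proof (Cnormsq_nonneg b) as N0. set (N := Cnormsq b) in *.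
  assert (HN' : 0 <= N < 9) by lra.
  pose proof (w1f_continuous N HN') as C1. pose proof (w2f_continuous N HN') as C2.
  pose proof (qf_pos N x HN') as qp.
  destruct (rsfun_deriv (w1f N) (w2f N) (Cconj b) Cone Czero lam x C1 C2 Cone_le1 Czero_le1) as [D1 D2].
  destruct (rsfun_deriv (w1f N) (w2f N) (Cconj b) Czero Cone lam x C1 C2 Czero_le1 Cone_le1) as [D3 D4].
  assert (Em : Cderiv_th (fun x => Cr (exp (- (x / 2)))) x (Cmul (Cr (- / 2)) (Cr (exp (- (x / 2)))))).
  { rewrite <- Cr_mul. apply Cderiv_Cr, is_derive_Reals. auto_derive; [trivial|]. unfold Rdiv. ring. }
  assert (Ep : Cderiv_th (fun x => Cr (exp (x / 2))) x (Cmul (Cr (/ 2)) (Cr (exp (x / 2))))).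
  { rewrite <- Cr_mul. apply Cderiv_Cr, is_derive_Reals. auto_derive; [trivial|]. unfold Rdiv. ring. }
  pose proof (exp_half x) as eh. pose proof (exp_pos (x / 2)) as ep.
  assert (X1 : Cmul (Cr (exp (- (x / 2)))) (Cr (w1f N x)) = Cmul (Cr (exp x / qf N x)) (Cr (exp (x / 2)))).
  { rewrite <- !Cr_mul. f_equal. unfold w1f. rewrite exp_Ropp. replace (2 * x) with (x + x) by ring.
    rewrite exp_plus, <- eh. field. lra. }
  assert (X2 : Cmul (Cr (exp (x / 2))) (Cr (w2f N x)) = Cmul (Cr (exp (- x) / qf N x)) (Cr (exp (- (x / 2))))).
  { rewrite <- !Cr_mul. f_equal. unfold w2f. replace (2 * x) with (x + x) by ring.
    rewrite !exp_Ropp, exp_plus, <- eh. field. lra. }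
  unfold Vplus, etaM. fold N. cbv zeta.
  split; [|split; [|split]]; cbn [a11 a12 a21 a22 Mmul].
  - pose proof (Cderiv_mul _ _ _ _ _ Em D1) as H. cbv beta in H.
    match goal with |- Cderiv_th _ _ ?g => match type of H with Cderiv_th _ _ ?h => replace g with h; [exact H|] end end.
    transitivity (Cadd (Cmul (Cmul (Cr (- / 2)) (Cr (exp (- (x / 2))))) (rfun (w1f N) (w2f N) (Cconj b) Cone Czero x lam))
      (Cmul (Cmul (Cr (exp (- (x / 2)))) (Cr (w1f N x))) (Cmul (Cmul lam (Cmul Ci (Cconj b))) (sfun (w1f N) (w2f N) (Cconj b) Cone Czero x lam)))); [ring|].
    rewrite X1. ring.
  - pose proof (Cderiv_mul _ _ _ _ _ Em D3) as H. cbv beta in H.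
    match goal with |- Cderiv_th _ _ ?g => match type of H with Cderiv_th _ _ ?h => replace g with h; [exact H|] end end.
    transitivity (Cadd (Cmul (Cmul (Cr (- / 2)) (Cr (exp (- (x / 2))))) (rfun (w1f N) (w2f N) (Cconj b) Czero Cone x lam))
      (Cmul (Cmul (Cr (exp (- (x / 2)))) (Cr (w1f N x))) (Cmul (Cmul lam (Cmul Ci (Cconj b))) (sfun (w1f N) (w2f N) (Cconj b) Czero Cone x lam)))); [ring|].
    rewrite X1. ring.
  - pose proof (Cderiv_mul _ _ _ _ _ Ep D2) as H. cbv beta in H.
    match goal with |- Cderiv_th _ _ ?g => match type of H with Cderiv_th _ _ ?h => replace g with h; [exact H|] end end.
    transitivity (Cadd (Cmul (Cmul (Cr (/ 2)) (Cr (exp (x / 2)))) (sfun (w1f N) (w2f N) (Cconj b) Cone Czero x lam))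
      (Cmul (Cmul (Cr (exp (x / 2))) (Cr (w2f N x))) (Cmul (Cmul lam Ci) (rfun (w1f N) (w2f N) (Cconj b) Cone Czero x lam)))); [ring|].
    rewrite X2. ring.
  - pose proof (Cderiv_mul _ _ _ _ _ Ep D4) as H. cbv beta in H.
    match goal with |- Cderiv_th _ _ ?g => match type of H with Cderiv_th _ _ ?h => replace g with h; [exact H|] end end.
    transitivity (Cadd (Cmul (Cmul (Cr (/ 2)) (Cr (exp (x / 2)))) (sfun (w1f N) (w2f N) (Cconj b) Czero Cone x lam))
      (Cmul (Cmul (Cr (exp (x / 2))) (Cr (w2f N x))) (Cmul (Cmul lam Ci) (rfun (w1f N) (w2f N) (Cconj b) Czero Cone x lam)))); [ring|].
    rewrite X2. ring.
Qed.

Lemma rfun_0 wa wb bb x0 y0 lam : (forall x, continuous wa x) -> (forall x, continuous wb x) ->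
  Cabs x0 <= 1 -> Cabs y0 <= 1 -> rfun wa wb bb x0 y0 0 lam = x0.
Proof.
  intros Ha Hb Hx Hy. unfold rfun. rewrite CPS_const.
  - simpl. change (Cr 1) with Cone. ring.
  - now apply Dom_rcoef.
  - intros n. rewrite iterint_0. change (Cr 0) with Czero. ring.
Qed.
Lemma sfun_0 wa wb bb x0 y0 lam : (forall x, continuous wa x) -> (forall x, continuous wb x) ->
  Cabs x0 <= 1 -> Cabs y0 <= 1 -> sfun wa wb bb x0 y0 0 lam = y0.
Proof.
  intros Ha Hb Hx Hy. unfold sfun. rewrite CPS_const.
  - simpl. change (Cr 1) with Cone. ring.
  - now apply Dom_scoef.
  - intros n. rewrite iterint_0. change (Cr 0) with Czero. ring.
Qed.

Lemma Vplus_0 b lam : Cnormsq b < 9 -> Vplus b 0 lam = Mid.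
Proof.
  intros HN. pose proof (Cnormsq_nonneg b) as N0.
  assert (HN' : 0 <= Cnormsq b < 9) by lra.
  pose proof (w1f_continuous _ HN') as C1. pose proof (w2f_continuous _ HN') as C2.
  unfold Vplus. cbv zeta. rewrite !rfun_0, !sfun_0 by (auto using Cone_le1, Czero_le1).
  replace (0 / 2) with 0 by field. rewrite Ropp_0, exp_0. change (Cr 1) with Cone. msolve.
Qed.

Lemma etaM_trace b x lam : a22 (etaM b x lam) = Copp (a11 (etaM b x lam)).
Proof. apply Cx_eq; simpl; field. Qed.

Lemma Vplus_det b x lam : Cnormsq b < 9 -> Mdet (Vplus b x lam) = Cone.
Proof.
  intros HN.
  assert (E : Mmul (Madj (Vplus b x lam)) (Vplus b x lam) = Mid).
  { rewrite (Mderiv_0_const (fun x => Mmul (Madj (Vplus b x lam)) (Vplus b x lam))).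
    - rewrite Vplus_0 by exact HN. msolve.
    - intros s. eapply Mderiv_eq.
      + apply (Mderiv_mul (fun x => Madj (Vplus b x lam)) (fun x => Vplus b x lam));
          [apply Mderiv_adj|]; apply Vplus_deriv, HN.
      + cbv beta. pose proof (etaM_trace b s lam) as T. revert T.
        generalize (Vplus b s lam) (etaM b s lam). intros V h T.
        apply M2_eq; simpl; rewrite T; ring. }
  apply (f_equal a11) in E. revert E. generalize (Vplus b x lam). intros V E.
  simpl in E. unfold Mdet. rewrite <- E. ring.
Qed.

Lemma Amat_0 b lam : Amat b 0 lam = Dpot Cone b 2 lam.
Proof.
  unfold Amat, Dpot. rewrite qf_0, Ropp_0, exp_0, Cconj_Cone. change (Cr 1) with Cone. cbv zeta. f_equal; ring.
Qed.

(** The Lax equation. Its diagonal says q q' = N exp(2x) - exp(-2x), which is the derivative of the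
    relation defining q. *)
Lemma Amat_deriv b x lam : Cnormsq b < 9 -> lam <> Czero ->
  Mderiv_th (fun x => Amat b x lam) x (Msub (Mmul (etaM b x lam) (Amat b x lam)) (Mmul (Amat b x lam) (etaM b x lam))).
Proof.
  intros HN Hl. pose proof (Cnormsq_nonneg b) as N0.
  assert (HN' : 0 <= Cnormsq b < 9) by lra.
  pose proof (qf_pos _ x HN') as qp. pose proof (qf_deriv _ x HN') as qd.
  assert (Dq : Cderiv_th (fun x => Cr (qf (Cnormsq b) x)) x (Cr ((Cnormsq b * exp (2 * x) - exp (- (2 * x))) / qf (Cnormsq b) x))).
  { apply Cderiv_Cr, is_derive_Reals, qd. }
  assert (Dm : Cderiv_th (fun x => Cr (exp (- x))) x (Copp (Cr (exp (- x))))).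
  { rewrite <- Cr_opp. apply Cderiv_Cr, is_derive_Reals. auto_derive; [trivial|ring]. }
  assert (Dp : Cderiv_th (fun x => Cr (exp x)) x (Cr (exp x))).
  { apply Cderiv_Cr, is_derive_Reals. auto_derive; [trivial|ring]. }
  assert (K : forall c f l, Cderiv_th f x l -> Cderiv_th (fun s => Cmul c (f s)) x (Cmul c l)).
  { intros c f l Hf. replace (Cmul c l) with (Cadd (Cmul Czero (f x)) (Cmul c l)) by ring.
    apply (Cderiv_mul (fun _ => c) f); [apply Cderiv_const|exact Hf]. }
  assert (lm : Cmul lam (Cinv lam) = Cone) by (field; exact Hl).
  assert (em : Cmul (Cr (exp x)) (Cr (exp (- x))) = Cone).
  { rewrite <- Cr_mul, <- exp_plus, Rplus_opp_r, exp_0. reflexivity. }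
  assert (e2 : Cr (Cnormsq b * exp (2 * x) - exp (- (2 * x)))
     = Csub (Cmul (Cmul b (Cconj b)) (Cmul (Cr (exp x)) (Cr (exp x)))) (Cmul (Cr (exp (- x))) (Cr (exp (- x))))).
  { rewrite Cmul_conj, <- !Cr_mul, <- !exp_plus. replace (2 * x) with (x + x) by ring.
    replace (- (x + x)) with (- x + - x) by ring. unfold Csub. rewrite <- Cr_opp, <- Cr_add. f_equal. }
  unfold Rdiv in Dq. rewrite Cr_mul, e2 in Dq.
  assert (Qi : Cmul (Cr (qf (Cnormsq b) x)) (Cr (/ qf (Cnormsq b) x)) = Cone).
  { rewrite <- Cr_mul, Rinv_r by lra. reflexivity. }
  assert (D1 := K Ci _ _ Dq). cbv beta in D1.
  assert (H2 : Cr (- / 2) = Copp (Cr (/ 2))) by apply Cr_opp.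
  assert (H3 : Cadd (Cr (/ 2)) (Cr (/ 2)) = Cone) by (rewrite <- Cr_add; apply Cx_eq; simpl; field).
  assert (I2 := Ci_sqr).
  unfold Amat, etaM, Rdiv. cbv zeta. rewrite !(Cr_mul (exp _)), H2.
  split; [|split; [|split]]; cbn [a11 a12 a21 a22 Mmul Msub Madd Mscal].
  - match goal with |- Cderiv_th _ _ ?g => match type of D1 with Cderiv_th _ _ ?h => replace g with h; [exact D1|] end end.
    ring [lm].
  - match goal with |- Cderiv_th _ _ ?g => replace g with
      (Cadd (Cmul (Cinv lam) (Copp (Cr (exp (- x))))) (Cmul lam (Cmul (Cconj b) (Cr (exp x))))) end.
    + apply Cderiv_add; [apply K, Dm|]. apply K, K, Dp.
    + revert H3 Qi. generalize (Cr (/ 2)) (Cr (qf (Cnormsq b) x)) (Cr (/ qf (Cnormsq b) x)). intros h q qi H3 Qi.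
      transitivity (Cadd (Copp (Cmul (Cadd h h) (Cadd (Cmul (Cinv lam) (Cr (exp (- x)))) (Cmul lam (Cmul (Cconj b) (Cr (exp x)))))))
        (Cadd (Cmul lam (Cmul (Cconj b) (Cr (exp x)))) (Cmul lam (Cmul (Cconj b) (Cr (exp x)))))); [rewrite H3; ring|].
      ring [Qi I2].
  - match goal with |- Cderiv_th _ _ ?g => replace g with
      (Cadd (Cmul (Cinv lam) (Cmul b (Cr (exp x)))) (Cmul lam (Copp (Cr (exp (- x)))))) end.
    + apply Cderiv_add; [apply K, K, Dp|]. apply K, Dm.
    + revert H3 Qi. generalize (Cr (/ 2)) (Cr (qf (Cnormsq b) x)) (Cr (/ qf (Cnormsq b) x)). intros h q qi H3 Qi.
      transitivity (Csub (Cmul (Cadd h h) (Cadd (Cmul (Cinv lam) (Cmul b (Cr (exp x)))) (Cmul lam (Cr (exp (- x))))))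
        (Cadd (Cmul lam (Cr (exp (- x)))) (Cmul lam (Cr (exp (- x)))))); [rewrite H3; ring|].
      ring [Qi I2].
  - apply Cderiv_opp in D1.
    match goal with |- Cderiv_th _ _ ?g => match type of D1 with Cderiv_th _ _ ?h => replace g with h; [exact D1|] end end.
    ring [lm].
Qed.

(** By the Lax equation V^-1 A V does not depend on x, and at x = 0 it is D. *)
Lemma Vplus_conj b x lam : Cnormsq b < 9 -> lam <> Czero ->
  Mmul (Dpot Cone b 2 lam) (Madj (Vplus b x lam)) = Mmul (Madj (Vplus b x lam)) (Amat b x lam).
Proof.
  intros HN Hl.
  assert (E : Mmul (Madj (Vplus b x lam)) (Mmul (Amat b x lam) (Vplus b x lam)) = Dpot Cone b 2 lam).
  { rewrite (Mderiv_0_const (fun x => Mmul (Madj (Vplus b x lam)) (Mmul (Amat b x lam) (Vplus b x lam)))).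
    - rewrite Vplus_0, Amat_0 by exact HN. rewrite Mmul_1r.
      replace (Madj Mid) with Mid by msolve. apply Mmul_1l.
    - intros s. eapply Mderiv_eq.
      + apply (Mderiv_mul (fun x => Madj (Vplus b x lam)) (fun x => Mmul (Amat b x lam) (Vplus b x lam))).
        * apply Mderiv_adj, Vplus_deriv, HN.
        * apply (Mderiv_mul (fun x => Amat b x lam) (fun x => Vplus b x lam)); [now apply Amat_deriv|now apply Vplus_deriv].
      + cbv beta. rewrite Madj_mul.
        assert (Ad : Madj (etaM b s lam) = Mscal (Copp Cone) (etaM b s lam)).
        { pose proof (etaM_trace b s lam) as T. revert T. generalize (etaM b s lam). intros h T.
          apply M2_eq; simpl; rewrite ?T; ring. }
        rewrite Ad. generalize (Vplus b s lam) (Madj (Vplus b s lam)) (etaM b s lam) (Amat b s lam).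
        intros V W h A. msolve. }
  rewrite <- E, <- !Mmul_assoc, Mmul_adj_r, Mmul_1r; [reflexivity|]. now apply Vplus_det.
Qed.

Definition Gfac (b : Cx) (x : R) (lam : Cx) : M2 :=
  Mmul (Mexp (Mscal Ci (Dpot Cone b 2 lam)) (Yf (Cnormsq b) x)) (Madj (Vplus b x lam)).

Lemma Mderiv_comp_real (F : R -> M2) (g : R -> R) t L g' :
  Mderiv_th F (g t) L -> derivable_pt_lim g t g' -> Mderiv_th (fun s => F (g s)) t (Mscal (Cr g') L).
Proof.
  intros (F1 & F2 & F3 & F4) Hg.
  assert (C : forall f l, Cderiv_th f (g t) l -> Cderiv_th (fun s => f (g s)) t (Cmul (Cr g') l)).
  { intros f l [H1 H2]. split; simpl.
    - replace (g' * cre l - 0 * cim l) with (cre l * g') by ring.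
      exact (derivable_pt_lim_comp g (fun s => cre (f s)) t g' (cre l) Hg H1).
    - replace (g' * cim l + 0 * cre l) with (cim l * g') by ring.
      exact (derivable_pt_lim_comp g (fun s => cim (f s)) t g' (cim l) Hg H2). }
  split; [|split; [|split]]; cbn [a11 a12 a21 a22 Mscal].
  - apply (C (fun s => a11 (F s))), F1. - apply (C (fun s => a12 (F s))), F2.
  - apply (C (fun s => a21 (F s))), F3. - apply (C (fun s => a22 (F s))), F4.
Qed.

(** Right logarithmic derivative of [Gfac]: the speed dy/dx = 1/(2q) contributes the multiple of A,
    and V_+^-1 contributes -eta. *)
Definition betaM (b : Cx) (x : R) (lam : Cx) : M2 :=
  Msub (Mscal (Cmul Ci (Cr (/ (2 * qf (Cnormsq b) x)))) (Amat b x lam)) (etaM b x lam).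

Lemma Gfac_deriv b x lam : Cnormsq b < 9 -> lam <> Czero ->
  Mderiv_th (fun x => Gfac b x lam) x (Mmul (Gfac b x lam) (betaM b x lam)).
Proof.
  intros HN Hl. pose proof (Cnormsq_nonneg b) as N0.
  assert (HN' : 0 <= Cnormsq b < 9) by lra. unfold Gfac.
  set (X := Mscal Ci (Dpot Cone b 2 lam)).
  eapply Mderiv_eq.
  - apply (Mderiv_mul (fun x => Mexp X (Yf (Cnormsq b) x)) (fun x => Madj (Vplus b x lam))).
    + apply (Mderiv_comp_real (Mexp X) (Yf (Cnormsq b))); [apply Mexp_deriv|]. apply is_derive_Reals. now apply Yf_deriv.
    + apply Mderiv_adj. now apply Vplus_deriv.
  - cbv beta. rewrite Madj_mul, (Mexp_comm X X _ eq_refl).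
    assert (Ad : Madj (etaM b x lam) = Mscal (Copp Cone) (etaM b x lam)).
    { pose proof (etaM_trace b x lam) as T. revert T. generalize (etaM b x lam). intros h T.
      apply M2_eq; simpl; rewrite ?T; ring. }
    rewrite Ad. unfold betaM.
    transitivity (Madd (Mscal (Cmul Ci (Cr (/ (2 * qf (Cnormsq b) x)))) (Mmul (Mexp X (Yf (Cnormsq b) x)) (Mmul (Dpot Cone b 2 lam) (Madj (Vplus b x lam)))))
       (Mmul (Mexp X (Yf (Cnormsq b) x)) (Mmul (Madj (Vplus b x lam)) (Mscal (Copp Cone) (etaM b x lam))))).
    + unfold X at 2. generalize (Mexp X (Yf (Cnormsq b) x)) (Madj (Vplus b x lam)) (Dpot Cone b 2 lam) (etaM b x lam). intros. msolve.
    + rewrite Vplus_conj by assumption.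
      generalize (Mexp X (Yf (Cnormsq b) x)) (Madj (Vplus b x lam)) (Amat b x lam) (etaM b x lam). intros. msolve.
Qed.

Lemma betaM_RF b x lam : Cnormsq b < 9 -> Cabs lam = 1 -> RF (betaM b x lam) /\ a22 (betaM b x lam) = Copp (a11 (betaM b x lam)).
Proof.
  intros HN Hl. pose proof (Cnormsq_nonneg b) as N0.
  assert (HN' : 0 <= Cnormsq b < 9) by lra. pose proof (qf_pos _ x HN') as qp.
  assert (Z : a11 (betaM b x lam) = Czero).
  { unfold betaM, Amat, etaM. cbv zeta. cbn [a11 Msub Madd Mscal]. apply Cx_eq; simpl; field; lra. }
  assert (Z2 : a22 (betaM b x lam) = Czero).
  { unfold betaM, Amat, etaM. cbv zeta. cbn [a22 Msub Madd Mscal]. apply Cx_eq; simpl; field; lra. }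
  split; [split|].
  - unfold betaM, Amat, etaM. cbv zeta. cbn [a11 a12 a21 a22 Msub Madd Mscal]. rewrite (Cinv_unit _ Hl).
    replace (/ (2 * qf (Cnormsq b) x)) with (/ 2 * / qf (Cnormsq b) x) by (field; lra).
    unfold Rdiv. rewrite !Cr_mul. cconj_simpl.
    assert (H3 : Cadd (Cr (/ 2)) (Cr (/ 2)) = Cone) by (rewrite <- Cr_add; apply Cx_eq; simpl; field).
    revert H3. generalize (Cr (/ 2)). intros h H3.
    assert (P : forall u, u = Cmul (Cadd h h) u) by (intros u; rewrite H3; ring).
    set (u1 := Cmul (Cmul Ci lam) (Cmul (Cr (exp (- x))) (Cr (/ qf (Cnormsq b) x)))).
    set (u2 := Cmul (Cmul Ci (Cconj lam)) (Cmul b (Cmul (Cr (exp x)) (Cr (/ qf (Cnormsq b) x))))).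
    transitivity (Csub (Cmul h u2) (Csub u1 (Cmul h u1))); [unfold u1, u2; ring|].
    transitivity (Csub (Csub u2 (Cmul h u2)) (Cmul h u1)); [|unfold u1, u2; ring].
    rewrite (P u1) at 1. rewrite (P u2) at 2. ring.
  - rewrite Z, Z2. symmetry. apply Cconj_Czero.
  - rewrite Z, Z2. ring.
Qed.

Lemma Mexp_iD_det b y lam : Mdet (Mexp (Mscal Ci (Dpot Cone b 2 lam)) y) = Cone.
Proof. apply Mdet_Mexp. unfold Mtr; simpl. cx_solve. Qed.

Lemma Gfac_det b x lam : Cnormsq b < 9 -> Mdet (Gfac b x lam) = Cone.
Proof.
  intros HN. unfold Gfac. rewrite Mdet_mul, Mdet_adj, Mexp_iD_det, Vplus_det by exact HN. ring.
Qed.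
Lemma Gfac_0 b lam : Cnormsq b < 9 -> Gfac b 0 lam = Mid.
Proof.
  intros HN. unfold Gfac. rewrite Yf_0, Mexp_0, Vplus_0 by exact HN. msolve.
Qed.

Lemma Mflip_mul A B : Mflip (Mmul A B) = Mmul (Mflip A) (Mflip B).
Proof. apply M2_eq; simpl; cconj_simpl; ring. Qed.
Lemma Mderiv_flip f t A : Mderiv_th f t A -> Mderiv_th (fun s => Mflip (f s)) t (Mflip A).
Proof.
  intros (H1 & H2 & H3 & H4).
  split; [|split; [|split]]; simpl; apply Cderiv_conj; assumption.
Qed.

(** G and its flip satisfy the same linear equation, since the flip fixes [betaM], and both are the
    identity at x = 0; their quotient is constant. *)
Lemma Gfac_RF b x lam : Cnormsq b < 9 -> Cabs lam = 1 -> RF (Gfac b x lam).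
Proof.
  intros HN Hl. pose proof (unit_neq0 _ Hl) as Hn.
  apply RF_flip.
  assert (E : Mmul (Mflip (Gfac b x lam)) (Madj (Gfac b x lam)) = Mid).
  { rewrite (Mderiv_0_const (fun x => Mmul (Mflip (Gfac b x lam)) (Madj (Gfac b x lam)))).
    - rewrite Gfac_0 by exact HN. msolve; cx_solve.
    - intros s. destruct (betaM_RF b s lam HN Hl) as [BR BT]. apply RF_flip in BR.
      eapply Mderiv_eq.
      + apply (Mderiv_mul (fun x => Mflip (Gfac b x lam)) (fun x => Madj (Gfac b x lam))).
        * apply Mderiv_flip. now apply Gfac_deriv.
        * apply Mderiv_adj. now apply Gfac_deriv.
      + cbv beta. rewrite Mflip_mul, BR, Madj_mul.
        revert BT. generalize (Mflip (Gfac b s lam)) (Madj (Gfac b s lam)) (betaM b s lam). intros P Q h T.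
        apply M2_eq; simpl; rewrite T; ring. }
  rewrite <- (Mmul_1r (Mflip (Gfac b x lam))), <- (Mmul_adj_l (Gfac b x lam)) by now apply Gfac_det.
  rewrite Mmul_assoc, E. apply Mmul_1l.
Qed.

Lemma Vplus_twist b x lam : Cnormsq b < 9 ->
  Vplus b x (Copp lam) = Mmul sigma3 (Mmul (Vplus b x lam) sigma3).
Proof.
  intros HN. pose proof (Cnormsq_nonneg b) as N0.
  assert (HN' : 0 <= Cnormsq b < 9) by lra.
  pose proof (w1f_continuous _ HN') as C1. pose proof (w2f_continuous _ HN') as C2.
  assert (R : forall x0 y0 sg, Cabs x0 <= 1 -> Cabs y0 <= 1 -> Cmul sg sg = Cone -> Cmul sg x0 = x0 -> Cmul (Copp sg) y0 = y0 ->
    rfun (w1f (Cnormsq b)) (w2f (Cnormsq b)) (Cconj b) x0 y0 x (Copp lam) = Cmul sg (rfun (w1f (Cnormsq b)) (w2f (Cnormsq b)) (Cconj b) x0 y0 x lam) /\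
    sfun (w1f (Cnormsq b)) (w2f (Cnormsq b)) (Cconj b) x0 y0 x (Copp lam) = Cmul (Copp sg) (sfun (w1f (Cnormsq b)) (w2f (Cnormsq b)) (Cconj b) x0 y0 x lam)).
  { intros x0 y0 sg Hx Hy Hs Sx Sy. split.
    - apply CPS_opp; [now apply Dom_rcoef|]. intros n.
      destruct (coefs_parity (Cconj b) x0 y0 sg n Hs Sx Sy) as [P _].
      transitivity (Cmul (Cmul (Cpow (Copp Cone) n) (fst (coefs (Cconj b) x0 y0 n))) (Cr (iterint (w1f (Cnormsq b)) (w2f (Cnormsq b)) n x))); [ring|].
      rewrite P. ring.
    - apply CPS_opp; [now apply Dom_scoef|]. intros n.
      destruct (coefs_parity (Cconj b) x0 y0 sg n Hs Sx Sy) as [_ P].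
      transitivity (Cmul (Cmul (Cpow (Copp Cone) n) (snd (coefs (Cconj b) x0 y0 n))) (Cr (iterint (w2f (Cnormsq b)) (w1f (Cnormsq b)) n x))); [ring|].
      rewrite P. ring. }
  destruct (R Cone Czero Cone Cone_le1 Czero_le1) as [R1 S1]; try ring.
  destruct (R Czero Cone (Copp Cone) Czero_le1 Cone_le1) as [R2 S2]; try ring.
  unfold Vplus. cbv zeta. rewrite R1, R2, S1, S2. msolve.
Qed.

Lemma Gfac_twist b x lam : Cnormsq b < 9 -> Cabs lam = 1 ->
  Gfac b x (Copp lam) = Mmul sigma3 (Mmul (Gfac b x lam) sigma3).
Proof.
  intros HN Hl. unfold Gfac. rewrite Vplus_twist, Dpot_twist by assumption.
  replace (Mscal Ci (Mmul sigma3 (Mmul (Dpot Cone b 2 lam) sigma3)))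
    with (Mmul sigma3 (Mmul (Mscal Ci (Dpot Cone b 2 lam)) sigma3))
    by (generalize (Dpot Cone b 2 lam); intros; msolve).
  rewrite Mexp_sigma3. generalize (Mexp (Mscal Ci (Dpot Cone b 2 lam)) (Yf (Cnormsq b) x)) (Vplus b x lam). intros. msolve.
Qed.

Lemma Vplus_at_0 b x : Cnormsq b < 9 ->
  a11 (Vplus b x Czero) = Cr (exp (- (x / 2))) /\ a22 (Vplus b x Czero) = Cr (exp (x / 2)).
Proof.
  intros HN. pose proof (Cnormsq_nonneg b) as N0.
  assert (HN' : 0 <= Cnormsq b < 9) by lra.
  pose proof (w1f_continuous _ HN') as C1. pose proof (w2f_continuous _ HN') as C2.
  unfold Vplus, rfun, sfun. cbv zeta. cbn [a11 a22].
  rewrite !CPS_at_0 by (apply Dom_rcoef || apply Dom_scoef; auto using Cone_le1, Czero_le1).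
  simpl. change (Cr 1) with Cone. split; ring.
Qed.

Lemma Vplus_InLoopPlusPos b x : Cnormsq b < 9 -> InLoopPlusPos (Vplus b x).
Proof.
  intros HN. pose proof (Cnormsq_nonneg b) as N0.
  assert (HN' : 0 <= Cnormsq b < 9) by lra.
  pose proof (w1f_continuous _ HN') as C1. pose proof (w2f_continuous _ HN') as C2.
  split.
  - intros lam Hl. split; [now apply Vplus_det|now apply Vplus_twist].
  - exists (Vplus b x). split; [reflexivity|].
    assert (R : forall k x0 y0, Cabs x0 <= 1 -> Cabs y0 <= 1 -> disk_holo (fun lam => Cmul k (rfun (w1f (Cnormsq b)) (w2f (Cnormsq b)) (Cconj b) x0 y0 x lam))).
    { intros k x0 y0 Hx Hy. apply disk_holo_mul; [apply disk_holo_const|]. apply CPS_disk_holo. now apply Dom_rcoef. }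
    assert (S : forall k x0 y0, Cabs x0 <= 1 -> Cabs y0 <= 1 -> disk_holo (fun lam => Cmul k (sfun (w1f (Cnormsq b)) (w2f (Cnormsq b)) (Cconj b) x0 y0 x lam))).
    { intros k x0 y0 Hx Hy. apply disk_holo_mul; [apply disk_holo_const|]. apply CPS_disk_holo. now apply Dom_scoef. }
    destruct (Vplus_at_0 b x HN) as [V1 V2]. pose proof (exp_pos (- (x / 2))). pose proof (exp_pos (x / 2)).
    destruct (R (Cr (exp (- (x / 2)))) Cone Czero Cone_le1 Czero_le1) as [A1 A2].
    destruct (R (Cr (exp (- (x / 2)))) Czero Cone Czero_le1 Cone_le1) as [B1 B2].
    destruct (S (Cr (exp (x / 2))) Cone Czero Cone_le1 Czero_le1) as [A3 A4].
    destruct (S (Cr (exp (x / 2))) Czero Cone Czero_le1 Cone_le1) as [B3 B4].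
    split; [|split; [|rewrite V1, V2; simpl; repeat split; assumption]].
    + intros w Hw. exact (conj (A1 w Hw) (conj (B1 w Hw) (conj (A3 w Hw) (B3 w Hw)))).
    + intros w Hw. exact (conj (A2 w Hw) (conj (B2 w Hw) (conj (A4 w Hw) (B4 w Hw)))).
Qed.

Lemma Gfac_factor b x lam : Cnormsq b < 9 ->
  Mmul (Gfac b x lam) (Vplus b x lam) = Mexp (Mscal Ci (Dpot Cone b 2 lam)) (Yf (Cnormsq b) x).
Proof.
  intros HN. unfold Gfac. rewrite <- Mmul_assoc, Mmul_adj_l, Mmul_1r; [reflexivity|now apply Vplus_det].
Qed.

(** The exponents s D and i y D commute, and exp(s D) is already SU(1,1)-valued, so it is merged
    into the first factor. *)
Lemma iwasawa_exp b s x : Cnormsq b < 9 ->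
  let Fh := fun lam => Mmul (Mexp (Dpot Cone b 2 lam) s) (Gfac b x lam) in
  InLoopSU Fh /\ InLoopPlusPos (Vplus b x) /\
  forall lam, IsMexp (Mscal (mkC s (Yf (Cnormsq b) x)) (Dpot Cone b 2 lam)) (Mmul (Fh lam) (Vplus b x lam)).
Proof.
  intros HN Fh. split; [|split].
  - apply InLoopSU_mul; [apply InLoopSU_exp|]. apply InLoopSU_iff. split.
    + intros lam Hl. split; [now apply Gfac_det|now apply Gfac_twist].
    + intros lam Hl. now apply Gfac_RF.
  - now apply Vplus_InLoopPlusPos.
  - intros lam. unfold Fh. rewrite <- Mmul_assoc, Gfac_factor by exact HN.
    replace (Mscal (mkC s (Yf (Cnormsq b) x)) (Dpot Cone b 2 lam))
      with (Madd (Mscal (Cr s) (Dpot Cone b 2 lam)) (Mscal (Cr (Yf (Cnormsq b) x)) (Mscal Ci (Dpot Cone b 2 lam)))).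
    + apply IsMexp_add; try apply IsMexp_Mexp_scal.
      generalize (Dpot Cone b 2 lam). intros. msolve.
    + generalize (Dpot Cone b 2 lam) (Yf (Cnormsq b) x). intros D y.
      assert (E : mkC s y = Cadd (Cr s) (Cmul (Cr y) Ci)) by cx_solve. rewrite E. msolve.
Qed.

(** * Smoothness along the unit circle and existence of the surface *)

Lemma CPSd_mul c w : Dom c -> Cmul w (CPS (CPSd c) w) = CPS (fun n => Cmul (Cr (INR n)) (c n)) w.
Proof.
  intros Hc. unfold CPS at 2. rewrite Csum_shift by (apply Dom_CPS, Dom_INR, Hc).
  simpl INR at 1. change (Cr 0) with Czero. unfold CPS. rewrite <- Csum_scal by (apply Dom_CPS, Dom_CPSd, Hc).
  rewrite (Csum_ext (fun n => Cmul w (Cmul (Cpow w n) (CPSd c n)))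
    (fun n => Cmul (Cpow w (S n)) (Cmul (Cr (INR (S n))) (c (S n))))); [ring|].
  intros n. unfold CPSd. cbn [Cpow]. ring.
Qed.

Lemma CPS_add c d w : Dom c -> Dom d -> CPS (fun n => Cadd (c n) (d n)) w = Cadd (CPS c w) (CPS d w).
Proof.
  intros Hc Hd. unfold CPS. rewrite <- Csum_add by now apply Dom_CPS. apply Csum_ext. intros; ring.
Qed.
Lemma CPS_scal k c w : Dom c -> CPS (fun n => Cmul k (c n)) w = Cmul k (CPS c w).
Proof.
  intros Hc. unfold CPS. rewrite <- Csum_scal by now apply Dom_CPS. apply Csum_ext. intros; ring.
Qed.
Lemma CPS_ext c d w : (forall n, c n = d n) -> CPS c w = CPS d w.
Proof. intros H. unfold CPS. apply Csum_ext. intros n. now rewrite H. Qed.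

(** [ch] and [sh] are the Taylor coefficients of cosh(sqrt w) and sinh(sqrt w)/sqrt w, both entire
    in w. *)
Definition ch (n : nat) : Cx := Cr (/ INR (fact (2 * n))).
Definition sh (n : nat) : Cx := Cr (/ INR (fact (2 * n + 1))).

Lemma Dom_inv_fact (g : nat -> nat) : (forall n, (n <= g n)%nat) -> Dom (fun n => Cr (/ INR (fact (g n)))).
Proof.
  intros H. exists 1, 1. split; [lra|]. split; [lra|]. intros n.
  rewrite Cabs_Cr, Rabs_pos_eq by (left; apply Rinv_0_lt_compat, INR_fact_lt_0).
  unfold fmaj. rewrite pow1. unfold Rdiv. rewrite !Rmult_1_l.
  apply Rinv_le_contravar; [apply INR_fact_lt_0|]. apply le_INR, fact_le, H.
Qed.
Lemma Dom_ch : Dom ch.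
Proof. apply (Dom_inv_fact (fun n => (2 * n)%nat)). intros; lia. Qed.
Lemma Dom_sh : Dom sh.
Proof. apply (Dom_inv_fact (fun n => (2 * n + 1)%nat)). intros; lia. Qed.

Lemma CPSd_ch w : CPS (CPSd ch) w = Cmul (Cr (/ 2)) (CPS sh w).
Proof.
  rewrite <- CPS_scal by apply Dom_sh. apply CPS_ext. intros n. unfold CPSd, ch, sh.
  rewrite <- !Cr_mul. f_equal. replace (2 * S n)%nat with (S (2 * n + 1)) by lia.
  rewrite fact_simpl, mult_INR. replace (S (2 * n + 1)) with (2 * S n)%nat by lia. rewrite mult_INR.
  replace (INR 2) with 2 by (simpl; ring). field. split; [apply INR_fact_neq_0|apply not_0_INR; lia].
Qed.
Lemma CPSd_sh w : Cadd (CPS sh w) (Cmul (Cr 2) (Cmul w (CPS (CPSd sh) w))) = CPS ch w.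
Proof.
  rewrite CPSd_mul by apply Dom_sh. rewrite <- CPS_scal by apply Dom_INR, Dom_sh.
  rewrite <- CPS_add by (auto using Dom_scal, Dom_INR, Dom_sh). apply CPS_ext. intros n. unfold ch, sh.
  rewrite <- !Cr_mul, <- Cr_add. f_equal. replace (2 * n + 1)%nat with (S (2 * n)) by lia.
  rewrite fact_simpl, mult_INR, S_INR, mult_INR. replace (INR 2) with 2 by (simpl; ring).
  field. split; [apply INR_fact_neq_0|]. pose proof (pos_INR n). lra.
Qed.

(** A formula for exp(tX) without square roots. For traceless X, kap = -det X, and the dependence on
    kap is entire, so the exponential stays smooth in the angle even where the determinant vanishes
    or changes sign. *)
Lemma Mexp_entire X kap t : Mmul X X = Mscal kap Mid ->
  Mexp X t = Madd (Mscal (CPS ch (Cmul kap (Cr (t * t)))) Mid) (Mscal (Cmul (Cr t) (CPS sh (Cmul kap (Cr (t * t))))) X).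
Proof.
  intros HX. symmetry.
  apply (Mexp_ode_unique X (fun t => Madd (Mscal (CPS ch (Cmul kap (Cr (t * t)))) Mid) (Mscal (Cmul (Cr t) (CPS sh (Cmul kap (Cr (t * t))))) X))).
  - replace (Cmul kap (Cr (0 * 0))) with Czero by (rewrite Rmult_0_l; change (Cr 0) with Czero; ring).
    rewrite !CPS_at_0 by (apply Dom_ch || apply Dom_sh). unfold ch, sh. simpl. rewrite Rinv_1.
    change (Cr 1) with Cone. change (Cr 0) with Czero. msolve.
  - intros s.
    assert (Dg : Cderiv_th (fun t => Cmul kap (Cr (t * t))) s (Cmul kap (Cr (2 * s)))).
    { replace (Cmul kap (Cr (2 * s))) with (Cadd (Cmul Czero (Cr (s * s))) (Cmul kap (Cr (2 * s)))) by ring.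
      apply (Cderiv_mul (fun _ => kap) (fun t => Cr (t * t))); [apply Cderiv_const|].
      apply Cderiv_Cr, is_derive_Reals. auto_derive; [trivial|ring]. }
    assert (Dt : Cderiv_th (fun t => Cr t) s Cone).
    { change Cone with (Cr 1). apply Cderiv_Cr, is_derive_Reals. auto_derive; [trivial|ring]. }
    pose proof (Cderiv_CPS_comp ch _ s _ Dom_ch Dg) as D1.
    pose proof (Cderiv_mul _ _ _ _ _ Dt (Cderiv_CPS_comp sh _ s _ Dom_sh Dg)) as D2. cbv beta in D1, D2.
    eapply Mderiv_eq.
    + apply Mderiv_add.
      * apply (Mderiv_scal _ (fun _ => Mid)); [exact D1|apply Mderiv_const].
      * apply (Mderiv_scal _ (fun _ => X)); [exact D2|apply Mderiv_const].
    + cbv beta. rewrite CPSd_ch.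
      pose proof (CPSd_sh (Cmul kap (Cr (s * s)))) as E. rewrite <- E. rewrite (Cr_mul s s), (Cr_mul 2 s).
      generalize (CPS sh (Cmul kap (Cmul (Cr s) (Cr s)))) (CPS (CPSd sh) (Cmul kap (Cmul (Cr s) (Cr s)))). intros u v.
      transitivity (Madd (Mscal (Cmul (Cmul (Cr s) u) (Cmul (Cmul (Cr (/ 2)) (Cr 2)) kap)) Mid)
        (Mscal (Cadd u (Cmul (Cr 2) (Cmul (Cmul kap (Cmul (Cr s) (Cr s))) v))) X)).
      * generalize X. intros Y. msolve.
      * replace (Cmul (Cr (/ 2)) (Cr 2)) with Cone by (rewrite <- Cr_mul; apply Cx_eq; simpl; field).
        transitivity (Madd (Mscal (Cmul (Cr s) u) (Mscal kap Mid)) (Mscal (Cadd u (Cmul (Cr 2) (Cmul (Cmul kap (Cmul (Cr s) (Cr s))) v))) X)); [msolve|].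
        rewrite <- HX. msolve.
Qed.

(** The Sym formula differentiates the frame twice, once to form f_L3 along the whole circle and
    once more at lambda = 1. *)
Definition CC2 (f : R -> Cx) : Prop :=
  exists f' f'', (forall t, Cderiv_th f t (f' t)) /\ (forall t, Cderiv_th f' t (f'' t)).

Lemma CC2_ext f g : (forall t, f t = g t) -> CC2 f -> CC2 g.
Proof. intros E (f1 & f2 & H1 & H2). exists f1, f2. split; [|exact H2]. intros t. eapply Cderiv_ext; [exact E|apply H1]. Qed.
Lemma CC2_const c : CC2 (fun _ => c).
Proof. exists (fun _ => Czero), (fun _ => Czero). split; intros; apply Cderiv_const. Qed.
Lemma CC2_add f g : CC2 f -> CC2 g -> CC2 (fun t => Cadd (f t) (g t)).
Proof.
  intros (f1 & f2 & H1 & H2) (g1 & g2 & K1 & K2).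
  exists (fun t => Cadd (f1 t) (g1 t)), (fun t => Cadd (f2 t) (g2 t)). split; intros; now apply Cderiv_add.
Qed.
Lemma CC2_mul f g : CC2 f -> CC2 g -> CC2 (fun t => Cmul (f t) (g t)).
Proof.
  intros (f1 & f2 & H1 & H2) (g1 & g2 & K1 & K2).
  eexists (fun t => Cadd (Cmul (f1 t) (g t)) (Cmul (f t) (g1 t))), _.
  split; intros t; [now apply Cderiv_mul|].
  apply Cderiv_add; apply Cderiv_mul; auto.
Qed.
Lemma CC2_opp f : CC2 f -> CC2 (fun t => Copp (f t)).
Proof.
  intros (f1 & f2 & H1 & H2). exists (fun t => Copp (f1 t)), (fun t => Copp (f2 t)).
  split; intros; now apply Cderiv_opp.
Qed.
Lemma CC2_conj f : CC2 f -> CC2 (fun t => Cconj (f t)).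
Proof.
  intros (f1 & f2 & H1 & H2). exists (fun t => Cconj (f1 t)), (fun t => Cconj (f2 t)).
  split; intros; now apply Cderiv_conj.
Qed.
Lemma CC2_cis : CC2 Ccis.
Proof.
  eexists (fun t => Cmul Ci (Ccis t)), _. split; intros t; [apply Cderiv_cis|].
  apply (Cderiv_mul (fun _ => Ci) Ccis); [apply Cderiv_const|apply Cderiv_cis].
Qed.
Lemma CC2_CPS c g : Dom c -> CC2 g -> CC2 (fun t => CPS c (g t)).
Proof.
  intros Hc (g1 & g2 & K1 & K2).
  eexists (fun t => Cmul (CPS (CPSd c) (g t)) (g1 t)), _. split; intros t.
  - now apply Cderiv_CPS_comp.
  - apply (Cderiv_mul (fun t => CPS (CPSd c) (g t)) g1); [apply Cderiv_CPS_comp; [now apply Dom_CPSd|apply K1]|apply K2].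
Qed.

Definition MC2 (h : R -> M2) : Prop :=
  CC2 (fun t => a11 (h t)) /\ CC2 (fun t => a12 (h t)) /\ CC2 (fun t => a21 (h t)) /\ CC2 (fun t => a22 (h t)).

Lemma MC2_ext f g : (forall t, f t = g t) -> MC2 f -> MC2 g.
Proof.
  intros E (H1 & H2 & H3 & H4).
  split; [|split; [|split]].
  - exact (CC2_ext _ _ (fun t => f_equal a11 (E t)) H1).
  - exact (CC2_ext _ _ (fun t => f_equal a12 (E t)) H2).
  - exact (CC2_ext _ _ (fun t => f_equal a21 (E t)) H3).
  - exact (CC2_ext _ _ (fun t => f_equal a22 (E t)) H4).
Qed.
Lemma MC2_mul f g : MC2 f -> MC2 g -> MC2 (fun t => Mmul (f t) (g t)).
Proof.
  intros (H1 & H2 & H3 & H4) (K1 & K2 & K3 & K4).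
  split; [|split; [|split]]; simpl; apply CC2_add; now apply CC2_mul.
Qed.
Lemma MC2_adj f : MC2 f -> MC2 (fun t => Madj (f t)).
Proof.
  intros (H1 & H2 & H3 & H4).
  split; [|split; [|split]]; simpl; try apply CC2_opp; assumption.
Qed.
Lemma MC2_scal k f : CC2 k -> MC2 f -> MC2 (fun t => Mscal (k t) (f t)).
Proof.
  intros Hk (H1 & H2 & H3 & H4).
  split; [|split; [|split]]; simpl; now apply CC2_mul.
Qed.
Lemma MC2_derivs h : MC2 h -> exists h' h'', (forall t, Mderiv_th h t (h' t)) /\ (forall t, Mderiv_th h' t (h'' t)).
Proof.
  intros ((p1 & p2 & P1 & P2) & (q1 & q2 & Q1 & Q2) & (r1 & r2 & R1 & R2) & (s1 & s2 & S1 & S2)).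
  exists (fun t => mkM (p1 t) (q1 t) (r1 t) (s1 t)), (fun t => mkM (p2 t) (q2 t) (r2 t) (s2 t)).
  split; intros t; (split; [|split; [|split]]); simpl; auto.
Qed.

Lemma Mexp_MC2 (X : R -> M2) y : MC2 X -> (forall t, Mtr (X t) = Czero) -> MC2 (fun t => Mexp (X t) y).
Proof.
  intros HX HT.
  assert (Sq : forall t, Mmul (X t) (X t) = Mscal (Copp (Mdet (X t))) Mid).
  { intros t. specialize (HT t). revert HT. generalize (X t). intros A HT.
    assert (T : a22 A = Copp (a11 A)).
    { unfold Mtr in HT. replace (a22 A) with (Csub (Cadd (a11 A) (a22 A)) (a11 A)) by ring. rewrite HT. ring. }
    unfold Mdet. apply M2_eq; simpl; rewrite T; ring. }
  eapply MC2_ext; [intros t; symmetry; apply Mexp_entire, Sq|].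
  assert (Kp : CC2 (fun t => Cmul (Copp (Mdet (X t))) (Cr (y * y)))).
  { destruct HX as (H1 & H2 & H3 & H4). apply CC2_mul; [|apply CC2_const].
    apply CC2_opp. unfold Mdet, Csub. apply CC2_add; [now apply CC2_mul|]. apply CC2_opp. now apply CC2_mul. }
  pose proof (CC2_CPS ch _ Dom_ch Kp) as C1. pose proof (CC2_CPS sh _ Dom_sh Kp) as C2.
  pose proof (CC2_mul _ _ (CC2_const (Cr y)) C2) as C3. cbv beta in C3.
  destruct HX as (H1 & H2 & H3 & H4).
  split; [|split; [|split]]; simpl; apply CC2_add; apply CC2_mul; assumption || apply CC2_const.
Qed.

Lemma Dpot_MC2 a b c : MC2 (fun t => Dpot a b c (Ccis t)).
Proof.
  assert (Ic : CC2 (fun t => Cinv (Ccis t))).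
  { eapply CC2_ext; [intros t; symmetry; apply (Cinv_unit _ (Cabs_cis t))|]. apply CC2_conj, CC2_cis. }
  split; [|split; [|split]]; cbn [a11 a12 a21 a22 Dpot].
  - apply CC2_const.
  - apply CC2_add; apply CC2_mul; try assumption; try apply CC2_cis; apply CC2_const.
  - apply CC2_add; apply CC2_mul; try assumption; try apply CC2_cis; apply CC2_const.
  - apply CC2_const.
Qed.

Lemma Vplus_MC2 b x : Cnormsq b < 9 -> MC2 (fun t => Vplus b x (Ccis t)).
Proof.
  intros HN. pose proof (Cnormsq_nonneg b) as N0.
  assert (HN' : 0 <= Cnormsq b < 9) by lra.
  pose proof (w1f_continuous _ HN') as C1. pose proof (w2f_continuous _ HN') as C2.
  unfold Vplus, rfun, sfun. cbv zeta.
  split; [|split; [|split]]; cbn [a11 a12 a21 a22]; (apply CC2_mul; [apply CC2_const|apply CC2_CPS; [|apply CC2_cis]]);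
    (apply Dom_rcoef || apply Dom_scoef); auto using Cone_le1, Czero_le1.
Qed.

Lemma S_of_MC2 P : Mdet P = Cone -> MC2 (fun t => S_of P (Ccis t)).
Proof.
  intros Hd. eapply MC2_ext; [intros t; symmetry; apply (S_of_adj P _ (Cabs_cis t) Hd)|].
  apply MC2_adj.
  assert (Ic : CC2 (fun t => Cinv (Ccis t))).
  { eapply CC2_ext; [intros t; symmetry; apply (Cinv_unit _ (Cabs_cis t))|]. apply CC2_conj, CC2_cis. }
  split; [|split; [|split]]; cbn [a11 a12 a21 a22 Sinv_of]; try apply CC2_const;
    apply CC2_mul; try assumption; try apply CC2_cis; apply CC2_const.
Qed.

Lemma iwasawa_factor_MC2 b s x : Cnormsq b < 9 ->
  MC2 (fun t => Mmul (Mexp (Dpot Cone b 2 (Ccis t)) s) (Gfac b x (Ccis t))).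
Proof.
  intros HN. apply MC2_mul.
  - apply (Mexp_MC2 (fun t => Dpot Cone b 2 (Ccis t))); [apply Dpot_MC2|intros; apply Dpot_trace].
  - unfold Gfac. apply MC2_mul; [|now apply MC2_adj, Vplus_MC2].
    apply (Mexp_MC2 (fun t => Mscal Ci (Dpot Cone b 2 (Ccis t)))).
    + apply (MC2_scal (fun _ => Ci)); [apply CC2_const|apply Dpot_MC2].
    + intros t. transitivity (Cmul Ci (Mtr (Dpot Cone b 2 (Ccis t)))); [unfold Mtr; simpl; ring|].
      rewrite Dpot_trace. ring.
Qed.

(** Y is su(1,1)-valued, and so is its derivative. This gives conjugate off-diagonal entries and an
    imaginary diagonal, which is what makes the three coordinates real. *)
Lemma SymHat_exists (F : Loop) : InLoopSU F -> MC2 (fun t => F (Ccis t)) -> exists p, SymHat F (XE p).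
Proof.
  intros HF HC. destruct (MC2_derivs _ HC) as (F' & F'' & H1 & H2).
  pose proof HF as HF'. apply InLoopSU_iff in HF'. destruct HF' as [Hs HR].
  set (h := fun t => F (Ccis t)) in *.
  assert (Hd : forall t, Mdet (h t) = Cone) by (intros t; now apply InLoopSU_det).
  assert (HRh : forall t, RF (h t)) by (intros t; apply HR, Cabs_cis).
  set (lF := fun t => Mscal (Copp Ci) (F' t)).
  assert (Hf : forall t, fL3 F lF t = Ysym h F' t).
  { intros t. unfold fL3, Ysym, Msub, lF. fold (h t). rewrite (Minv_det1 _ (Hd t)).
    generalize (F' t) (h t) (Madj (h t)). intros A B C.
    assert (E : Mscal (Copp Ci) (Mmul (Mscal (Copp Ci) A) C) = Mscal (Copp Cone) (Mmul A C)).
    { generalize (Mscal_mul_l (Copp Ci) A C). intros E0. rewrite E0. generalize (Mmul A C). intros D. msolve; cx_solve. }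
    rewrite E. msolve. }
  assert (YR : forall t, RF (Ysym h F' t)).
  { intros t. unfold Ysym. apply RF_add.
    - change (Copp Cone) with (Copp (Cr 1)). rewrite <- Cr_opp. apply RF_scal.
      apply RF_mul; [exact (RF_deriv h t _ HRh (H1 t))|apply RF_adj, HRh].
    - replace (Mscal (Copp half_i) (Mmul (h t) (Mmul sigma3 (Madj (h t)))))
        with (Mmul (h t) (Mmul (Mscal (Copp half_i) sigma3) (Madj (h t))))
        by (generalize (h t) (Madj (h t)); intros; msolve).
      apply RF_mul; [apply HRh|]. apply RF_mul; [|apply RF_adj, HRh].
      unfold half_i. split; simpl; cx_solve. }
  assert (YT : forall t, Mtr (Ysym h F' t) = Czero).
  { intros t. pose proof (det1_deriv_trace h t _ Hd (H1 t)) as T.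
    pose proof (Mtr_conj (h t) sigma3 (Hd t)) as T2. unfold Ysym, Mtr in *.
    cbn [a11 a22 Madd Mscal].
    transitivity (Cadd (Cmul (Copp Cone) (Cadd (a11 (Mmul (F' t) (Madj (h t)))) (a22 (Mmul (F' t) (Madj (h t))))))
      (Cmul (Copp half_i) (Cadd (a11 (Mmul (h t) (Mmul sigma3 (Madj (h t))))) (a22 (Mmul (h t) (Mmul sigma3 (Madj (h t)))))))); [ring|].
    rewrite T, T2. simpl a11. simpl a22. ring. }
  assert (YD : exists Y', Mderiv_th (Ysym h F') 0 Y').
  { eexists. unfold Ysym. apply Mderiv_add; apply Mderiv_scal_const.
    - apply (Mderiv_mul F' (fun s => Madj (h s))); [apply H2|apply Mderiv_adj, H1].
    - apply (Mderiv_mul h (fun s => Mmul sigma3 (Madj (h s)))); [apply H1|].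
      apply Mderiv_mul_const_l. apply Mderiv_adj, H1. }
  destruct YD as [Y' YD].
  pose proof (RF_deriv _ 0 _ YR YD) as [R1 R2].
  assert (T' : Mtr Y' = Czero).
  { destruct YD as (D1 & _ & _ & D4). unfold Mtr. eapply Cderiv_unique; [apply Cderiv_add; [exact D1|exact D4]|].
    eapply Cderiv_ext; [|apply (Cderiv_const Czero)]. intros s. symmetry. apply (YT s). }
  destruct (YR 0) as [S1 S2]. pose proof (YT 0) as S3.
  set (y := a12 (Ysym h F' 0)) in *.
  (* Solves y = (i/2)(x1 + i x2), that is x1 + i x2 = -2 i y, and i x3 = the (1,1) entry of Y'. *)
  exists (2 * cim y, - 2 * cre y, cim (a11 Y')), lF. split.
  - intros t. exists (F' t). split; [exact (H1 t)|reflexivity].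
  - exists (Mscal (Copp Ci) Y'). split.
    + exists Y'. split; [|reflexivity]. eapply Mderiv_ext; [intros s; symmetry; apply Hf|exact YD].
    + rewrite Hf.
      assert (a11r : cre (a11 Y') = 0).
      { unfold Mtr in T'. rewrite R2 in T'. apply (f_equal cre) in T'. simpl in T'. lra. }
      unfold XE, p1, p2, p3. cbn [fst snd].
      assert (Ey : a21 (Ysym h F' 0) = Cconj y) by exact S1.
      assert (Ey' : a12 (Ysym h F' 0) = y) by reflexivity.
      revert Ey Ey' R2 a11r. generalize (Ysym h F' 0) y Y'. intros A u Z Ey Ey' R2' Zr.
      unfold Msub, Moff, Mdiag, half_i. apply M2_eq; cbn [a11 a12 a21 a22 Madd Mscal E1 E2 E3]; rewrite ?Ey, ?Ey', ?R2';
        apply Cx_eq; simpl; rewrite ?Zr; field.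
Qed.

Theorem generated_exists b P : Cabs (Cadd Cone b) < 2 -> Mdet P = Cone -> RF P ->
  exists (f : Cx -> R3) (U : Cx -> Prop), Generated (Dpot Cone b 2) (S_of P) f U.
Proof.
  intros Hb Hd HR.
  (* |b| <= |1 + b| + 1 < 3. *)
  assert (HN : Cnormsq b < 9).
  { pose proof (Cabs_nonneg b) as b0. rewrite <- Cabs_sqr.
    assert (Cabs b < 3); [|nra].
    replace b with (Cadd (Cadd Cone b) (Copp Cone)) by ring.
    eapply Rle_lt_trans; [apply Cabs_add|]. rewrite Cabs_opp, Cabs_Cone. lra. }
  pose proof (Cnormsq_nonneg b) as N0.
  destruct (Yf_surjective (Cnormsq b)) as (eps & He & HY); [lra|].
  pose proof (S_of_SU P Hd HR) as HS.
  set (U := fun z => Rabs (cim z) < eps).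
  assert (HP : forall z, U z -> exists p, SurfPt (Dpot Cone b 2) (S_of P) z p).
  { intros z Hz. destruct (HY _ Hz) as [x Hx].
    destruct (iwasawa_exp b (cre z) x HN) as (I1 & I2 & I3).
    set (Fh := fun lam => Mmul (Mexp (Dpot Cone b 2 lam) (cre z)) (Gfac b x lam)) in *.
    destruct (SymHat_exists (fun lam => Mmul (S_of P lam) (Fh lam))) as [p Hp].
    - now apply InLoopSU_mul.
    - apply (MC2_mul (fun t => S_of P (Ccis t)) (fun t => Fh (Ccis t))); [now apply S_of_MC2|].
      exact (iwasawa_factor_MC2 b (cre z) x HN).
    - exists p, Fh, (Vplus b x). split; [exact I1|]. split; [exact I2|]. split; [|exact Hp].
      intros lam _. rewrite Hx in I3. destruct z as [zx zy]. apply I3. }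
  (* A point is chosen for each z separately; outside the strip U the value is whatever [epsilon]
     returns, while [Generated] constrains f on U. *)
  exists (fun z => epsilon (inhabits (0, 0, 0)) (fun p => SurfPt (Dpot Cone b 2) (S_of P) z p)), U.
  split; [|split].
  - intros x. unfold U. simpl. now rewrite Rabs_R0.
  - intros z Hz. unfold U in *. exists (eps - Rabs (cim z)). split; [lra|]. intros w Hw.
    replace (cim w) with (cim (Csub w z) + cim z) by (simpl; ring).
    eapply Rle_lt_trans; [apply Rabs_triang|]. pose proof (Cabs_cim (Csub w z)). lra.
  - intros z Hz. apply epsilon_spec. now apply HP.
Qed.

Theorem mainTheorem10 :
  (forall b : Cx,
     Cabs (Cadd Cone b) < 2 -> b <> Copp Cone ->
     exists P : M2,
       good_eigenframe (Dpot Cone b 2 Cone) (ell b) P /\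
       (exists (f : Cx -> R3) (U : Cx -> Prop), Generated (Dpot Cone b 2) (S_of P) f U) /\
       (forall (f : Cx -> R3) (U : Cx -> Prop), Generated (Dpot Cone b 2) (S_of P) f U ->
          Equivariant f U (fun t => helic (alpha_of b) (pitch b) (2 * ell b * t))) /\
       (forall (f : Cx -> R3) (U : Cx -> Prop), Generated (Dpot Cone b 2) (S_of P) f U ->
          (Rotational f U <-> pitch_num b = 0)))
  /\
  (forall (a b : Cx) (c : R) (S : Loop) (f : Cx -> R3) (U : Cx -> Prop),
     InLoopSU S ->
     Generated (Dpot a b c) S f U ->
     (exists z0, U z0 /\ ImmersedAt f z0) ->
     Helicoidal f U ->
     ~ TranslationInvariant f U ->
     exists r : R, 0 < r /\ Mdet (Dpot a b c Cone) = Cr r).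
Proof.
  split.
  - intros b H1 H2. destruct (half_angle_exists b H1 H2) as (n & l & psi & H).
    exists (eigP l psi).
    pose proof (eigP_det _ _ _ _ H) as Hd. pose proof (eigP_RF l psi) as HR.
    split; [now apply eigP_good with n|]. split; [now apply generated_exists|]. split.
    + intros f U HG. now apply eig_equivariant with n l psi.
    + intros f U HG. apply rotational_iff; [exact H1|apply HG|]. now apply eig_equivariant with n l psi.
  - intros a b c S f U HS HG Him Hh _. now apply helicoidal_det_positive with S f U.
Qed.
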